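(* Let $d\in\mathbb{R}$, let $f$ be a majority-type update function with parameters $m,\beta,\gamma$, and let the initial number of vertices with opinion $X$ be $X_0=n/2+d\sqrt{n}+o(\sqrt{n})$. Let $Z\stackrel{d}{=}\mathcal{N}\big(d,\tfrac{1}{4(\gamma^2-1)}\big)$. Let $x,y\in[0,1)$ and let $(n_i)_{i\in\mathbb{N}}$ be an increasing sequence in $\mathbb{N}$ such that, as $i\to\infty$, $$\tfrac12\log_\gamma n_i-\big\lfloor\tfrac12\log_\gamma n_i\big\rfloor\to x\quad\text{and}\quad \log_m\ln n_i-\lfloor\log_m\ln n_i\rfloor\to y.$$ Then, with $h(z)=g(z)+z$, in distribution as $i\to\infty$, $$R_{n_i}(X_0)-\Big(\big\lfloor\tfrac12\log_\gamma n_i\big\rfloor+\lfloor\log_m\ln n_i\rfloor\Big)\to\big\lfloor h(x-\log_\gamma|Z|)+y\big\rfloor.$$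
   Context: Majority-type update function: a function $f:[0,1]\to[0,1]$ such that (i) $f$ is $(m+1)$-times continuously differentiable for some integer $m\ge 2$; (ii) $f$ is convex on $[0,1/2]$; (iii) $1-f(1-x)=f(x)$ for all $x\in[0,1]$; (iv) there exist $\gamma>1$ and $\beta>0$ such that, as $x\to0$, $f(x)=\beta x^m+O(x^{m+1})$ and $f(1/2+x)=1/2+\gamma x+O(x^2)$. The numbers $m,\beta,\gamma$ are called its parameters. Iterates: $f^{(0)}(x)=x$, $f^{(i)}=f\circ f^{(i-1)}$ for $i\ge1$. Process: there are $n$ vertices, each holding opinion $X$ or $Y$. $X_t$ is the number of vertices with opinion $X$ after round $t$. The process $(X_t)_{t\in\mathbb{N}_0}$ (depending on $n$) is the Markov chain with deterministic initial value $X_0\in[0,n]$ (not required to be an integer) and, conditionally on $X_t$, $X_{t+1}\stackrel{d}{=}\mathrm{Bin}(n,f(X_t/n))$. Put $Y_t=n-X_t$. The runtime is $R_n(X_0)=\inf\{t\in\mathbb{N}_0: X_t=n\text{ or }Y_t=n\}$; in $R_{n_i}(X_0)$ the process is the one with $n=n_i$. The function $g:\mathbb{R}\to\mathbb{R}$ associated with $f$ is $$g(x)=1-x+\lim_{a\to\infty,\,a\in\mathbb{N}}\ \lim_{b\to\infty,\,b\in\mathbb{N}}\Big(b-a-\log_m\big|\ln f^{(b)}(1/2-\gamma^{-a-x})\big|\Big)$$ (these limits exist; for given $x$ only $a$ large enough that $1/2-\gamma^{-a-x}>0$ matter). $\mathcal{N}(\mu,\sigma^2)$ is the Gaussian distribution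 with mean $\mu$ and variance $\sigma^2$. *)

(* Defs.v *)
From HB Require Import structures.
From mathcomp Require Import all_boot all_order all_algebra.
From mathcomp Require Import all_classical all_reals all_analysis.
From mathcomp Require Import measurable_realfun.

Set Implicit Arguments.
Unset Strict Implicit.
Unset Printing Implicit Defensive.

Import Order.TTheory GRing.Theory Num.Theory.
Import numFieldNormedType.Exports.

Local Open Scope classical_set_scope.
Local Open Scope ring_scope.

Definition logb (R : realType) (b x : R) : R := ln x / ln b.

(* Derivative relative to A; one-sided at the endpoints of an interval A. *)
Definition is_derive_within (R : realType) (A : set R) (f : R -> R) (x l : R) :=
  (f y - f x) / (y - x) @[y --> within A x^'] --> l.

Definition continuously_differentiable_on (R : realType) (A : set R) (k : nat)
    (f : R -> R) :=
  exists D : nat -> R -> R,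
    [/\ forall x, A x -> D 0%N x = f x,
        forall j x, (j < k)%N -> A x -> is_derive_within A (D j) x (D j.+1 x)
      & {within A, continuous (D k)}].

(* An update function is a total function on R of which only the restriction
   to [0, 1] matters; hence the right neighborhood of 0 in the expansion
   at 0. *)
Record majority_type (R : realType) (f : R -> R) (m : nat) (beta gamma : R) :
    Prop := MajorityType {
  mt_range : forall x, 0 <= x <= 1 -> 0 <= f x <= 1 ;
  mt_m_ge2 : (2 <= m)%N ;
  mt_smooth : continuously_differentiable_on `[0, 1] m.+1 f ;
  mt_convex : @convex_function R R^o `[0, 1 / 2] f ;
  mt_symmetric : forall x, 0 <= x <= 1 -> 1 - f (1 - x) = f x ;
  mt_gamma_gt1 : 1 < gamma ;
  mt_beta_gt0 : 0 < beta ;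
  mt_expand0 :
    (fun x => f x - beta * x ^+ m) =O_ (0^'+) (fun x => x ^+ m.+1) ;
  mt_expand_half :
    (fun x => f (1 / 2 + x) - (1 / 2 + gamma * x)) =O_ (0 : R)
      (fun x => x ^+ 2) }.

(* For fixed x, only finitely many a have 1/2 - gamma^(-a-x) <= 0, so the
   values of f outside [0, 1] do not affect the limit over a. *)
Definition g_fun (R : realType) (f : R -> R) (m : nat) (gamma x : R) : R :=
  1 - x +
  lim ((lim ((b%:R - a%:R
              - logb m%:R `|ln (iter b f (1 / 2 - gamma `^ (- a%:R - x)))|)
             @[b --> \oo]) : R) @[a --> \oo]).

Definition h_fun (R : realType) (f : R -> R) (m : nat) (gamma z : R) : R :=
  g_fun f m gamma z + z.

(* The last clause is the Markov property with transition law
   Bin(n, f(X_t / n)), multiplied out so that histories of probability 0 are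
   harmless. It fixes all finite-dimensional laws: the masses of the binomial
   law on nat sum to 1, so X_t is almost surely a natural number for t > 0. *)
Definition majority_process (R : realType) (f : R -> R) (n : nat) (x0 : R)
    (d : measure_display) (T : measurableType d) (P : probability T R)
    (X : nat -> {RV P >-> R}) :=
  [/\ 0 <= x0 <= n%:R,
      P [set w | X 0%N w = x0] = 1%E
    & forall (t : nat) (s : nat -> R) (k : nat),
        P [set w | (forall i, (i <= t)%N -> X i w = s i) /\ X t.+1 w = k%:R]
        = (P [set w | forall i, (i <= t)%N -> X i w = s i]
           * binomial_prob n (f (s t / n%:R)%R) [set k])%E].

(* Infimum in the extended reals: +oo if consensus is never reached. *)
Definition runtime (R : realType) (n : nat) (T : Type) (X : nat -> T -> R)
    (w : T) : \bar R :=
  ereal_inf [set (t%:R : R)%:E | t in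
    [set t : nat | X t w = n%:R \/ n%:R - X t w = n%:R]].

(* Convergence in law of random variables living on possibly different
   probability spaces: pointwise convergence of distribution functions at the
   continuity points of the limiting one. *)
Definition cvg_in_distribution (R : realType)
    (d : nat -> measure_display) (T : forall i, measurableType (d i))
    (P : forall i, probability (T i) R) (U : forall i, T i -> \bar R)
    (d' : measure_display) (T' : measurableType d') (Q : probability T' R)
    (V : T' -> \bar R) :=
  [/\ forall i, measurable_fun [set: T i] (U i),
      measurable_fun [set: T'] V
    & forall r : R,
        {for r, continuous (fun s : R => Q [set w | (V w <= s%:E)%E])} ->
        P i [set w | (U i w <= r%:E)%E] @[i --> \oo]
          --> Q [set w | (V w <= r%:E)%E]].

(* Main.v *)
Require Import Defs.
From HB Require Import structures.
From mathcomp Require Import all_boot all_order all_algebra.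
From mathcomp Require Import all_classical all_reals all_analysis.
From mathcomp Require Import measurable_realfun ring lra zify.

Set Implicit Arguments.
Unset Strict Implicit.
Unset Printing Implicit Defensive.

Import Order.TTheory GRing.Theory Num.Theory.
Import numFieldNormedType.Exports.

Local Open Scope classical_set_scope.
Local Open Scope ring_scope.

(** The runtime splits into a stage in which the difference between the two
opinions becomes macroscopic and a stage in which the minority dies out; only
the first few rounds are truly random.

Near 1/2 a deviation of the share of an opinion is multiplied by [gamma] in
each round. A deviation of order [1 / sqrt n] thus becomes macroscopic in about
[1/2 * logb gamma n] rounds. Near 0 the minority share behaves like
[u |-> beta * u ^+ m] and falls below [1 / n] in about [logb m (ln n)] rounds.
The two clocks are compared by the Bottcher coordinate [bottcher] of [f] at 0,
which satisfies [bottcher (f u) = m * bottcher u]; its logarithm [abel] makes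
rounds additive. Starting it at the deviations [gamma `^ (- a - z)], which are
[gamma `^ (- z)] after [a] linearized rounds, gives a sequence [abel_orbit z]
with limit [1 - h z] ([abel_orbit_cvg]). Convexity makes this sequence monotone,
and a family of points with a quadratic correction encloses it from the other
side; this enclosure also shows that [h] is strictly increasing ([h_lt]), so
that it crosses each level at one point ([h_crossing]).

In the first rounds the deviation of the state from [n / 2], divided by
[sqrt n], is multiplied by [gamma] and receives an independent noise of variance
1/4. The variance [s = 1 / (4 * (gamma ^+ 2 - 1))] satisfies
[s + 1/4 = gamma ^+ 2 * s]. Hence normal distribution functions of this
variance, used as test functions, are reproduced by a round up to
[O(1 / sqrt n)] and a scaling of the argument by [gamma] ([test_step]); the
proof replaces the binomial trials one at a time by the heat flow. So for every
fixed [a] the expectation of a test function after [a] rounds converges to a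
probability about [Z] ([test_limit]), and for large [a] the test functions
resemble indicators ([smoothing_error]).

After [a] rounds the process follows [f]: Chebyshev's inequality near 1/2
([early_fast], [early_slow]) and at intermediate shares ([middle_fast],
[middle_slow]), and Markov's or Chebyshev's inequality near 0 ([late_fast],
[late_slow]) show that the remaining rounds lead to consensus with probability
close to 1 or to 0, depending on whether the deviation is above or below
[gamma ^+ a * rho], up to an error of order [gamma ^- (2 * a)] ([fast_total],
[slow_total]). The critical [rho] is the one for which [x - logb gamma rho] is
the point where [h] crosses [k + 1 - y], if [k] is the number of rounds allowed
beyond the two integer parts. As the probability of a runtime of at most [t] is
the [t]-th iterate of the transition operator at the indicator of consensus
([hitting_law]), it converges to the probability of [rho < `|Z|], that is, of
[floor (h (x - logb gamma `|Z|) + y) <= k] ([limit_value_tail]). *)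

(** Keeps long contexts out of a problem of linear arithmetic. *)
Ltac lra_goal :=
  repeat match goal with
  | H : is_true _ |- _ => clear H
  | H : _ = _ |- _ => clear H
  end; lra.

(** * Update functions near 0 and near 1/2 *)

Section UpdateFunction.
Context {R : realType} (f : R -> R) (m : nat) (beta gamma : R).
Context (hf : majority_type f m beta gamma).

Let gamma_gt1 : 1 < gamma. Proof. exact: mt_gamma_gt1 hf. Qed.
Let beta_gt0 : 0 < beta. Proof. exact: mt_beta_gt0 hf. Qed.
Let m_ge2 : (2 <= m)%N. Proof. exact: mt_m_ge2 hf. Qed.

Lemma update_convex (t x y : R) : 0 <= t <= 1 -> 0 <= x <= 1 / 2 ->
  0 <= y <= 1 / 2 -> f (t * x + (1 - t) * y) <= t * f x + (1 - t) * f y.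
Proof.
move=> /andP[t0 t1] hx hy.
have /(_ (Itv01 t0 t1) x y) := mt_convex hf.
rewrite !convRE /=; apply.
- by rewrite inE /= in_itv.
- by rewrite inE /= in_itv.
Qed.

Lemma update_expand0 : exists2 C, 0 < C & exists2 x0, 0 < x0 &
  forall x, 0 < x < x0 -> `|f x - beta * x ^+ m| <= C * x ^+ m.+1.
Proof.
have /eqO_exP[C C0 hC] := mt_expand0 hf.
exists C => //.
move: hC; rewrite /at_right /= => /nbhs_ballP[e /= e0 he].
exists e => // x /andP[x0 xe].
have := he x; rewrite /= /ball/= sub0r normrN gtr0_norm// => /(_ xe x0).
by rewrite (@ger0_norm _ (x ^+ _)) // exprn_ge0 // ltW.
Qed.

Lemma update_expand_half_local : exists2 C, 0 < C & exists2 x0, 0 < x0 &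
  forall x, `|x| < x0 -> `|f (1 / 2 + x) - (1 / 2 + gamma * x)| <= C * x ^+ 2.
Proof.
have /eqO_exP[C C0 hC] := mt_expand_half hf.
exists C => //.
move: hC => /nbhs_ballP[e /= e0 he].
exists e => // x xe.
have := he x; rewrite /= /ball/= sub0r normrN => /(_ xe).
by rewrite (@ger0_norm _ (x ^+ _)) // sqr_ge0.
Qed.

Lemma update_half : f (1 / 2) = 1 / 2.
Proof.
have := mt_symmetric hf (x := 1 / 2); have -> : 1 - 1 / 2 = 1 / 2 :> R by lra.
move=> /(_ _); have h : 0 <= (1 / 2 : R) <= 1 by lra.
by move=> /(_ h); lra.
Qed.

(** Differentiability makes [f] continuous at 0, and then the expansion at 0
determines the value there. *)
Lemma update0 : f 0 = 0.
Proof.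
have g1 := gamma_gt1; have b0 := beta_gt0.
have [C C0 [x0 x00 hC]] := update_expand0.
have [D [D0 D1 _]] := mt_smooth hf.
have /D1 : (0 < m.+1)%N by [].
have h01 : `[0, 1]%classic (0 : R) by rewrite /= in_itv /= lexx ler01.
move=> /(_ 0 h01) hD.
set l := D 1%N 0 in hD.
apply/eqP; rewrite -normr_le0; apply/ler_addgt0Pr => e e0; rewrite add0r.
move: hD => /cvgrPdist_le /(_ 1 ltr01) /=.
rewrite /dnbhs /within /= => /nbhs_ballP[r /= r0 hr].
pose K := `|l| + 1 + beta + C.
have K0 : 0 < K by rewrite /K; have := normr_ge0 l; lra.
pose x := Num.min (1 / 2) (Num.min (x0 / 2) (Num.min (r / 2) (e / K))).
have xpos : 0 < x by rewrite /x !lt_min !divr_gt0 //=; lra.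
have x1 : x <= 1 / 2 by rewrite /x ge_min lexx.
have x2 : x <= x0 / 2 by rewrite /x !ge_min lexx orbT.
have x3 : x <= r / 2 by rewrite /x !ge_min lexx !orbT.
have x4 : x <= e / K by rewrite /x !ge_min lexx !orbT.
have hx01 : `[0, 1]%classic x by rewrite /= in_itv /=; lra.
have := hr x; rewrite /= /ball /= sub0r normrN gtr0_norm // => h.
have /h {}h : x < r by lra.
have /h/(_ hx01) {h} : x != 0 by rewrite gt_eqF.
rewrite !D0 // subr0 => h1.
have h2 : `|f x| <= (beta + C) * x.
  have := hC x; have -> : 0 < x < x0 by lra.
  move=> /(_ isT) h2.
  have -> : f x = (f x - beta * x ^+ m) + beta * x ^+ m by ring.
  apply: (le_trans (ler_normD _ _)).
  rewrite mulrDl addrC lerD //.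
    rewrite normrM (gtr0_norm beta_gt0) ler_pM2l // ger0_norm ?exprn_ge0 ?(ltW xpos) //.
    rewrite -[leRHS]expr1; apply: ler_wiXn2l; [lra|lra|exact: ltnW].
  apply: (le_trans h2); rewrite ler_pM2l //.
  by rewrite -[leRHS]expr1; apply: ler_wiXn2l; [lra|lra|].
have h3 : `|f x - f 0| <= (`|l| + 1) * x.
  have : `|(f x - f 0) / x| <= `|l| + 1.
    have -> : (f x - f 0) / x = l - (l - (f x - f 0) / x) by ring.
    by rewrite (le_trans (ler_normB _ _)) // lerD2l.
  by rewrite normrM normfV (gtr0_norm xpos) ler_pdivrMr.
have -> : f 0 = f x - (f x - f 0) by ring.
apply: (le_trans (ler_normB _ _)).
move: x4; rewrite ler_pdivlMr // => x4.
have : K * x = (beta + C) * x + (`|l| + 1) * x by rewrite /K; ring.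
lra.
Qed.

Lemma update_ge0 x : 0 <= x <= 1 -> 0 <= f x.
Proof. by move=> /(mt_range hf)/andP[]. Qed.

(** A convex function that vanishes at 0 is starshaped: the slopes of its chords
from the origin increase. *)
Lemma update_star x y : 0 <= x <= y -> y <= 1 / 2 -> f x * y <= x * f y.
Proof.
move=> /andP[x0 xy] y1; have [y0|y0] := eqVneq y 0.
  have -> : x = 0 by lra.
  by rewrite y0 update0; lra.
have y0' : 0 < y by lra.
have := @update_convex (x / y) y 0.
have -> : 0 <= x / y <= 1.
  by rewrite divr_ge0 ?ler_pdivrMr ?mul1r ?xy //; lra.
have -> : 0 <= y <= 1 / 2 by lra.
have -> : 0 <= (0 : R) <= 1 / 2 by lra.
rewrite update0 !mulr0 !addr0 divfK // => /(_ isT isT isT).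
by rewrite mulrAC ler_pdivlMr.
Qed.

Lemma update_le_id x : 0 <= x <= 1 / 2 -> f x <= x.
Proof.
move=> /andP[x0 x1]; have := @update_star x (1 / 2).
by rewrite x0 x1 lexx update_half => /(_ isT isT); lra.
Qed.

Lemma update_mono x y : 0 <= x <= y -> y <= 1 / 2 -> f x <= f y.
Proof.
move=> /andP[x0 xy] y1; have [y0|y0] := eqVneq y 0.
  by have -> : x = y by lra.
have y0' : 0 < y by lra.
have := @update_star x y; rewrite x0 xy y1 => /(_ isT isT) h.
rewrite -(ler_pM2r y0'); apply: (le_trans h).
by rewrite mulrC ler_wpM2l // update_ge0; lra.
Qed.

Lemma update_in_half x : 0 <= x <= 1 / 2 -> 0 <= f x <= 1 / 2.
Proof. by move=> hx; rewrite update_ge0 /=; have := update_le_id hx; lra. Qed.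

Lemma update_equiv0 e : 0 < e -> exists2 x0, 0 < x0 <= 1 / 2 &
  forall x, 0 < x <= x0 -> `|f x - beta * x ^+ m| <= e * x ^+ m.
Proof.
move=> e0; have [C C0 [x0 x00 hC]] := update_expand0.
have h1 : 0 < e / C by rewrite divr_gt0.
exists (Num.min (1 / 2) (Num.min (x0 / 2) (e / C))).
  by rewrite !lt_min ge_min lexx /=; lra.
move=> x; rewrite !le_min => /andP[xpos /and3P[x1 x2 x3]].
apply: (le_trans (hC x _)); first by lra.
rewrite exprS mulrA ler_wpM2r ?exprn_ge0 ?(ltW xpos) //.
by rewrite mulrC -ler_pdivlMr.
Qed.

Lemma update_gt0 x : 0 < x <= 1 / 2 -> 0 < f x.
Proof.
have g1 := gamma_gt1; have b0 := beta_gt0.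
move=> /andP[x0 x1].
have b2 : 0 < beta / 2 by rewrite divr_gt0.
have [z0 /andP[z00 z01] hz] := update_equiv0 b2.
pose z := Num.min x z0.
have zx : z <= x by rewrite /z ge_min lexx.
have zpos : 0 < z by rewrite /z lt_min x0.
apply: (@lt_le_trans _ _ (f z)); last by apply: update_mono => //; lra.
have := hz z; rewrite zpos /z ge_min lexx orbT -/z => /(_ isT).
have : 0 < z ^+ m by rewrite exprn_gt0.
rewrite ler_norml => zm /andP[h _].
have : 0 < beta * z ^+ m by rewrite mulr_gt0.
lra.
Qed.

(** The chord from [1/2 - e] to [1/2] lies above the graph, which near 1/2
follows the line of slope [gamma]; so the chord is no steeper than this line. *)
Lemma update_ge_tangent e : 0 <= e <= 1 / 2 -> 1 / 2 - gamma * e <= f (1 / 2 - e).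
Proof.
move=> /andP[e0 e1]; have [->|en0] := eqVneq e 0.
  by rewrite mulr0 !subr0 update_half.
have epos : 0 < e by lra.
have [C C0 [x0 x00 hC]] := update_expand_half_local.
apply/ler_addgt0Pr => r r0.
pose t := Num.min 1 (Num.min (x0 / (2 * e)) (r / (C * e ^+ 2))).
have e2 : 0 < e ^+ 2 by rewrite exprn_gt0.
have tpos : 0 < t by rewrite /t !lt_min ltr01 !divr_gt0 // ?mulr_gt0.
have t1 : t <= 1 by rewrite /t ge_min lexx.
have t2 : t * (2 * e) <= x0.
  by rewrite -ler_pdivlMr ?/t ?ge_min ?lexx ?orbT //; lra.
have t3 : t * (C * e ^+ 2) <= r.
  by rewrite -ler_pdivlMr ?/t ?ge_min ?lexx ?orbT // mulr_gt0.
have := @update_convex t (1 / 2 - e) (1 / 2); rewrite (ltW tpos) t1 update_half.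
have -> : 0 <= 1 / 2 - e <= 1 / 2 by lra.
have -> : 0 <= (1 / 2 : R) <= 1 / 2 by lra.
move=> /(_ isT isT isT).
have -> : t * (1 / 2 - e) + (1 - t) * (1 / 2) = 1 / 2 + - (t * e) by ring.
have tepos : 0 < t * e by rewrite mulr_gt0.
have := hC (- (t * e)); rewrite normrN gtr0_norm //.
have -> : t * e < x0 by lra.
move=> /(_ isT); rewrite ler_norml => /andP[h1 _] h2.
have h3 : t * (1 / 2 - gamma * e - t * (C * e ^+ 2)) <= t * f (1 / 2 - e).
  have -> : t * (1 / 2 - gamma * e - t * (C * e ^+ 2)) =
    t / 2 - gamma * (t * e) - C * (- (t * e)) ^+ 2 by ring.
  lra.
by move: h3; rewrite ler_pM2l //; lra.
Qed.

Lemma update_reflect x : 0 <= x <= 1 -> f (1 - x) = 1 - f x.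
Proof. by move=> hx; have := mt_symmetric hf hx; lra. Qed.

(** On [0, 1/2] the graph runs between the tangent at 1/2 and the diagonal; the
symmetry transfers this to [1/2, 1]. *)
Lemma update_half_lipschitz x : 0 <= x <= 1 ->
  `|f x - 1 / 2| <= gamma * `|x - 1 / 2|.
Proof.
have g1 := gamma_gt1; have b0 := beta_gt0.
have key z : 0 <= z <= 1 / 2 -> `|f z - 1 / 2| <= gamma * `|z - 1 / 2|.
  move=> hz; have hz' := update_le_id hz.
  have := @update_ge_tangent (1 / 2 - z); rewrite subKr => /(_ _).
  have -> : 0 <= 1 / 2 - z <= 1 / 2 by lra.
  move=> /(_ isT) h; rewrite !ler0_norm; lra.
move=> hx; have [x1|x1] := leP x (1 / 2); first by apply: key; lra.
have := key (1 - x); rewrite update_reflect //.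
have -> : 1 - f x - 1 / 2 = - (f x - 1 / 2) by lra.
have -> : 1 - x - 1 / 2 = - (x - 1 / 2) by lra.
by rewrite !normrN; apply; lra.
Qed.

(** Outside the range of the local expansion, [x ^+ 2] dominates [`|x|] and
absorbs the Lipschitz bound. *)
Lemma update_expand_half : exists2 C, 0 < C &
  forall x, `|x| <= 1 / 2 -> `|f (1 / 2 + x) - (1 / 2 + gamma * x)| <= C * x ^+ 2.
Proof.
have g1 := gamma_gt1; have b0 := beta_gt0.
have [C C0 [x0 x00 hC]] := update_expand_half_local.
have h0 : 0 < 2 * gamma / x0 by rewrite divr_gt0 //; lra.
exists (C + 2 * gamma / x0); first by lra.
move=> x hx; have x2 : 0 <= x ^+ 2 := sqr_ge0 x.
have [xx0|xx0] := ltP `|x| x0.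
  by apply: (le_trans (hC _ xx0)); rewrite ler_wpM2r //; lra.
have := @update_half_lipschitz (1 / 2 + x); move: (hx).
rewrite ler_norml => hx' /(_ ltac:(lra)).
have -> : 1 / 2 + x - 1 / 2 = x by ring.
move=> h1.
have -> : f (1 / 2 + x) - (1 / 2 + gamma * x) =
  (f (1 / 2 + x) - 1 / 2) - gamma * x by ring.
apply: (le_trans (ler_normB _ _)).
rewrite normrM (@gtr0_norm _ gamma); last by lra.
apply: (@le_trans _ _ (2 * gamma / x0 * x ^+ 2)); last first.
  by rewrite ler_wpM2r //; lra.
have -> : x ^+ 2 = `|x| ^+ 2 by rewrite real_normK // num_real.
have : 2 * gamma * `|x| <= 2 * gamma / x0 * `|x| ^+ 2.
  rewrite -mulrA [X in _ <= X]mulrAC -[X in _ <= X]mulrA -mulrA ler_pM2l //.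
  rewrite ler_pM2l; last by lra.
  by rewrite ler_pdivlMr // expr2 ler_wpM2l.
lra.
Qed.

(** By convexity no chord slope on [0, 1/2] exceeds the slope at 1/2. *)
Lemma update_lipschitz x y : 0 <= x <= y -> y <= 1 / 2 ->
  f y - f x <= gamma * (y - x).
Proof.
have g1 := gamma_gt1; have b0 := beta_gt0.
move=> /andP[x0 xy] y1.
have [xh|xh] := eqVneq x (1 / 2).
  have -> : y = x by lra.
  by rewrite !subrr mulr0.
have xh' : 0 < 1 / 2 - x by lra.
pose t := (1 / 2 - y) / (1 / 2 - x).
have ht : t * (1 / 2 - x) = 1 / 2 - y by rewrite /t divfK // gt_eqF.
have := @update_convex t x (1 / 2); rewrite update_half.
have -> : t * x + (1 - t) * (1 / 2) = y by lra.
have -> : 0 <= t <= 1.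
  by rewrite /t divr_ge0 ?ler_pdivrMr //=; lra.
have -> : 0 <= x <= 1 / 2 by lra.
have -> : 0 <= (1 / 2 : R) <= 1 / 2 by lra.
move=> /(_ isT isT isT) h1.
have := @update_ge_tangent (1 / 2 - x); rewrite subKr.
have -> : 0 <= 1 / 2 - x <= 1 / 2 by lra.
move=> /(_ isT) h2.
have t1 : t <= 1 by rewrite /t ler_pdivrMr //; lra.
have : (1 - t) * (1 / 2 - f x) <= (1 - t) * (gamma * (1 / 2 - x)).
  by rewrite ler_wpM2l //; lra.
have -> : (1 - t) * (gamma * (1 / 2 - x)) = gamma * (y - x).
  have -> : y = 1 / 2 - t * (1 / 2 - x) by lra.
  by ring.
lra.
Qed.

(** Near 1/2 the slope is [gamma > 1], so [f] drops below the diagonal there;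
the chord inequality through the origin carries this to all of (0, 1/2). *)
Lemma update_lt_id x : 0 < x < 1 / 2 -> f x < x.
Proof.
have g1 := gamma_gt1; have b0 := beta_gt0.
move=> /andP[x0 x1].
have [C C0 hC] := update_expand_half.
have h0 : 0 < (gamma - 1) / (2 * C) by rewrite divr_gt0 //; lra.
pose e := Num.min (1 / 2 - x) ((gamma - 1) / (2 * C)).
have e0 : 0 < e by rewrite /e lt_min h0 andbT; lra.
have e1 : e <= 1 / 2 - x by rewrite /e ge_min lexx.
have e2 : C * e * 2 <= gamma - 1.
  have : e <= (gamma - 1) / (2 * C) by rewrite /e ge_min lexx orbT.
  by rewrite ler_pdivlMr; lra.
have hy : f (1 / 2 - e) < 1 / 2 - e.
  have := hC (- e); rewrite normrN gtr0_norm // => /(_ ltac:(lra)).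
  rewrite ler_norml => /andP[_].
  have : C * (- e) ^+ 2 = (C * e) * e by ring.
  have : (C * e) * e <= (gamma - 1) / 2 * e by rewrite ler_wpM2r //; lra.
  have : 0 < (gamma - 1) / 2 * e by rewrite mulr_gt0 //; lra.
  lra.
have := @update_star x (1 / 2 - e).
have -> : 0 <= x <= 1 / 2 - e by lra.
have -> : 1 / 2 - e <= 1 / 2 by lra.
move=> /(_ isT isT) h.
have y0 : 0 < 1 / 2 - e by lra.
rewrite -(ltr_pM2r y0); apply: (le_lt_trans h).
by rewrite ltr_pM2l.
Qed.

(** The expansion at 0 covers small [u]; on the rest of (0, 1/2] both
logarithms are bounded. *)
Lemma update_ln_bound : exists2 C, 0 <= C &
  forall u, 0 < u <= 1 / 2 -> `|ln (f u) - m%:R * ln u| <= C.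
Proof.
have g1 := gamma_gt1; have b0 := beta_gt0.
have b2 : 0 < beta / 2 by rewrite divr_gt0.
have [z /andP[z0 z1] hz] := update_equiv0 b2.
have fz : 0 < f z by rewrite update_gt0 // z0.
pose C := `|ln (beta / 2)| + `|ln (2 * beta)| + `|ln (f z)| + m%:R * `|ln z|
  + m%:R * `|ln (1 / 2 : R)|.
exists C; first by rewrite /C !addr_ge0 // mulr_ge0.
move=> u /andP[u0 u1].
have fu : 0 < f u by rewrite update_gt0 // u0.
have mu : m%:R * ln u = ln (u ^+ m) by rewrite lnXn // mulr_natl.
have um : 0 < u ^+ m by rewrite exprn_gt0.
have mr : 0 <= (m%:R : R) by [].
have := mulr_ge0 mr (normr_ge0 (ln z)).
have := mulr_ge0 mr (normr_ge0 (ln (1 / 2 : R))).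
have := normr_ge0 (ln (f z)).
have [uz|uz] := leP u z.
  have := hz u; rewrite u0 uz => /(_ isT); rewrite ler_norml => /andP[h1 h2].
  have h3 : ln (beta / 2 * u ^+ m) <= ln (f u).
    by rewrite ler_ln ?posrE ?mulr_gt0 //; lra.
  have h4 : ln (f u) <= ln (2 * beta * u ^+ m).
    by rewrite ler_ln ?posrE ?mulr_gt0 //; lra.
  have e1 : ln (beta / 2 * u ^+ m) = ln (beta / 2) + ln (u ^+ m).
    by rewrite lnM ?posrE.
  have e2 : ln (2 * beta * u ^+ m) = ln (2 * beta) + ln (u ^+ m).
    by rewrite lnM ?posrE //; lra.
  move: h3 h4; rewrite e1 e2 mu /C ler_norml.
  have := ler_norm (ln (2 * beta)).
  have := lerNnormlW (lexx `|ln (beta / 2)|).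
  have := normr_ge0 (ln (beta / 2)). have := normr_ge0 (ln (2 * beta)).
  by lra.
have h1 : f z <= f u by apply: update_mono => //; lra.
have h2 : f u <= 1 / 2 by have /andP[] := update_in_half (x := u) ltac:(lra).
have h3 : ln (f z) <= ln (f u) by rewrite ler_ln ?posrE.
have h4 : ln (f u) <= ln (1 / 2) by rewrite ler_ln ?posrE //; lra.
have h5 : ln z <= ln u by rewrite ler_ln ?posrE // ltW.
have h6 : ln u <= ln (1 / 2) by rewrite ler_ln ?posrE //; lra.
have h7 : ln (1 / 2 : R) <= 0 by rewrite ln_le0 // ler_pdivrMr // mul1r ler1n.
have h8 : m%:R * ln z <= m%:R * ln u by rewrite ler_wpM2l.
have h9 : m%:R * ln u <= 0 by rewrite mulr_ge0_le0 //; lra.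
rewrite /C ler_norml.
have := ler_norm (- ln (f z)). have := ler_norm (- ln z).
rewrite !normrN => k1 k2.
have : m%:R * - ln z <= m%:R * `|ln z| by rewrite ler_wpM2l.
have := normr_ge0 (ln (beta / 2)). have := normr_ge0 (ln (2 * beta)).
rewrite mulrN.
by lra.
Qed.

Lemma update_ln_equiv e : 0 < e -> exists2 x0, 0 < x0 <= 1 / 2 &
  forall u, 0 < u <= x0 -> `|ln (f u) - m%:R * ln u - ln beta| <= e.
Proof.
have g1 := gamma_gt1; have b0 := beta_gt0.
move=> e0.
pose r := Num.min (beta * (expR e - 1)) (beta * (1 - expR (- e))).
have E1 : 1 < expR e by rewrite expR_gt1.
have E2 : expR (- e) < 1 by rewrite expR_lt1 oppr_lt0.
have r0 : 0 < r by rewrite /r lt_min !mulr_gt0 ?subr_gt0.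
have [z /andP[z0 z1] hz] := update_equiv0 r0.
exists z; first by rewrite z0.
move=> u /andP[u0 uz]; have fu : 0 < f u by rewrite update_gt0 // u0; lra.
have um : 0 < u ^+ m by rewrite exprn_gt0.
have mu : m%:R * ln u = ln (u ^+ m) by rewrite lnXn // mulr_natl.
have := hz u; rewrite u0 uz => /(_ isT); rewrite ler_norml => /andP[h1 h2].
have r1 : r <= beta * (expR e - 1) by rewrite /r ge_min lexx.
have r2 : r <= beta * (1 - expR (- e)) by rewrite /r ge_min lexx orbT.
have h3 : f u <= expR e * beta * u ^+ m.
  have : r * u ^+ m <= beta * (expR e - 1) * u ^+ m by rewrite ler_wpM2r // ltW.
  lra.
have h4 : expR (- e) * beta * u ^+ m <= f u.
  have : r * u ^+ m <= beta * (1 - expR (- e)) * u ^+ m by rewrite ler_wpM2r // ltW.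
  lra.
have : ln (f u) <= ln (expR e * beta * u ^+ m).
  by rewrite ler_ln ?posrE ?mulr_gt0 ?expR_gt0.
have : ln (expR (- e) * beta * u ^+ m) <= ln (f u).
  by rewrite ler_ln ?posrE ?mulr_gt0 ?expR_gt0.
rewrite !lnM ?posrE ?mulr_gt0 ?expR_gt0 // !expRK mu ler_norml.
lra.
Qed.

End UpdateFunction.

(** * The Bottcher coordinate at 0 *)

Section Bottcher.
Context {R : realType} (f : R -> R) (m : nat) (beta gamma : R).
Context (hf : majority_type f m beta gamma).

(** The Bottcher coordinate of the superattracting fixed point 0, in
logarithmic form: it conjugates [f] to the multiplication by [m]. *)
Definition bottcher (u : R) : R :=
  lim ((- ln (iter b f u)) / m%:R ^+ b @[b --> \oo]).

Lemma m_gt1 : 1 < m%:R :> R.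
Proof. by rewrite ltr1n; exact: mt_m_ge2 hf. Qed.

Lemma iter_update_in b u : 0 < u <= 1 / 2 -> 0 < iter b f u <= 1 / 2.
Proof.
move=> hu; elim: b => //= b /andP[i0 i1].
by rewrite (update_gt0 hf) ?i0 //=; have := update_le_id hf (x := iter b f u) ltac:(lra); lra.
Qed.

Lemma iter_update_le b u x0 : 0 < u <= x0 -> x0 <= 1 / 2 ->
  0 < iter b f u <= x0.
Proof.
move=> hu hx; elim: b => //= b /andP[i0 i1].
by rewrite (update_gt0 hf) ?i0 //=; have := update_le_id hf (x := iter b f u) ltac:(lra); lra.
Qed.

(** If [ln (f w)] is [m * ln w + c] up to an error [C], the renormalized
logarithms shifted by the fixed point [- c / (m - 1)] of the recursion are
caught between two monotone sequences. *)
Lemma bottcher_bound c C x0 u : 0 <= C -> 0 < u <= x0 -> x0 <= 1 / 2 ->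
  (forall w, 0 < w <= x0 -> `|ln (f w) - m%:R * ln w - c| <= C) ->
  (- ln (iter b f u)) / m%:R ^+ b @[b --> \oo] --> bottcher u /\
  `|bottcher u + ln u + c / (m%:R - 1)| <= C / (m%:R - 1).
Proof.
move=> C0 hu hx0 hC; have m1 := m_gt1.
pose M : R := m%:R; pose L b := - ln (iter b f u).
pose k := - c / (M - 1); pose D := C / (M - 1).
have M1 : 0 < M - 1 by rewrite /M; lra.
have D0 : 0 <= D by rewrite /D divr_ge0 // ltW.
have kE : k * (M - 1) = - c by rewrite /k divfK // gt_eqF.
have DE : D * (M - 1) = C by rewrite /D divfK // gt_eqF.
have M0 : 0 < M by rewrite /M; lra.
have Mb b : 0 < M ^+ b by rewrite exprn_gt0.
have step b : M * L b + k - M * k * 0 - c - C <= L b.+1 + k <= M * L b + k - c + C.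
  have := hC _ (iter_update_le b hu hx0); rewrite ler_norml /L iterS -/M.
  lra.
have up : forall b, (L b.+1 + k + D) / M ^+ b.+1 <= (L b + k + D) / M ^+ b.
  move=> b; rewrite exprS invfM mulrA ler_wpM2r ?invr_ge0 ?(ltW (Mb _)) //.
  by rewrite ler_pdivrMr //; have := step b; lra.
have dn : forall b, (L b + k - D) / M ^+ b <= (L b.+1 + k - D) / M ^+ b.+1.
  move=> b; rewrite exprS invfM mulrA ler_wpM2r ?invr_ge0 ?(ltW (Mb _)) //.
  by rewrite ler_pdivlMr //; have := step b; lra.
have ups : {homo (fun b => (L b + k + D) / M ^+ b) : a b / (a <= b)%N >-> b <= a}.
  by apply/nonincreasing_seqP.
have dns : {homo (fun b => (L b + k - D) / M ^+ b) : a b / (a <= b)%N >-> a <= b}.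
  by apply/nondecreasing_seqP.
have dnup b : (L b + k - D) / M ^+ b <= (L b + k + D) / M ^+ b.
  by rewrite ler_wpM2r ?invr_ge0 ?(ltW (Mb _)) //; lra.
have cv : cvgn (fun b => (L b + k + D) / M ^+ b).
  apply: nonincreasing_is_cvgn => //.
  exists ((L 0%N + k - D) / M ^+ 0) => _ [b _ <-].
  by apply: le_trans (dnup b); apply: dns.
have geo : (M ^+ b)^-1 @[b --> \oo] --> (0 : R).
  have -> : (fun b => (M ^+ b)^-1) = (fun b => M^-1 ^+ b).
    by apply/funext => b; rewrite exprVn.
  apply: cvg_expr; rewrite ger0_norm ?invr_ge0 ?ltW //.
  by rewrite invf_cp1 // /M.
have cvL : L b / M ^+ b @[b --> \oo] --> lim ((L b + k + D) / M ^+ b @[b --> \oo]).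
  have -> : (fun b => L b / M ^+ b) =
     (fun b => (L b + k + D) / M ^+ b - (k + D) * (M ^+ b)^-1).
    by apply/funext => b; ring.
  rewrite -[X in _ --> X]subr0 -[in X in _ --> X](mulr0 (k + D)).
  by apply: cvgB; [exact: cv|apply: cvgM; [exact: cvg_cst|exact: geo]].
have Be : bottcher u = lim ((L b + k + D) / M ^+ b @[b --> \oo]).
  exact/cvg_lim.
split; first by rewrite Be.
have B1 : bottcher u <= L 0%N + k + D.
  rewrite Be; have -> : L 0%N + k + D = (L 0%N + k + D) / M ^+ 0 by rewrite expr0 divr1.
  apply: limr_le => //; near=> b; exact: ups.
have B2 : L 0%N + k - D <= bottcher u.
  rewrite Be; have -> : L 0%N + k - D = (L 0%N + k - D) / M ^+ 0 by rewrite expr0 divr1.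
  apply: limr_ge => //; near=> b; apply: le_trans (dnup b); exact: dns.
have -> : c / (m%:R - 1) = - k by rewrite /k /M; ring.
by rewrite ler_norml -/M -/D; move: B1 B2; rewrite /L /=; lra.
Unshelve. all: by end_near. Qed.

Lemma bottcher_cvg u : 0 < u <= 1 / 2 ->
  (- ln (iter b f u)) / m%:R ^+ b @[b --> \oo] --> bottcher u.
Proof.
move=> hu; have [C C0 hC] := update_ln_bound hf.
have [] // := @bottcher_bound 0 C (1 / 2) u C0 hu (lexx _).
by move=> w hw; rewrite subr0; exact: hC.
Qed.

(** Close to 0 the previous bound applies with [c = ln beta] and an error [C]
as small as desired. *)
Lemma bottcher_near e : 0 < e -> exists2 x0, 0 < x0 <= 1 / 2 &
  forall u, 0 < u <= x0 -> `|bottcher u + ln u + ln beta / (m%:R - 1)| <= e.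
Proof.
move=> e0; have m1 := m_gt1.
have e0' : 0 < e * (m%:R - 1) by rewrite mulr_gt0 //; lra.
have [x0 hx0 h] := update_ln_equiv hf e0'.
exists x0 => // u hu; have /andP[_ hx] := hx0.
have [_] := @bottcher_bound _ _ _ _ (ltW e0') hu hx h.
by rewrite mulfK // gt_eqF //; lra.
Qed.

Lemma bottcher_update u : 0 < u <= 1 / 2 -> bottcher (f u) = m%:R * bottcher u.
Proof.
move=> hu; apply/cvg_lim => //; have m1 := m_gt1.
have := bottcher_cvg hu; rewrite -(cvg_shiftS) => h.
have -> : (fun b => (- ln (iter b f (f u))) / m%:R ^+ b) =
   (fun b => m%:R * ((- ln (iter b.+1 f u)) / m%:R ^+ b.+1)).
  apply/funext => b; rewrite -iterSr exprS.
  by field; rewrite expf_neq0 gt_eqF //; lra.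
by apply: cvgM; [exact: cvg_cst|exact: h].
Qed.

Lemma bottcher_iter k u : 0 < u <= 1 / 2 ->
  bottcher (iter k f u) = m%:R ^+ k * bottcher u.
Proof.
move=> hu; elim: k => [|k IH]; first by rewrite mul1r.
by rewrite iterS bottcher_update ?iter_update_in // IH exprS mulrA.
Qed.

(** By starshapedness [f w / w] stays below [f u / u < 1] along the orbit of
[u], which therefore decays geometrically. *)
Lemma iter_update_small x0 u : 0 < x0 -> 0 < u < 1 / 2 ->
  \forall k \near \oo, iter k f u <= x0.
Proof.
move=> x00 hu; have [u0 u1] := andP hu.
pose q := f u / u.
have q1 : q < 1 by rewrite /q ltr_pdivrMr // mul1r; exact: (update_lt_id hf).
have q0 : 0 < q by rewrite /q divr_gt0 // (update_gt0 hf) ?u0 //; lra.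
have hk k : iter k f u <= q ^+ k * u.
  elim: k => [|k IH]; first by rewrite mul1r.
  have /andP[i0 i1] : 0 < iter k f u <= u by apply: iter_update_le; lra.
  have := @update_star _ _ _ _ _ hf (iter k f u) u.
  have -> : 0 <= iter k f u <= u by lra.
  move=> /(_ isT ltac:(lra)) h.
  rewrite iterS exprS -mulrA; apply: (@le_trans _ _ (q * iter k f u)).
    by rewrite /q mulrAC ler_pdivlMr // [f u * _]mulrC.
  by rewrite ler_pM2l.
have : q ^+ k * u @[k --> \oo] --> (0 : R).
  rewrite -[X in _ --> X](mul0r u); apply: cvgM; last exact: cvg_cst.
  by apply: cvg_expr; rewrite ger0_norm ?ltW.
move=> /cvgrPdist_le /(_ _ x00) [N _ hN]; exists N => // k /= Nk.
apply: (le_trans (hk k)); have := hN k Nk; rewrite /= sub0r normrN.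
by move=> h; apply: le_trans h; exact: ler_norm.
Qed.

(** Starshapedness keeps the ratio of the iterates of [u < v] at least
[v / u], while the Bottcher coordinate approaches [- ln] plus a constant. *)
Lemma bottcher_lt u v : 0 < u < v -> v < 1 / 2 -> bottcher v < bottcher u.
Proof.
move=> /andP[u0 uv] v1; have m1 := m_gt1.
have v0 : 0 < v by lra.
pose e := ln (v / u) / 3.
have e0 : 0 < e by rewrite /e divr_gt0 // ln_gt0 // ltr_pdivlMr // mul1r.
have [x0 /andP[x00 x01] hx] := bottcher_near e0.
have [N _ hN] := iter_update_small x00 (u := v) ltac:(lra).
have hu : 0 < u <= 1 / 2 by lra.
have hv : 0 < v <= 1 / 2 by lra.
have ratio k : iter k f u * v <= u * iter k f v /\ iter k f u <= iter k f v.
  elim: k => [|k [IH1 IH2]]; first by split; rewrite //= ltW.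
  have /andP[a0 a1] := iter_update_in k hu.
  have /andP[b0 b1] := iter_update_in k hv.
  have h := @update_star _ _ _ _ _ hf (iter k f u) (iter k f v) ltac:(lra) b1.
  split; last by rewrite !iterS; apply: (update_mono hf); lra.
  have fv := update_gt0 hf (x := iter k f v) ltac:(lra).
  rewrite !iterS -(ler_pM2r b0) mulrAC.
  apply: (@le_trans _ _ (iter k f u * f (iter k f v) * v)); first by rewrite ler_pM2r.
  by rewrite mulrAC [leRHS]mulrAC ler_pM2r.
have hvN : iter N f v <= x0 by apply: hN => /=.
have [r1 r2] := ratio N.
have /andP[a0 _] := iter_update_in N hu.
have /andP[b0 _] := iter_update_in N hv.
have mN : 0 < (m%:R : R) ^+ N by rewrite exprn_gt0 //; lra.
rewrite -(ltr_pM2l mN) -!bottcher_iter //.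
have := hx (iter N f v) ltac:(lra); have := hx (iter N f u) ltac:(lra).
have hr : ln (v / u) <= ln (iter N f v) - ln (iter N f u).
  rewrite -ln_div ?posrE // ler_ln ?posrE ?divr_gt0 //.
  rewrite ler_pdivrMr // mulrAC ler_pdivlMr //; lra.
have : ln (v / u) = 3 * e by rewrite /e; lra.
by rewrite !ler_norml; lra.
Qed.

(** Far along the orbit [- ln] exceeds the error in [bottcher_near], and
[bottcher_iter] carries the sign back to [u]. *)
Lemma bottcher_gt0 u : 0 < u < 1 / 2 -> 0 < bottcher u.
Proof.
move=> hu; have m1 := m_gt1.
have [x0 /andP[x00 x01] hx] := bottcher_near ltr01.
pose y0 := Num.min x0 (expR (- (2 + `|ln beta / (m%:R - 1)|))).
have y00 : 0 < y0 by rewrite /y0 lt_min x00 expR_gt0.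
have [N _ hN] := iter_update_small y00 hu.
have hvN : iter N f u <= y0 by apply: hN => /=.
have mN : 0 < (m%:R : R) ^+ N by rewrite exprn_gt0 //; lra.
rewrite -(pmulr_rgt0 _ mN) -bottcher_iter //; last by lra.
have /andP[a0 _] := iter_update_in N (u := u) ltac:(lra).
have y1 : y0 <= x0 by rewrite /y0 ge_min lexx.
have y2 : y0 <= (expR (- (2 + `|ln beta / (m%:R - 1)|))) by rewrite /y0 ge_min lexx orbT.
have : ln (iter N f u) <= - (2 + `|ln beta / (m%:R - 1)|).
  by rewrite -[leRHS]expRK ler_ln ?posrE ?expR_gt0 //; lra.
have := hx (iter N f u) ltac:(lra); rewrite ler_norml.
have := ler_norm (ln beta / (m%:R - 1)); lra.
Qed.

End Bottcher.

(** * The function h *)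

Lemma nondecreasing_from {R : realType} (u : nat -> R) a b :
  (forall c, (a <= c)%N -> u c <= u c.+1) -> (a <= b)%N -> u a <= u b.
Proof.
move=> h /subnK <-; elim: (b - a)%N => // k IH.
by rewrite addSn (le_trans IH) // h // leq_addl.
Qed.

Section Limit.
Context {R : realType} (f : R -> R) (m : nat) (beta gamma : R).
Context (hf : majority_type f m beta gamma).

Local Notation B := (bottcher f m).

(** The deviation from 1/2 which the linearization [e |-> gamma * e] turns into
[gamma `^ (- z)] within [a] rounds. *)
Definition dev (a : nat) (z : R) : R := gamma `^ (- a%:R - z).

(** Solution of Abel's equation: each application of [f] adds 1, so that
differences of [abel] count rounds. *)
Definition abel (u : R) : R := logb m%:R (B u).

Lemma gamma_gt0 : 0 < gamma.
Proof. by have := mt_gamma_gt1 hf; lra. Qed.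

Lemma dev_gt0 a z : 0 < dev a z.
Proof. by rewrite powR_gt0 // gamma_gt0. Qed.

Lemma devS a z : gamma * dev a.+1 z = dev a z.
Proof.
rewrite /dev -[X in X * _]powRr1 ?(ltW gamma_gt0) // -powRD; last first.
  by rewrite (gt_eqF gamma_gt0) implybT.
by congr powR; rewrite -natr1; ring.
Qed.

Lemma dev_shift a z : dev a (z + 1) = dev a.+1 z.
Proof. by congr powR; rewrite -natr1; ring. Qed.

Lemma dev_shiftr a z w : dev a (z + w) = dev a z * gamma `^ (- w).
Proof.
rewrite /dev -powRD; last by rewrite (gt_eqF gamma_gt0) implybT.
by congr powR; ring.
Qed.

Lemma dev_expn a z : dev a z = gamma `^ (- z) * gamma^-1 ^+ a.
Proof.
elim: a => [|a IH]; first by rewrite /dev oppr0 sub0r expr0 mulr1.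
apply: (@mulfI _ gamma); first by rewrite gt_eqF // gamma_gt0.
by rewrite devS IH exprS; field; rewrite gt_eqF // gamma_gt0.
Qed.

Lemma dev_cvg0 z : dev a z @[a --> \oo] --> (0 : R).
Proof.
have g1 := mt_gamma_gt1 hf; have g0 := gamma_gt0.
have -> : dev ^~ z = (fun a => gamma `^ (- z) * gamma^-1 ^+ a).
  by apply/funext => a; rewrite dev_expn.
rewrite -[X in _ --> X](mulr0 (gamma `^ (- z))).
apply: cvgM; first exact: cvg_cst.
by apply: cvg_expr; rewrite ger0_norm ?invr_ge0 ?ltW // invf_cp1.
Qed.

Lemma dev_small z e : 0 < e -> \forall a \near \oo, dev a z <= e.
Proof.
move=> e0; have /cvgrPdist_le/(_ _ e0) := dev_cvg0 z.
apply: filterS => a; rewrite sub0r normrN; apply: le_trans; exact: ler_norm.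
Qed.

(** The quadratic correction [K * E ^+ 2] dominates the error of the linear
approximation of [f] at 1/2, and the slack [S] grows at rate [r < gamma]; so
[f] maps each point of the family in question below the next one, with room
[(gamma - r) * S]. *)
Lemma update_corrected : exists2 K, 0 < K & exists2 E0, 0 < E0 &
  forall E S r, 0 < E -> gamma * E <= E0 -> 0 <= S <= E ->
  [/\ 0 <= E * (1 - K * E) + S <= 1 / 2, 2 * K * (gamma * E) <= 1,
      4 * (gamma * E) <= 1
    & f (1 / 2 - (E * (1 - K * E) + S)) + (gamma - r) * S <=
      1 / 2 - (gamma * E * (1 - K * (gamma * E)) + r * S)].
Proof.
have g1 := mt_gamma_gt1 hf.
have [C C0 hC] := update_expand_half hf.
(* The correction gained in a round, [K * gamma * (gamma - 1) * E ^+ 2], is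
   to equal the error [C * (2 * E) ^+ 2] of the linearization. *)
pose K := 4 * C / (gamma * (gamma - 1)).
have gg : 0 < gamma * (gamma - 1) by rewrite mulr_gt0; lra.
have K0 : 0 < K by rewrite /K divr_gt0 // mulr_gt0.
have KE : K * (gamma * (gamma - 1)) = 4 * C by rewrite /K divfK // gt_eqF.
exists K => //.
have h0 : 0 < (2 * K)^-1 by rewrite invr_gt0 mulr_gt0.
exists (Num.min (1 / 4) (2 * K)^-1); first by rewrite lt_min h0 andbT; lra.
move=> E S r E0; rewrite le_min => /andP[E1 E2] /andP[S0 S1].
have E2' : 2 * K * (gamma * E) <= 1.
  have k2 : 0 < 2 * K by rewrite mulr_gt0.
  by have := ler_wpM2l (ltW k2) E2; rewrite mulfV // gt_eqF.
have gE : E <= gamma * E by have : 0 <= (gamma - 1) * E by [rewrite mulr_ge0; lra]; lra.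
have KEE : 0 <= K * E by rewrite mulr_ge0; lra.
have KEs : K * E <= 1 / 2.
  by have : K * E <= K * (gamma * E) by [rewrite ler_wpM2l; lra]; lra.
set e := E * (1 - K * E) + S.
have e0 : 0 <= e by rewrite /e addr_ge0 // mulr_ge0; lra.
have e1 : e <= 2 * E.
  have : 0 <= E * (K * E) by rewrite mulr_ge0; lra.
  by rewrite /e; lra.
split => //; [lra|lra|].
have := hC (- e); rewrite normrN ger0_norm // => /(_ ltac:(lra)).
rewrite ler_norml sqrrN => /andP[_ h].
have : C * e ^+ 2 <= C * (2 * E) ^+ 2.
  by rewrite ler_pM2l // ler_sqr ?nnegrE //; lra.
have -> : C * (2 * E) ^+ 2 = K * gamma * (gamma - 1) * E ^+ 2 by rewrite -(mulrA K) KE; ring.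
move=> h2.
have : gamma * e = gamma * (E * (1 - K * E)) + gamma * S by rewrite /e; ring.
have : K * gamma * (gamma - 1) * E ^+ 2 = gamma * E * (1 - K * E) - gamma * E * (1 - K * (gamma * E)) by ring.
lra.
Qed.

Lemma abel_update u : 0 < u < 1 / 2 -> abel (f u) = abel u + 1.
Proof.
move=> hu; have m1 := m_gt1 hf; rewrite /abel /logb (bottcher_update hf); last by lra.
rewrite lnM ?posrE ?(bottcher_gt0 hf) //; last by lra.
by rewrite mulrDl divff ?gt_eqF ?ln_gt0 // addrC.
Qed.

Lemma abel_lt u v : 0 < u < v -> v < 1 / 2 -> abel v < abel u.
Proof.
move=> huv v1; have m1 := m_gt1 hf; have l0 : 0 < ln (m%:R : R) by rewrite ln_gt0.
rewrite /abel /logb ltr_pM2r ?invr_gt0 //.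
rewrite ltr_ln ?posrE ?(bottcher_gt0 hf) //; try lra.
exact: (bottcher_lt hf).
Qed.

Lemma abel_le u v : 0 < u <= v -> v < 1 / 2 -> abel v <= abel u.
Proof.
move=> /andP[u0]; rewrite le_eqVlt => /orP[/eqP-> //|uv] v1.
by rewrite ltW // abel_lt // u0.
Qed.

(** Up to the sign, this is the inner limit in the definition of [g_fun]; see
[inner_limit]. *)
Definition abel_orbit (z : R) (a : nat) : R := a%:R + abel (1 / 2 - dev a z).

(** The graph of [f] lies above its tangent at 1/2, so [f] leaves 1/2 no faster
than its linearization does. *)
Lemma abel_orbit_nonincr z a : dev a z < 1 / 2 ->
  abel_orbit z a.+1 <= abel_orbit z a.
Proof.
move=> h; have d0 := dev_gt0 a z; have d1 := dev_gt0 a.+1 z.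
have g1 := mt_gamma_gt1 hf; have dE := devS a z.
have d2 : dev a.+1 z < dev a z.
  by have : 0 < (gamma - 1) * dev a.+1 z by [rewrite mulr_gt0; lra]; lra.
rewrite /abel_orbit -natr1 -addrA lerD2l addrC -abel_update; last by lra.
apply: abel_le; last by have := update_lt_id hf (x := 1 / 2 - dev a.+1 z) ltac:(lra); lra.
have := update_ge_tangent hf (e := dev a.+1 z) ltac:(lra).
by rewrite dE; lra.
Qed.

Lemma dev_le a b z : (a <= b)%N -> dev b z <= dev a z.
Proof.
have g1 := mt_gamma_gt1 hf => /subnK<-; elim: (b - a)%N => // k IH.
rewrite addSn; apply: le_trans IH; have := devS (k + a) z; have := dev_gt0 (k + a).+1 z.
by move=> h1; have : 0 < (gamma - 1) * dev (k + a).+1 z by [rewrite mulr_gt0; lra]; lra.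
Qed.

(** Along the corrected family [a + abel] increases with [a], by
[update_corrected] without slack. Each of its members thus bounds the whole
tail of [abel_orbit z] from below, and the limit exists. *)
Lemma abel_orbit_lower : exists2 K, 0 < K & forall z, \forall a \near \oo,
  [/\ dev a z < 1 / 2, 0 < dev a z * (1 - K * dev a z) <= dev a z
    & forall b, (a <= b)%N ->
      a%:R + abel (1 / 2 - dev a z * (1 - K * dev a z)) <= abel_orbit z b].
Proof.
have g1 := mt_gamma_gt1 hf.
have [K K0 [E0 E00 h]] := update_corrected.
exists K => // z.
have [N _ hN] := dev_small z E00.
exists N.+1 => // -[//|a] /= Na.
pose lam b := 1 / 2 - dev b z * (1 - K * dev b z).
have key b : (a < b)%N -> [/\ dev b z < 1 / 2, 0 < dev b z * (1 - K * dev b z) <= dev b z & f (lam b.+1) <= lam b].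
  move=> ab; have db := dev_gt0 b z; have db1 := dev_gt0 b.+1 z.
  have hb : dev b z <= E0 by apply: hN => /=; apply: leq_trans ab; apply: ltnW.
  have := h (dev b.+1 z) 0 1 db1; rewrite devS lexx (ltW db1) => /(_ hb isT).
  rewrite !mulr0 !addr0 => -[h1 h2 h3 h4].
  have k1 : 0 < K * dev b z by rewrite mulr_gt0.
  split; [lra| |exact: h4].
  rewrite mulr_gt0 /=; [|lra|lra].
  by rewrite -[leRHS]mulr1 ler_pM2l //; lra.
have lamin b : (a < b)%N -> 0 < lam b < 1 / 2.
  by move=> ab; have [] := key b ab; rewrite /lam; lra.
have [k1 k2 _] := key a.+1 (ltnSn _).
split => // b ab.
have mono : a.+1%:R + abel (lam a.+1) <= b%:R + abel (lam b).
  apply: (nondecreasing_from (u := fun c => c%:R + abel (lam c))) ab => c ac.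
  have [_ _ k3] := key c ac.
  rewrite -[in leRHS]natr1 -[leRHS]addrA lerD2l [leRHS]addrC -abel_update; last first.
    by apply: lamin; apply: ltnW.
  apply: abel_le; last by have := lamin c ac; lra.
  by rewrite k3 (update_gt0 hf) //; have := lamin c.+1 (ltnW ac); lra.
apply: (le_trans mono); rewrite /abel_orbit lerD2l.
have [q1 q2 _] := key b ab; have dp := dev_gt0 b z.
rewrite /lam; clear mono h key lamin; move: q1 q2 dp; move: (dev b z * _) => X q1 q2 dp.
by apply: abel_le; lra.
Qed.

Lemma inner_limit a z : dev a z < 1 / 2 ->
  lim ((b%:R - a%:R - logb m%:R `|ln (iter b f (1 / 2 - dev a z))|) @[b --> \oo])
  = - abel_orbit z a.
Proof.
move=> h; have d0 := dev_gt0 a z.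
set u := 1 / 2 - dev a z.
have hu : 0 < u < 1 / 2 by rewrite /u; lra.
have m1 := m_gt1 hf; have l0 : 0 < ln (m%:R : R) by rewrite ln_gt0.
apply/cvg_lim => //.
have hL b : 0 < - ln (iter b f u).
  have /andP[i0 i1] := iter_update_in hf b (u := u) ltac:(lra).
  by rewrite oppr_gt0 ln_lt0 // i0 /=; lra.
have -> : (fun b => b%:R - a%:R - logb m%:R `|ln (iter b f u)|) =
   (fun b => - a%:R - logb m%:R ((- ln (iter b f u)) / m%:R ^+ b)).
  apply/funext => b; rewrite -normrN ger0_norm ?(ltW (hL b)) // /logb.
  rewrite ln_div ?posrE ?exprn_gt0 //; last by lra.
  by rewrite lnXn ?(lt_trans ltr01 m1) // -mulr_natr; field; rewrite gt_eqF.
have -> : - abel_orbit z a = - a%:R - abel u by rewrite /abel_orbit -/u; ring.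
apply: cvgB; first exact: cvg_cst.
rewrite /abel /logb; apply: cvgM; last exact: cvg_cst.
apply: (@cvg_comp _ _ _ _ _ _ (nbhs (B u))).
  by apply: (bottcher_cvg hf); lra.
by apply: continuous_ln; exact: (bottcher_gt0 hf).
Qed.

Lemma abel_orbit_cvg z : abel_orbit z a @[a --> \oo] --> 1 - h_fun f m gamma z.
Proof.
have [K K0 /(_ z)[N _ hN]] := abel_orbit_lower.
have [N1 N2 N3] := hN N (leqnn N).
have noninc : {homo (fun b => abel_orbit z (b + N)) : a b / (a <= b)%N >-> b <= a}.
  apply/nonincreasing_seqP => b; rewrite addSn abel_orbit_nonincr //.
  by apply: le_lt_trans N1; apply: dev_le; rewrite leq_addl.
have cvN : cvgn (fun b => abel_orbit z (b + N)).
  apply: nonincreasing_is_cvgn => //.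
  exists (N%:R + abel (1 / 2 - dev N z * (1 - K * dev N z))) => _ [b _ <-].
  by apply: N3; rewrite leq_addl.
have cv : abel_orbit z a @[a --> \oo] --> lim (abel_orbit z (b + N) @[b --> \oo]).
  by rewrite -(cvg_shiftn N); exact: cvN.
suff -> : 1 - h_fun f m gamma z = lim (abel_orbit z (b + N) @[b --> \oo]) by [].
rewrite /h_fun /g_fun.
set l := lim (abel_orbit z (b + N) @[b --> \oo]) in cv *.
set G := lim _; suff -> : G = - l by ring.
apply/cvg_lim => //.
apply: (@cvg_trans _ ((fun a => - abel_orbit z a) @ \oo)); last exact: cvgN cv.
apply: near_eq_cvg; exists N => // a Na; apply/esym; apply: inner_limit.
by have [] := hN a Na.
Qed.

(** For large [a] the corrected point of [z1] lies below the plain point of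
[z2 > z1]. Strict monotonicity of the Bottcher coordinate at this one level
separates the two limits. *)
Lemma h_lt z1 z2 : z1 < z2 -> h_fun f m gamma z1 < h_fun f m gamma z2.
Proof.
move=> z12; have g1 := mt_gamma_gt1 hf.
have [K K0 hK] := abel_orbit_lower.
pose q := gamma `^ (- (z2 - z1)).
have q1 : q < 1.
  rewrite /q /powR (gt_eqF gamma_gt0) expR_lt1 mulNr oppr_lt0.
  by rewrite mulr_gt0 ?ln_gt0 // subr_gt0.
have e0 : 0 < (1 - q) / (2 * K) by rewrite divr_gt0 ?subr_gt0 // mulr_gt0.
have [N1 _ h1] := hK z1; have [N2 _ h2] := hK z2; have [N3 _ h3] := dev_small z1 e0.
pose a := maxn N1 (maxn N2 N3).
have [a1 a2 a3] := h1 a (leq_maxl _ _).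
have [b1 _ _] : [/\ dev a z2 < 1 / 2, 0 < dev a z2 * (1 - K * dev a z2) <= dev a z2
    & forall b, (a <= b)%N ->
      a%:R + abel (1 / 2 - dev a z2 * (1 - K * dev a z2)) <= abel_orbit z2 b].
  by apply: h2; rewrite /= /a !leq_max leqnn orbT.
have c1 : dev a z1 <= (1 - q) / (2 * K) by apply: h3; rewrite /= /a !leq_max leqnn !orbT.
clearbody a.
have dE : dev a z2 = dev a z1 * q by rewrite -dev_shiftr; congr dev; ring.
have d1 := dev_gt0 a z1; have d2 := dev_gt0 a z2.
have c2 : K * dev a z1 < 1 - q.
  have q1' : 0 < 1 - q by lra.
  by move: c1; rewrite ler_pdivlMr ?mulr_gt0 //; lra.
have lt12 : dev a z2 < dev a z1 * (1 - K * dev a z1) by rewrite dE ltr_pM2l //; lra.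
have s1 : a%:R + abel (1 / 2 - dev a z1 * (1 - K * dev a z1)) <= 1 - h_fun f m gamma z1.
  have cv := @abel_orbit_cvg z1; rewrite -(cvg_lim _ cv) //.
  apply: limr_ge; first by apply/cvg_ex; eexists; exact: cv.
  by exists a => // b /= ab; exact: a3.
have s2 : 1 - h_fun f m gamma z2 <= abel_orbit z2 a.
  have cv := @abel_orbit_cvg z2; rewrite -(cvg_lim _ cv) //.
  apply: limr_le; first by apply/cvg_ex; eexists; exact: cv.
  exists a; [by []|move=> b ab; rewrite -lerN2].
  apply: (nondecreasing_from (u := fun c => - abel_orbit z2 c)) ab => c ac.
  rewrite lerN2; apply: abel_orbit_nonincr.
  by apply: le_lt_trans b1; apply: dev_le.
have : abel (1 / 2 - dev a z2) < abel (1 / 2 - dev a z1 * (1 - K * dev a z1)).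
  by apply: abel_lt; lra.
by move: s2; rewrite /abel_orbit; lra.
Qed.

(** Moving [z] by 1 moves the index of the defining sequence by 1. *)
Lemma h_shift z : h_fun f m gamma (z + 1) = h_fun f m gamma z + 1.
Proof.
have cv1 := @abel_orbit_cvg (z + 1).
have cv2 : abel_orbit (z + 1) a @[a --> \oo] --> 1 - h_fun f m gamma z - 1.
  have -> : abel_orbit (z + 1) = (fun a => abel_orbit z a.+1 - 1).
    by apply/funext => a; rewrite /abel_orbit dev_shift -natr1; ring.
  by apply: cvgB; [rewrite cvg_shiftS; exact: abel_orbit_cvg|exact: cvg_cst].
have e : 1 - h_fun f m gamma (z + 1) = 1 - h_fun f m gamma z - 1.
  exact: cvg_unique cv1 cv2.
lra.
Qed.

Lemma h_shiftn z n : h_fun f m gamma (z + n%:R) = h_fun f m gamma z + n%:R.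
Proof.
elim: n => [|n IH]; first by rewrite !addr0.
by rewrite -natr1 addrA h_shift IH; ring.
Qed.

(** [h] is strictly increasing, and [h_shift] makes it unbounded on both sides.
On which side of [c] its value at the crossing point lies is left open. *)
Lemma h_crossing c : exists zc, (forall z, z < zc -> h_fun f m gamma z < c) /\
  (forall z, zc < z -> c < h_fun f m gamma z).
Proof.
pose A := [set z | h_fun f m gamma z < c].
have A0 : A !=set0.
  pose n := `|Num.ceil (h_fun f m gamma 0 - c + 1)|%N.
  exists (- n%:R); rewrite /A /=; have := h_shiftn (- n%:R) n; rewrite addNr.
  have : h_fun f m gamma 0 - c + 1 <= n%:R.
    by apply: (le_trans (ceil_ge _)); rewrite /n natr_absz ler_int; exact: ler_norm.
  lra.
have Aub : has_ubound A.
  pose n := `|Num.ceil (c - h_fun f m gamma 0)|%N.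
  exists n%:R => z /=; rewrite /A /= leNgt => hz; apply/negP => nz.
  have := h_lt nz; have := h_shiftn 0 n; rewrite add0r.
  have : c - h_fun f m gamma 0 <= n%:R.
    by apply: (le_trans (ceil_ge _)); rewrite /n natr_absz ler_int; exact: ler_norm.
  lra.
exists (sup A); split => z hz.
  have e0 : 0 < sup A - z by lra.
  have [w Aw] := sup_adherent e0 (conj A0 Aub).
  rewrite subKr => zw; exact: lt_trans (h_lt zw) Aw.
have zz : (z + sup A) / 2 < z by lra.
apply: le_lt_trans (h_lt zz); rewrite leNgt; apply/negP => h.
have : A ((z + sup A) / 2) by [].
by move=> /(ub_le_sup Aub); lra.
Qed.

End Limit.

(** * Expectations over one round *)

Section BinomialExpectation.
Context {R : realType}.
Implicit Types (p : R) (G H : R -> R).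

(** Expectation under Bin(n, p), by conditioning on one of the [n] trials. *)
Fixpoint binE (n : nat) (p : R) (G : R -> R) : R :=
  if n is n'.+1 then
    p * binE n' p (fun x => G (x + 1)) + (1 - p) * binE n' p G
  else G 0.

Lemma binE_le n p G H : 0 <= p <= 1 ->
  (forall k, (k <= n)%N -> G k%:R <= H k%:R) -> binE n p G <= binE n p H.
Proof.
move=> hp; elim: n G H => [|n IH] G H GH /=; first exact: (GH 0%N).
apply: lerD; apply: ler_wpM2l; try lra; apply: IH => k kn.
  by rewrite natr1; apply: GH.
by apply: GH; apply: leqW.
Qed.

Lemma binE_lin n p a b G H :
  binE n p (fun x => a * G x + b * H x) = a * binE n p G + b * binE n p H.
Proof. by elim: n G H => [|n IH] G H //=; rewrite !IH; ring. Qed.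

Lemma binE_cst n p c : binE n p (fun=> c) = c.
Proof. by elim: n => //= n ->; ring. Qed.

Lemma binE_id n p : binE n p id = n%:R * p.
Proof.
elim: n => [|n IH] /=; first by rewrite mul0r.
have -> : (fun x : R => id (x + 1)) = (fun x => 1 * id x + 1 * (fun=> 1) x).
  by apply/funext => x; rewrite !mul1r.
by rewrite binE_lin binE_cst IH -natr1; ring.
Qed.

Lemma binE_sq n p c :
  binE n p (fun x => (x - c) ^+ 2) = n%:R * p * (1 - p) + (n%:R * p - c) ^+ 2.
Proof.
elim: n c => [|n IH] c /=; first by ring.
have -> : (fun x => (x + 1 - c) ^+ 2) = (fun x => (x - (c - 1)) ^+ 2).
  by apply/funext => x; ring.
by rewrite !IH -natr1; ring.
Qed.

Lemma binE_pmf n p G :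
  binE n p G = \sum_(k < n.+1) binomial_pmf n p k * G k%:R.
Proof.
elim: n G => [|n IH] G /=.
  by rewrite big_ord1 /binomial_pmf bin0 !expr0 !mul1r.
rewrite !IH [RHS]big_ord_recl.
have -> : \sum_(i < n.+1) binomial_pmf n.+1 p (lift ord0 i) * G (lift ord0 i)%:R =
  p * (\sum_(k < n.+1) binomial_pmf n p k * G (k%:R + 1)) +
  (1 - p) * (\sum_(k < n.+1) binomial_pmf n p k.+1 * G k.+1%:R).
  rewrite !mulr_sumr -big_split /=; apply: eq_bigr => k _.
  rewrite /bump leq0n add1n natr1 /binomial_pmf binS mulrnDr.
  rewrite subSS exprS mulrDl addrC; congr (_ + _); last first.
    by rewrite !(mulrnAl, mulrnAr) !mulrA.
  have [kn|kn] := ltnP k n; last first.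
    by rewrite bin_small ?ltnS // !mulr0n !mul0r mulr0.
  have -> : (n - k)%N = (n - k.+1).+1 by rewrite subnSK.
  rewrite exprS /unstable.onem.
  by rewrite !(mulrnAl, mulrnAr); congr (_ *+ _); ring.
have -> : \sum_(k < n.+1) binomial_pmf n p k * G k%:R =
  binomial_pmf n p 0 * G 0 + \sum_(k < n.+1) binomial_pmf n p k.+1 * G k.+1%:R.
  rewrite big_ord_recl; congr (_ + _).
  have top : binomial_pmf n p n.+1 = 0 by rewrite /binomial_pmf bin_small.
  rewrite [RHS]big_ord_recr /= top mul0r addr0.
  by apply: eq_bigr => k _; rewrite /bump leq0n add1n.
have -> : binomial_pmf n.+1 p (ord0 : 'I_n.+2) = (1 - p) * binomial_pmf n p 0.
  by rewrite /binomial_pmf !bin0 expr0 subn0 exprS !mul1r.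
by ring.
Qed.

Lemma binE_chebyshev n p e G : (0 < n)%N -> 0 <= p <= 1 -> e != 0 ->
  (forall k, (k <= n)%N -> G k%:R <= ((k%:R / n%:R - p) / e) ^+ 2) ->
  binE n p G <= p * (1 - p) / (n%:R * e ^+ 2).
Proof.
move=> n0 hp e0 hG; have nR : (n%:R : R) != 0 by rewrite pnatr_eq0 -lt0n.
pose c := (n%:R * e) ^- 2.
apply: (@le_trans _ _ (binE n p (fun x => c * (x - n%:R * p) ^+ 2 + 0 * 0))).
  apply: binE_le => // k /hG /le_trans; apply.
  by rewrite mulr0 addr0 le_eqVlt; apply/orP; left; apply/eqP; rewrite /c; field; rewrite ?e0 ?nR.
rewrite (binE_lin n p c 0 (fun x => (x - n%:R * p) ^+ 2) (fun=> 0)) binE_sq mul0r addr0 subrr.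
by rewrite le_eqVlt; apply/orP; left; apply/eqP; rewrite /c; field; rewrite ?e0 ?nR.
Qed.

End BinomialExpectation.

(** * Passing levels of the minority share *)

Section Kernel.
Context {R : realType} (f : R -> R) (m : nat) (beta gamma : R).
Context (hf : majority_type f m beta gamma).

(** The transition operator of the process, acting on functions of the state. *)
Definition step (n : nat) (G : R -> R) (v : R) : R := binE n (f (v / n%:R)) G.

Definition consensus (n : nat) (v : R) : R :=
  if (v == n%:R) || (n%:R - v == n%:R) then 1 else 0.

Definition minority (n : nat) (v : R) : R := Num.min (v / n%:R) (1 - v / n%:R).

Lemma state_ratio n (v : R) : 0 <= v <= n%:R -> 0 <= v / n%:R <= 1.
Proof.
case: n => [|n] hv; first by rewrite invr0 mulr0 lexx ler01.
by rewrite divr_ge0 ?ler_pdivrMr ?mul1r ?ltr0n //; lra.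
Qed.

Lemma nat_state n k : (k <= n)%N -> 0 <= (k%:R : R) <= n%:R.
Proof. by move=> kn; rewrite ler0n ler_nat. Qed.

Lemma step_prob n v : 0 <= v <= n%:R -> 0 <= f (v / n%:R) <= 1.
Proof. by move=> hv; apply: (mt_range hf); exact: state_ratio. Qed.

Lemma step_le n G H v : 0 <= v <= n%:R ->
  (forall k, (k <= n)%N -> G k%:R <= H k%:R) -> step n G v <= step n H v.
Proof. by move=> hv; apply: binE_le; exact: step_prob. Qed.

(** The initial state may be any real number, but after one round the state is
a natural number; hence [0 < t]. *)
Lemma iter_step_le t n G H v : 0 <= v <= n%:R -> (0 < t)%N ->
  (forall k, (k <= n)%N -> G k%:R <= H k%:R) ->
  iter t (step n) G v <= iter t (step n) H v.
Proof.
move=> + + h; elim: t v => // t IH v hv _; rewrite !iterS; apply: step_le => // k kn.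
by case: t IH => [|t] IH; [exact: h|apply: IH => //; exact: nat_state].
Qed.

Lemma iter_step_lin t n a b G H v :
  iter t (step n) (fun x => a * G x + b * H x) v =
  a * iter t (step n) G v + b * iter t (step n) H v.
Proof.
have -> : iter t (step n) (fun x => a * G x + b * H x) =
  fun v => a * iter t (step n) G v + b * iter t (step n) H v.
  elim: t => // t IH; rewrite !iterS IH; apply/funext => w.
  by rewrite /step binE_lin.
by [].
Qed.

Lemma iter_step_cst t n c v : iter t (step n) (fun=> c) v = c.
Proof.
have -> : iter t (step n) (fun=> c) = (fun=> c).
  elim: t => // t IH; rewrite iterS IH; apply/funext => w; exact: binE_cst.
by [].
Qed.

Lemma consensus_01 n v : 0 <= consensus n v <= 1.
Proof. by rewrite /consensus; case: ifP; rewrite lexx ler01. Qed.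

Lemma iter_step_01 t n k : (k <= n)%N ->
  0 <= iter t (step n) (consensus n) k%:R <= 1.
Proof.
move=> kn; have hv := nat_state kn; case: t => [|t]; first exact: consensus_01.
have h0 := iter_step_cst t.+1 n 0 k%:R; have h1 := iter_step_cst t.+1 n 1 k%:R.
apply/andP; split; [rewrite -[leLHS]h0|rewrite -[leRHS]h1].
  by apply: iter_step_le => // j _; have /andP[] := consensus_01 n j%:R.
by apply: iter_step_le => // j _; have /andP[] := consensus_01 n j%:R.
Qed.

(** Consensus being absorbing, [iter t (step n) (consensus n) k%:R] is the
probability of reaching it from [k] within [t] rounds. *)
Definition fast (n t : nat) (l eta : R) := forall k, (k <= n)%N ->
  minority n k%:R <= l -> 1 - eta <= iter t (step n) (consensus n) k%:R.

Definition slow (n t : nat) (l eta : R) := forall k, (k <= n)%N ->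
  l <= minority n k%:R -> iter t (step n) (consensus n) k%:R <= eta.

Definition indic (b : bool) : R := if b then 1 else 0.

Lemma minority_half n v : 0 <= v <= n%:R -> 0 <= minority n v <= 1 / 2.
Proof.
move=> /state_ratio hr; rewrite /minority.
by case: (leP (v / n%:R) (1 - v / n%:R)) => hle; lra.
Qed.

Lemma update_minority n v : 0 <= v <= n%:R ->
  let p := f (v / n%:R) in
  (p = f (minority n v) \/ 1 - p = f (minority n v)) /\ f (minority n v) <= p
  /\ f (minority n v) <= 1 - p.
Proof.
move=> hv p; have hr := state_ratio hv.
have /(update_in_half hf) hh := minority_half hv.
have e : f (1 - v / n%:R) = 1 - p by rewrite (update_reflect hf).
move: hh; rewrite /minority; case: (leP (v / n%:R) (1 - v / n%:R)) => hle; rewrite ?e -/p => hh.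
  by split; [left|lra].
by split; [right|lra].
Qed.

Lemma fast_step n t l l' eta err : 0 <= eta -> fast n t l' eta ->
  (forall k, (k <= n)%N -> minority n k%:R <= l ->
    binE n (f (k%:R / n%:R)) (fun x => indic (l' < minority n x)) <= err) ->
  fast n t.+1 l (eta + err).
Proof.
move=> e0 hF hE k kn hk; have hv := nat_state kn.
have hp := step_prob hv.
rewrite iterS; apply: (@le_trans _ _
  (binE n (f (k%:R / n%:R)) (fun x => 1 * (fun=> 1 - eta) x + (-1) * indic (l' < minority n x)))).
  by rewrite (binE_lin n _ 1 (-1) (fun=> 1 - eta)) binE_cst; have := hE k kn hk; lra.
apply: binE_le => // j jn; have := iter_step_01 t jn; rewrite /indic.
by case: ltP => h; [lra|have := hF j jn h; lra].
Qed.

Lemma slow_step n t l l' eta err : slow n t l' eta -> 0 <= eta ->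
  (forall k, (k <= n)%N -> l <= minority n k%:R ->
    binE n (f (k%:R / n%:R)) (fun x => indic (minority n x < l')) <= err) ->
  slow n t.+1 l (eta + err).
Proof.
move=> hF e0 hE k kn hk; have hv := nat_state kn.
have hp := step_prob hv.
rewrite iterS; apply: (@le_trans _ _
  (binE n (f (k%:R / n%:R)) (fun x => 1 * (fun=> eta) x + 1 * indic (minority n x < l')))).
  apply: binE_le => // j jn; have := iter_step_01 t jn; rewrite /indic.
  by case: ltP => h; [lra|have := hF j jn h; lra].
by rewrite (binE_lin n _ 1 1 (fun=> eta)) binE_cst; have := hE k kn hk; lra.
Qed.

Lemma fast_chebyshev n t l l' e eta : (0 < n)%N -> 0 <= eta -> 0 < e ->
  0 <= l <= 1 / 2 -> f l + e <= l' -> fast n t l' eta ->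
  fast n t.+1 l (eta + f l / (n%:R * e ^+ 2)).
Proof.
move=> n0 eta0 e0 hl hle hF; apply: fast_step hF _ => // k kn hk.
have hv := nat_state kn; have hp := step_prob hv.
have nR : 0 < (n%:R : R) by rewrite ltr0n.
have [hm [hm1 hm2]] := update_minority hv.
have := minority_half hv => /andP[hh0 hh1].
have fl : f (minority n k%:R) <= f l by apply: (update_mono hf); lra.
set p := f (k%:R / n%:R) in hp hm hm1 hm2 *.
apply: (@le_trans _ _ (p * (1 - p) / (n%:R * e ^+ 2))).
  apply: binE_chebyshev => //; first by rewrite gt_eqF.
  move=> j jn; rewrite /indic; case: ltP => h; last exact: sqr_ge0.
  move: h; rewrite /minority lt_min => /andP[h1 h2].
  rewrite expr_div_n ler_pdivlMr ?exprn_gt0 // mul1r.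
  case: hm => hm; first by rewrite ler_sqr ?nnegrE; lra.
  by rewrite -[leRHS]sqrrN ler_sqr ?nnegrE; lra.
have ne : 0 <= (n%:R * e ^+ 2)^-1 by rewrite invr_ge0 mulr_ge0 // sqr_ge0.
rewrite ler_wpM2r //.
case: hm => hm.
  have : p * (1 - p) <= p * 1 by rewrite ler_wpM2l; lra.
  lra.
have : p * (1 - p) <= 1 * (1 - p) by rewrite ler_wpM2r; lra.
lra.
Qed.

(** At shares of order [1 / n] the fluctuations are as large as the mean;
Markov's inequality then does better than Chebyshev's. *)
Lemma fast_markov n t l l' eta : (0 < n)%N -> 0 <= eta -> 0 < l' ->
  0 <= l <= 1 / 2 -> fast n t l' eta -> fast n t.+1 l (eta + f l / l').
Proof.
move=> n0 eta0 l0 hl hF; apply: fast_step hF _ => // k kn hk.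
have hv := nat_state kn; have hp := step_prob hv.
have nR : 0 < (n%:R : R) by rewrite ltr0n.
have nR0 : (n%:R : R) != 0 by rewrite gt_eqF.
have [hm _] := update_minority hv.
have := minority_half hv => /andP[hh0 hh1].
have fl : f (minority n k%:R) <= f l by apply: (update_mono hf); lra.
set p := f (k%:R / n%:R) in hp hm *.
rewrite ler_pdivlMr //.
suff : binE n p (fun x => l' * indic (l' < minority n x) + 0 * indic true) <= f l.
  by rewrite (binE_lin n p l' 0 (fun x => indic (l' < minority n x)) (fun=> indic true)) mul0r addr0 mulrC.
case: hm => hm.
  apply: (@le_trans _ _ (binE n p (fun x => n%:R^-1 * id x + 0 * (fun=> 0) x))).
    apply: binE_le => // j jn; have /andP[hj _] := state_ratio (nat_state jn).
    rewrite !mul0r !addr0 /indic; case: ltP => h; last by rewrite mulr0 mulrC.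
    by move: h; rewrite /minority lt_min => /andP[h1 h2]; rewrite mulr1 mulrC ltW.
  by rewrite binE_lin binE_id binE_cst mulrA mulVf // mul1r mulr0 addr0 hm.
apply: (@le_trans _ _ (binE n p (fun x => (- n%:R^-1) * id x + 1 * (fun=> 1) x))).
  apply: binE_le => // j jn; have /andP[_ hj] := state_ratio (nat_state jn).
  have -> : - n%:R^-1 * id (j%:R : R) + 1 * (fun=> 1) (j%:R : R) = 1 - j%:R / n%:R.
    by rewrite mul1r addrC mulNr mulrC.
  rewrite !mul0r !addr0 /indic; case: ltP => h; last by rewrite mulr0 subr_ge0.
  by move: h; rewrite /minority lt_min => /andP[h1 h2]; rewrite mulr1 ltW.
rewrite binE_lin binE_id binE_cst mulrA mulNr mulVf //.
lra.
Qed.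

Lemma ratio_antitone (a b l : R) : 0 <= l < a -> a <= b ->
  b / (b - l) ^+ 2 <= a / (a - l) ^+ 2.
Proof.
move=> /andP[l0 la] ab.
have a2 : 0 < (a - l) ^+ 2 by rewrite exprn_gt0 //; lra.
have b2 : 0 < (b - l) ^+ 2 by rewrite exprn_gt0 //; lra.
rewrite ler_pdivrMr // mulrAC ler_pdivlMr // -subr_ge0.
have -> : a * (b - l) ^+ 2 - b * (a - l) ^+ 2 = (b - a) * (a * b - l * l) by ring.
apply: mulr_ge0; first by lra.
by rewrite subr_ge0; apply: ler_pM; lra.
Qed.

(** The share drops below [l'] when either of the opinions does: two
deviations to be excluded, hence the factor 2. *)
Lemma slow_chebyshev n t l l' eta : (0 < n)%N -> 0 <= eta ->
  0 <= l <= 1 / 2 -> 0 <= l' < f l -> slow n t l' eta ->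
  slow n t.+1 l (eta + 2 * f l / (n%:R * (f l - l') ^+ 2)).
Proof.
move=> n0 eta0 hl hle hF; apply: slow_step hF eta0 _ => k kn hk.
have hv := nat_state kn; have hp := step_prob hv.
have nR : 0 < (n%:R : R) by rewrite ltr0n.
have [_ [hm1 hm2]] := update_minority hv.
have := minority_half hv => /andP[hh0 hh1].
have fl : f l <= f (minority n k%:R) by apply: (update_mono hf); lra.
set p := f (k%:R / n%:R) in hp hm1 hm2 *.
pose e1 := p - l'; pose e2 := 1 - p - l'.
have e10 : 0 < e1 by rewrite /e1; lra.
have e20 : 0 < e2 by rewrite /e2; lra.
apply: (@le_trans _ _ (binE n p (fun x => 1 * indic (x / n%:R < l') + 1 * indic (1 - x / n%:R < l')))).
  apply: binE_le => // j jn; rewrite !mul1r /indic /minority gt_min.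
  by case: ltP => _; case: ltP => _ /=; lra_goal.
rewrite (binE_lin n p 1 1 (fun x => indic (x / n%:R < l'))) !mul1r.
have b1 : binE n p (fun x => indic (x / n%:R < l')) <= p * (1 - p) / (n%:R * e1 ^+ 2).
  apply: binE_chebyshev => //; first by rewrite gt_eqF.
  move=> j jn; rewrite /indic; case: ltP => h; last exact: sqr_ge0.
  rewrite expr_div_n ler_pdivlMr ?exprn_gt0 // mul1r -[leRHS]sqrrN.
  by rewrite ler_sqr ?nnegrE /e1; lra.
have b2 : binE n p (fun x => indic (1 - x / n%:R < l')) <= p * (1 - p) / (n%:R * e2 ^+ 2).
  apply: binE_chebyshev => //; first by rewrite gt_eqF.
  move=> j jn; rewrite /indic; case: ltP => h; last exact: sqr_ge0.
  rewrite expr_div_n ler_pdivlMr ?exprn_gt0 // mul1r.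
  by rewrite ler_sqr ?nnegrE /e2; lra.
have c1 : p * (1 - p) / (n%:R * e1 ^+ 2) <= f l / (n%:R * (f l - l') ^+ 2).
  have -> : p * (1 - p) / (n%:R * e1 ^+ 2) = (p / e1 ^+ 2) * (1 - p) / n%:R.
    by rewrite invfM; ring.
  have -> : f l / (n%:R * (f l - l') ^+ 2) = f l / (f l - l') ^+ 2 / n%:R.
    by rewrite invfM; ring.
  rewrite ler_pM2r ?invr_gt0 //.
  apply: (@le_trans _ _ (p / e1 ^+ 2 * 1)).
    rewrite ler_wpM2l; [by []| |by lra].
    by rewrite divr_ge0 ?sqr_ge0; lra.
  by rewrite mulr1; apply: ratio_antitone; lra.
have c2 : p * (1 - p) / (n%:R * e2 ^+ 2) <= f l / (n%:R * (f l - l') ^+ 2).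
  have -> : p * (1 - p) / (n%:R * e2 ^+ 2) = p * ((1 - p) / e2 ^+ 2) / n%:R.
    by rewrite invfM; ring.
  have -> : f l / (n%:R * (f l - l') ^+ 2) = f l / (f l - l') ^+ 2 / n%:R.
    by rewrite invfM; ring.
  rewrite ler_pM2r ?invr_gt0 //.
  apply: (@le_trans _ _ (1 * ((1 - p) / e2 ^+ 2))).
    have /andP[p0 p1] := hp.
    by rewrite ler_wpM2r ?divr_ge0 ?sqr_ge0 ?subr_ge0.
  by rewrite mul1r; apply: ratio_antitone; lra.
have -> : 2 * f l / (n%:R * (f l - l') ^+ 2) =
  f l / (n%:R * (f l - l') ^+ 2) + f l / (n%:R * (f l - l') ^+ 2) by ring.
lra.
Qed.

Lemma fast_mono n t l l' eta eta' : l <= l' -> eta <= eta' ->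
  fast n t l' eta -> fast n t l eta'.
Proof. by move=> ll ee hF k kn hk; have := hF k kn (le_trans hk ll); lra. Qed.

Lemma slow_mono n t l l' eta eta' : l' <= l -> eta <= eta' ->
  slow n t l' eta -> slow n t l eta'.
Proof. by move=> ll ee hF k kn hk; have := hF k kn (le_trans ll hk); lra. Qed.

Lemma fast0 n l : l * n%:R < 1 -> fast n 0 l 0.
Proof.
case: n => [|n] hl k kn hk; rewrite subr0 /= /consensus.
  by move: kn; rewrite leqn0 => /eqP ->; rewrite eqxx.
have nR : 0 < (n.+1%:R : R) by rewrite ltr0n.
move: hk; rewrite /minority ge_min => /orP[].
  rewrite ler_pdivrMr // => h; have : (k%:R : R) < 1 by lra.
  by rewrite (ltr_nat R k 1) ltnS leqn0 => /eqP ->; rewrite subr0 eqxx orbT.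
move=> h.
have h2 : (n.+1%:R : R) - k%:R < 1.
  have -> : n.+1%:R - k%:R = (1 - k%:R / n.+1%:R) * n.+1%:R :> R.
    by rewrite mulrBl mul1r divfK // gt_eqF.
  by apply: le_lt_trans hl; rewrite ler_pM2r.
have : k = n.+1.
  apply/eqP; rewrite eqn_leq kn /=.
  by move: h2; rewrite -natrB // (ltr_nat R _ 1) ltnS leqn0 subn_eq0.
by move=> ->; rewrite eqxx.
Qed.

Lemma slow0 n l : (0 < n)%N -> 0 < l -> slow n 0 l 0.
Proof.
move=> n0 l0 k kn hk; rewrite /= /consensus.
have nR : 0 < (n%:R : R) by rewrite ltr0n.
have : 0 < minority n k%:R by lra.
rewrite /minority lt_min pmulr_lgt0 ?invr_gt0 // subr_gt0 ltr_pdivrMr // mul1r => /andP[h1 h2].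
by rewrite lt_eqF //= subr_eq addrC -subr_eq subrr eq_sym gt_eqF.
Qed.

End Kernel.

(** * Mean value and Taylor estimates *)

Section Calculus.
Context {R : realType}.
Implicit Types (f g F G H : R -> R) (x y z a b c s t C : R).

(** Derivation rules for functions written pointwise, with the derivative as an
argument, so that they compose to the derivative of a compound expression. *)
Lemma derive_add f g x a b : is_derive x 1 f a -> is_derive x 1 g b ->
  is_derive x 1 (fun y => f y + g y) (a + b).
Proof. by move=> hf hg; exact: is_deriveD. Qed.

Lemma derive_mul f g x a b : is_derive x 1 f a -> is_derive x 1 g b ->
  is_derive x 1 (fun y => f y * g y) (f x * b + g x * a).
Proof. by move=> hf hg; exact: is_deriveM. Qed.

Lemma derive_comp f g x a b : is_derive (g x) 1 f a -> is_derive x 1 g b ->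
  is_derive x 1 (fun y => f (g y)) (a * b).
Proof. by move=> hf hg; exact: is_derive1_comp. Qed.

Lemma derive_eq f x a b : a = b -> is_derive x 1 f a -> is_derive x 1 f b.
Proof. by move=> ->. Qed.

Lemma derive_c c x : is_derive x (1 : R) (fun=> c) 0.
Proof. exact: is_derive_cst. Qed.

Lemma derive_i x : is_derive x (1 : R) (fun y : R => y) 1.
Proof. exact: is_derive_id. Qed.

Lemma derive_lin k z : is_derive z (1 : R) (fun w : R => w * k) k.
Proof.
by refine (derive_eq _ (derive_mul (derive_i z) (derive_c k z))); rewrite mulr0 mulr1 add0r.
Qed.

Lemma derive_continuous f x a : is_derive x 1 f a -> {for x, continuous f}.
Proof. by move=> [h _]; apply/differentiable_continuous/derivable1_diffP. Qed.

Lemma mean_value_bound F G a b C :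
  (forall z, Num.min a b <= z <= Num.max a b ->
     is_derive z 1 F (G z) /\ `|G z| <= C) ->
  `|F b - F a| <= C * `|b - a|.
Proof.
wlog ab : a b / a <= b.
  move=> h; have [/h //|] := boolP (a <= b); rewrite -ltNge => /ltW /h hba hz.
  by rewrite distrC [`|b - a|]distrC; apply: hba => z; rewrite minC maxC; exact: hz.
rewrite min_l // max_r //; move: ab; rewrite le_eqVlt => /orP[/eqP ->|ab] h.
  by rewrite !subrr normr0 mulr0.
have cont : {within `[a, b], continuous F}.
  apply: derivable_within_continuous => w.
  by rewrite in_itv /= => /h[[]].
have [z /subset_itv_oo_cc hz ->] := MVT ab (fun z hz => (h z (subset_itv_oo_cc hz)).1) cont.
by rewrite normrM ler_wpM2r //; have [] := h z hz.
Qed.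

Lemma taylor2 F G H x t C : 0 <= C ->
  (forall z, is_derive z 1 F (G z)) -> (forall z, is_derive z 1 G (H z)) ->
  (forall z, exists2 D, is_derive z 1 H D & `|D| <= C) ->
  `|F (x + t) - F x - t * G x - t ^+ 2 / 2 * H x| <= C * `|t| ^+ 3.
Proof.
move=> C0 hF hG hH.
have between u : Num.min 0 t <= u <= Num.max 0 t -> `|u| <= `|t|.
  case: (leP 0 t) => t0 hu; first by rewrite !ger0_norm; lra.
  by rewrite !ler0_norm; lra.
have hadd z : is_derive z 1 (fun u => x + u) (0 + 1 : R).
  exact: (derive_add (derive_c x z) (derive_i z)).
have [D hD] : exists D, forall z, is_derive z 1 H (D z) /\ `|D z| <= C.
  suff /choice[D hD] : forall z, exists D, is_derive z 1 H D /\ `|D| <= C by exists D.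
  by move=> z; have [D ? ?] := hH z; exists D.
have s1 u : `|H (x + u) - H x| <= C * `|u|.
  have e : u = x + u - x by ring.
  by rewrite [in leRHS]e; apply: (@mean_value_bound _ D) => z _; exact: hD.
have s2 u : `|G (x + u) - u * H x - G x| <= C * `|u| ^+ 2.
  have := @mean_value_bound (fun w => G (x + w) - w * H x) (fun w => H (x + w) - H x) 0 u (C * `|u|).
  rewrite addr0 mul0r !subr0 -mulrA -expr2; apply => z hz; split.
    have -> : (fun w => G (x + w) - w * H x) = (fun w => G (x + w) + w * - H x).
      by apply/funext => w; ring.
    by refine (derive_eq _ (derive_add (derive_comp (hG (x + z)) (hadd z))
      (derive_lin (- H x) z))); ring.
  apply: (le_trans (s1 z)); rewrite ler_wpM2l //.
  move: hz; case: (leP 0 u) => t0 hu; first by rewrite !ger0_norm; lra.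
  by rewrite !ler0_norm; lra.
have -> : C * `|t| ^+ 3 = C * `|t| ^+ 2 * `|t - 0| by rewrite subr0 -mulrA -exprSr.
have -> : F (x + t) - F x - t * G x - t ^+ 2 / 2 * H x =
  (F (x + t) - t * G x - t ^+ 2 / 2 * H x) - (F (x + 0) - 0 * G x - 0 ^+ 2 / 2 * H x).
  by rewrite addr0; ring.
apply: (@mean_value_bound (fun w => F (x + w) - w * G x - w ^+ 2 / 2 * H x)
  (fun w => G (x + w) - w * H x - G x)) => z /between hz; split.
  have -> : (fun w => F (x + w) - w * G x - w ^+ 2 / 2 * H x) =
            (fun w => F (x + w) + (w * - G x + (w * w) * (- H x / 2))).
    by apply/funext => w; field.
  by refine (derive_eq _ (derive_add (derive_comp (hF (x + z)) (hadd z))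
    (derive_add (derive_lin (- G x) z) (derive_mul (derive_mul (derive_i z) (derive_i z))
      (derive_c (- H x / 2) z))))); field.
apply: (le_trans (s2 z)); rewrite ler_wpM2l //.
by rewrite ler_sqr ?nnegrE.
Qed.

Lemma taylor1 F G (s0 : R) s t C : 0 <= t -> s0 <= s -> 0 <= C ->
  (forall z, s0 <= z -> is_derive z 1 F (G z)) ->
  (forall z, s0 <= z -> exists2 D, is_derive z 1 G D & `|D| <= C) ->
  `|F (s + t) - F s - t * G s| <= C * t ^+ 2.
Proof.
move=> t0 ss C0 hF hG.
have hadd z : is_derive z 1 (fun u => s + u) (0 + 1 : R).
  exact: (derive_add (derive_c s z) (derive_i z)).
have [D hD] : exists D, forall z, s0 <= z -> is_derive z 1 G (D z) /\ `|D z| <= C.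
  suff /choice[D hD] : forall z, exists D, s0 <= z -> is_derive z 1 G D /\ `|D| <= C by exists D.
  move=> z; have [/hG[D ? ?]|z0] := leP s0 z; first by exists D.
  by exists 0.
have s1 u : 0 <= u -> `|G (s + u) - G s| <= C * u.
  move=> u0; have {2}-> : u = `|s + u - s| by rewrite addrAC subrr add0r ger0_norm.
  apply: (@mean_value_bound _ D) => z; rewrite min_l ?max_r; try lra.
  by move=> hz; apply: hD; lra.
have := @mean_value_bound (fun w => F (s + w) - w * G s) (fun w => G (s + w) - G s) 0 t (C * t).
rewrite addr0 mul0r !subr0 (ger0_norm t0) -mulrA -expr2.
have -> : F (s + t) - t * G s - F s = F (s + t) - F s - t * G s by ring.
apply => z; rewrite min_l // max_r // => hz; split.
  have -> : (fun w => F (s + w) - w * G s) = (fun w => F (s + w) + w * - G s).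
    by apply/funext => w; ring.
  have hF' : is_derive (s + z) 1 F (G (s + z)) by apply: hF; lra.
  by refine (derive_eq _ (derive_add (derive_comp hF' (hadd z)) (derive_lin (- G s) z))); ring.
by apply: (le_trans (s1 z _)); rewrite ?ler_wpM2l //; lra.
Qed.

End Calculus.

(** * The normal distribution function *)

Section NormalCdf.
Context {R : realType}.
Implicit Types (m s x y z c : R).

Definition ncdf m s c : R := fine (normal_prob m s `]-oo, c]).

Lemma normal_prob_fin m s A : measurable A -> normal_prob m s A \is a fin_num.
Proof. by move=> mA; exact: fin_num_measure. Qed.

Lemma ncdfE m s c : (ncdf m s c)%:E = normal_prob m s `]-oo, c].
Proof. by rewrite fineK // normal_prob_fin. Qed.

Lemma ncdf_01 m s c : 0 <= ncdf m s c <= 1.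
Proof. by rewrite -!lee_fin ncdfE measure_ge0 probability_le1. Qed.

Lemma ncdf_mono m s x y : x <= y -> ncdf m s x <= ncdf m s y.
Proof.
move=> xy; rewrite -lee_fin !ncdfE; apply: le_measure; rewrite ?inE //.
by apply: subset_itvl; rewrite bnd_simp.
Qed.

Lemma ncdf_derive m s x : s != 0 -> is_derive x 1 (ncdf m s) (normal_pdf m s x).
Proof.
move=> s0.
have hx : x < x + 1 by rewrite ltrDl.
have hi : lebesgue_measure.-integrable `]-oo, x + 1] (EFin \o normal_pdf m s).
  by apply: integrableS (integrable_normal_pdf m s).
have hc : {for x, continuous (normal_pdf m s)} by exact: continuous_normal_pdf.
have [dF F'] := continuous_FTC1 hx hi (ltNyr x) hc.
rewrite -F' derive1E; exact: derivableP.
Qed.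

Let idR : measurableTypeR R -> R := idfun.

#[local] HB.instance Definition _ :=
  @isMeasurableFun.Build _ _ _ _ idR (@measurable_id _ _ setT).

(** The identity is a random variable of law [P]. *)
Lemma cdf_tails (P : probability (measurableTypeR R) R) :
  fine (P [set` `]-oo, x]]) @[x --> -oo] --> (0 : R) /\
  fine (P [set` `]-oo, x]]) @[x --> +oo] --> (1 : R).
Proof.
split; [have := cvg_cdfNy0 (idR : {RV P >-> R})|have := cvg_cdfy1 (idR : {RV P >-> R})];
  by move=> /fine_cvgP[].
Qed.

Lemma ncdf_Ny m s : ncdf m s x @[x --> -oo] --> (0 : R).
Proof. exact: (cdf_tails (normal_prob m s)).1. Qed.

Lemma ncdf_y m s : ncdf m s x @[x --> +oo] --> (1 : R).
Proof. exact: (cdf_tails (normal_prob m s)).2. Qed.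

Definition gauss x : R := normal_peak 1 * expR (- (x * x / 2)).

Lemma normal_pdf_gauss : normal_pdf 0 1 = gauss.
Proof.
rewrite normal_pdfE ?oner_eq0 //; apply/funext => x.
rewrite /gauss /normal_fun subr0 expr1n; congr (_ * expR _).
by rewrite expr2; field.
Qed.

Lemma gauss_derive x : is_derive x 1 gauss (- x * gauss x).
Proof.
have -> : gauss = (fun y => expR ((y * y) * (-1 / 2)) * normal_peak 1).
  by apply/funext => y; rewrite /gauss mulrC; congr (expR _ * _); field.
have hE (w : R) : is_derive w 1 (@expR R) (expR w) by exact: is_derive_expR.
refine (derive_eq _ (derive_mul (derive_comp (hE _) (derive_mul (derive_mul (derive_i x) (derive_i x))
  (derive_c (-1 / 2) x))) (derive_c (normal_peak 1) x))).
by field.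
Qed.

Lemma gauss_moment x k : (k <= 4)%N -> `|x ^+ k * gauss x| <= 8 * normal_peak 1.
Proof.
move=> k4; have n0 : 0 <= normal_peak (1 : R) := normal_peak_ge0 1.
rewrite /gauss mulrCA normrM (ger0_norm n0) mulrC ler_wpM2r //.
rewrite normrM (ger0_norm (expR_ge0 _)) expRN ler_pdivrMr ?expR_gt0 //.
have y0 : 0 <= x * x / 2 by rewrite divr_ge0 // -expr2 sqr_ge0.
have := expR_ge1Dxn 1 y0; rewrite (_ : 2`! = 2)%N // => h.
have h2 : `|x ^+ k| <= 1 + x ^+ 4.
  have x4 : x ^+ 4 = `|x| ^+ 4 by rewrite -normrX ger0_norm // (exprM x 2 2) sqr_ge0.
  rewrite normrX x4; have [x1|x1] := leP `|x| 1.
    by have := exprn_ile1 k (normr_ge0 x) x1; have := exprn_ge0 4 (normr_ge0 x); lra.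
  by have := ler_weXn2l (ltW x1) k4; lra.
have : (x * x / 2) ^+ 2 / 2%:R = x ^+ 4 / 8 by field.
lra.
Qed.

(** Both sides have the same derivative in [c], and both vanish at [-oo]. *)
Lemma ncdf_scale m s c : 0 < s -> ncdf m s c = ncdf 0 1 ((c - m) / s).
Proof.
move=> s0; have s1 : s != 0 by rewrite gt_eqF.
pose D x := ncdf m s x + (-1) * ncdf 0 1 (x * s^-1 + (- m / s)).
have hD x : is_derive x 1 D 0.
  pose w := x * s^-1 + (- m / s).
  have hw : is_derive x 1 (fun x => x * s^-1 + (- m / s)) (s^-1 + 0).
    exact: (derive_add (derive_lin s^-1 x) (derive_c (- m / s) x)).
  have hN : is_derive w 1 (ncdf 0 1) (normal_pdf 0 1 w).
    by apply: ncdf_derive; rewrite oner_eq0.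
  refine (derive_eq _ (derive_add (ncdf_derive m x s1)
    (derive_mul (derive_c (-1) x) (derive_comp (g := fun x => x * s^-1 + (- m / s)) hN hw)))).
  have pk : normal_peak s = normal_peak 1 / s.
    rewrite /normal_peak -(mulrnAr (s ^+ 2)) -(mulrnAr (1 ^+ 2)) expr1n mul1r.
    by rewrite sqrtrM ?sqr_ge0 // sqrtr_sqr ger0_norm ?(ltW s0) // invfM mulrC.
  rewrite normal_pdf_gauss normal_pdfE // /gauss pk /normal_fun.
  have -> : - (x - m) ^+ 2 / (s ^+ 2 *+ 2) = - (w * w / 2) by rewrite /w; field.
  by ring.
have lim0 : D x @[x --> -oo] --> (0 : R).
  rewrite -[X in _ --> X]addr0 -[X in _ --> _ + X](mulr0 (-1)).
  apply: cvgD; first exact: ncdf_Ny.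
  apply: cvgM; first exact: cvg_cst.
  apply: (@cvg_comp _ _ _ (fun x => x * s^-1 + (- m / s)) (ncdf 0 1) _ -oo); last exact: ncdf_Ny.
  apply: (@cvg_comp _ _ _ (fun x => x * s^-1) (fun y => y + (- m / s)) _ -oo); last exact: cvg_addrr_Ny.
  by apply: gt0_cvgMlNy; [rewrite invr_gt0|exact: cvg_id].
have Dc : D = fun=> D c by apply/funext => x; exact: is_derive_0_is_cst.
have : D c = 0.
  move: lim0; rewrite Dc => h.
  exact: (cvg_unique _ (cvg_cst (D c)) h).
rewrite /D mulN1r => /eqP; rewrite subr_eq0 => /eqP ->; congr (ncdf 0 1 _).
by field.
Qed.

End NormalCdf.

(** * Binomial steps and the heat flow *)

Section Heat.
Context {R : realType}.
Implicit Types (s x y z p h : R).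

(** Solution of the heat equation [d/ds = (1/2) d^2/dx^2] started from the
indicator of the positive half-line. *)
Definition heat s x : R := ncdf 0 1 (x / Num.sqrt s).

Let c0 : R := 8 * normal_peak 1.

Let c0_ge0 : 0 <= c0.
Proof. by rewrite /c0 mulr_ge0 // normal_peak_ge0. Qed.

Let q s : R := (Num.sqrt s)^-1.

Let q_gt0 s : 0 < s -> 0 < q s.
Proof. by move=> s0; rewrite invr_gt0 sqrtr_gt0. Qed.

Let q_le s0 s : 0 < s0 -> s0 <= s -> q s <= q s0.
Proof.
move=> s00 ss; rewrite /q lef_pV2 ?posrE ?sqrtr_gt0 //; last by lra.
by rewrite ler_wsqrtr.
Qed.

Let qX_ge0 s k : 0 < s -> 0 <= q s ^+ k.
Proof. by move=> s0; rewrite exprn_ge0 // ltW // q_gt0. Qed.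

Let qX_le s0 s k : 0 < s0 -> s0 <= s -> q s ^+ k <= q s0 ^+ k.
Proof.
move=> s00 ss; apply: lerXn2r; rewrite ?nnegrE ?q_le // ltW // q_gt0 //.
exact: lt_le_trans ss.
Qed.

Let q_derive s : 0 < s -> is_derive s 1 q (- (q s ^+ 3) / 2).
Proof.
move=> s0; have r0 : Num.sqrt s != 0 by rewrite gt_eqF // sqrtr_gt0.
have hs : is_derive s 1 (@Num.sqrt R) (2 * Num.sqrt s)^-1 by exact: is_derive1_sqrt.
have := is_deriveV r0 hs.
apply: derive_eq; rewrite /q /GRing.scale /=.
by field.
Qed.

Let N_derive (z : R) : is_derive z 1 (ncdf (0 : R) 1) (gauss z).
Proof. by rewrite -normal_pdf_gauss; apply: ncdf_derive; rewrite oner_eq0. Qed.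

Let gm z k : (k <= 4)%N -> `|z ^+ k * gauss z| <= c0.
Proof. exact: gauss_moment. Qed.

Lemma heat_dx s x : is_derive x 1 (heat s) (gauss (x * q s) * q s).
Proof. exact: (derive_comp (g := fun x => x * q s) (N_derive _) (derive_lin (q s) x)). Qed.

Let dx2 s x := - (x * q s) * gauss (x * q s) * q s ^+ 2.

Lemma heat_dxx s x : is_derive x 1 (fun x => gauss (x * q s) * q s) (dx2 s x).
Proof.
refine (derive_eq _ (derive_mul (derive_comp (g := fun x => x * q s) (gauss_derive _)
  (derive_lin (q s) x)) (derive_c (q s) x))).
by rewrite /dx2; ring.
Qed.

Lemma heat_dxxx s x : 0 < s ->
  exists2 D, is_derive x 1 (dx2 s) D & `|D| <= 2 * c0 * q s ^+ 3.
Proof.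
move=> s0; exists ((x * q s) ^+ 2 * gauss (x * q s) * q s ^+ 3 - gauss (x * q s) * q s ^+ 3).
  have -> : dx2 s = (fun x => (x * (- q s ^+ 3)) * gauss (x * q s)).
    by apply/funext => w; rewrite /dx2; ring.
  refine (derive_eq _ (derive_mul (derive_lin (- q s ^+ 3) x)
    (derive_comp (g := fun x => x * q s) (gauss_derive _) (derive_lin (q s) x)))).
  by ring.
rewrite -mulrBl normrM (@ger0_norm _ (_ ^+ 3)) ?qX_ge0 //.
rewrite ler_wpM2r ?qX_ge0 //.
apply: (le_trans (ler_normB _ _)); have := gm (x * q s) (isT : (2 <= 4)%N).
have := gm (x * q s) (isT : (0 <= 4)%N); rewrite expr0 mul1r; lra.
Qed.

Lemma heat_ds s x : 0 < s -> is_derive s 1 (heat ^~ x) (dx2 s x / 2).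
Proof.
move=> s0.
refine (derive_eq _ (derive_comp (g := fun s => x * q s) (N_derive _)
  (derive_mul (derive_c x s) (q_derive s0)))).
by rewrite /dx2; field.
Qed.

Lemma heat_dss s x : 0 < s -> exists2 D,
  is_derive s 1 (fun s => dx2 s x / 2) D & `|D| <= c0 * q s ^+ 4.
Proof.
move=> s0; exists ((3 / 4 * ((x * q s) ^+ 1 * gauss (x * q s)) -
     1 / 4 * ((x * q s) ^+ 3 * gauss (x * q s))) * q s ^+ 4).
  have -> : (fun s => dx2 s x / 2) =
    (fun s => ((q s * q s) * q s) * (gauss (x * q s) * (- x / 2))).
    by apply/funext => w; rewrite /dx2; field.
  have hq := q_derive s0.
  have hg : is_derive s 1 (fun s => gauss (x * q s) * (- x / 2)) _ :=
    (derive_mul (derive_comp (g := fun s => x * q s) (gauss_derive _)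
       (derive_mul (derive_c x s) hq)) (derive_c (- x / 2) s)).
  refine (derive_eq _ (derive_mul (derive_mul (derive_mul hq hq) hq) hg)).
  by field.
rewrite normrM (@ger0_norm _ (_ ^+ 4)) ?qX_ge0 //.
rewrite ler_wpM2r ?qX_ge0 //.
have := gm (x * q s) (isT : (1 <= 4)%N); have := gm (x * q s) (isT : (3 <= 4)%N).
move: (_ ^+ 1 * _) (_ ^+ 3 * _) c0 => a b c; rewrite !ler_norml; lra.
Qed.

(** A centred Bernoulli step of size [h] and running the heat flow for its
variance [p * (1 - p) * h ^+ 2] agree to second order. *)
Lemma heat_bernoulli s0 : 0 < s0 -> exists2 C, 0 <= C & forall s x p h,
  s0 <= s -> 0 <= p <= 1 -> 0 <= h <= 1 ->
  `|p * heat s (x - (1 - p) * h) + (1 - p) * heat s (x + p * h)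
    - heat (s + p * (1 - p) * h ^+ 2) x| <= C * h ^+ 3.
Proof.
move=> s00; pose A := 2 * c0 * q s0 ^+ 3; pose B := c0 * q s0 ^+ 4.
have A0 : 0 <= A by exact: mulr_ge0 (mulr_ge0 (ler0n _ 2) c0_ge0) (qX_ge0 3 s00).
have B0 : 0 <= B by exact: mulr_ge0 c0_ge0 (qX_ge0 4 s00).
exists (A + B); first by lra.
move=> s x p h ss /andP[p0 p1] /andP[h0 h1].
have T t : `|heat s (x + t) - heat s x - t * (gauss (x * q s) * q s) - t ^+ 2 / 2 * dx2 s x| <= A * `|t| ^+ 3.
  apply: (taylor2 (F := heat s) (G := fun x => gauss (x * q s) * q s) (H := dx2 s)); [exact: A0| | |] => z.
  - exact: heat_dx.
  - exact: heat_dxx.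
  - have [|D hD hD2] := @heat_dxxx s z; first by lra.
    exists D; first exact: hD.
    exact: le_trans hD2 (ler_wpM2l (mulr_ge0 (ler0n _ 2) c0_ge0) (qX_le 3 s00 ss)).
have d0 : 0 <= p * (1 - p) * h ^+ 2 by rewrite !mulr_ge0 ?sqr_ge0 //; lra.
have S : `|heat (s + p * (1 - p) * h ^+ 2) x - heat s x - p * (1 - p) * h ^+ 2 * (dx2 s x / 2)| <= B * (p * (1 - p) * h ^+ 2) ^+ 2.
  apply: (@taylor1 _ (heat ^~ x) (fun s => dx2 s x / 2) s0); [exact: d0|exact: ss|exact: B0| |] => z hz.
    by apply: heat_ds; lra.
  have [|D hD hD2] := @heat_dss z x; first by lra.
  exists D; first exact: hD.
  exact: le_trans hD2 (ler_wpM2l c0_ge0 (qX_le 4 s00 hz)).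
have T1 := T (- ((1 - p) * h)); have T2 := T (p * h).
have e1 : `|- ((1 - p) * h)| ^+ 3 <= h ^+ 3.
  rewrite normrN ger0_norm ?mulr_ge0 ?subr_ge0 //.
  by rewrite ler_pXn2r ?nnegrE ?mulr_ge0 ?subr_ge0 // ler_piMl // gerBl.
have e2 : `|p * h| ^+ 3 <= h ^+ 3.
  rewrite ger0_norm ?mulr_ge0 //.
  by rewrite ler_pXn2r ?nnegrE ?mulr_ge0 // ler_piMl.
have e3 : (p * (1 - p) * h ^+ 2) ^+ 2 <= h ^+ 3.
  have p2 : 0 <= p * (1 - p) by rewrite mulr_ge0 // subr_ge0.
  have p3 : p * (1 - p) <= 1 by have := sqr_ge0 p; rewrite expr2; lra.
  have -> : (p * (1 - p) * h ^+ 2) ^+ 2 = (p * (1 - p)) ^+ 2 * h * h ^+ 3 by ring.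
  rewrite ler_piMl ?exprn_ge0 // mulr_ile1 ?exprn_ge0 //.
  by rewrite exprn_ile1.
have k1 := ler_wpM2l A0 e1; have k2 := ler_wpM2l A0 e2; have k3 := ler_wpM2l B0 e3.
have U1 : `|p * (heat s (x + - ((1 - p) * h)) - heat s x - - ((1 - p) * h) * (gauss (x * q s) * q s) - (- ((1 - p) * h)) ^+ 2 / 2 * dx2 s x)| <= p * (A * h ^+ 3).
  by rewrite normrM (ger0_norm p0) ler_wpM2l //; apply: le_trans T1 k1.
have p1' : 0 <= 1 - p by lra.
have U2 : `|(1 - p) * (heat s (x + p * h) - heat s x - (p * h) * (gauss (x * q s) * q s) - (p * h) ^+ 2 / 2 * dx2 s x)| <= (1 - p) * (A * h ^+ 3).
  by rewrite normrM (ger0_norm p1') ler_wpM2l //; apply: le_trans T2 k2.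
have {S} S := le_trans S k3.
move: S U1 U2; clear T T1 T2 k1 k2 k3.
move: (heat s (x - _)) (heat s (x + p * h)) (heat s x) (heat (s + _) x) (gauss _ * _) (dx2 s x).
move=> a b c e u v S U1 U2.
have -> : p * a + (1 - p) * b - e =
  p * (a - c - - ((1 - p) * h) * u - (- ((1 - p) * h)) ^+ 2 / 2 * v)
  + (1 - p) * (b - c - p * h * u - (p * h) ^+ 2 / 2 * v)
  - (e - c - p * (1 - p) * h ^+ 2 * (v / 2)) by field.
move: U1 U2 S; move: (p * (a - _ - _ - _)) ((1 - p) * (b - _ - _ - _)) (e - _ - _) => X Y Z U1 U2 S.
apply: (le_trans (ler_normB _ _)); have := ler_normD X Y.
have : p * (A * h ^+ 3) + (1 - p) * (A * h ^+ 3) = A * h ^+ 3 by ring.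
have : (A + B) * h ^+ 3 = A * h ^+ 3 + B * h ^+ 3 by ring.
move: (h ^+ 3) U1 U2 S => hh3 U1 U2 S; clear -U1 U2 S.
lra.
Qed.

(** Lindeberg's replacement of the trials one at a time. *)
Lemma heat_binomial s0 : 0 < s0 -> exists2 C, 0 <= C & forall j s x p h,
  s0 <= s -> 0 <= p <= 1 -> 0 <= h <= 1 ->
  `|binE j p (fun k => heat s (x - (k - j%:R * p) * h))
    - heat (s + j%:R * (p * (1 - p) * h ^+ 2)) x| <= j%:R * (C * h ^+ 3).
Proof.
move=> s00; have [C C0 hC] := heat_bernoulli s00; exists C => // j s x p h ss hp hh.
have d0 : 0 <= p * (1 - p) * h ^+ 2 by rewrite !mulr_ge0 ?sqr_ge0 //; lra.
elim: j x => [|j IH] x /=.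
  by rewrite !mul0r subr0 mul0r subr0 addr0 subrr normr0.
set G1 := (fun y : R => _); set G2 := (fun k : R => _).
have E1 : G1 = (fun k => heat s ((x - (1 - p) * h) - (k - j%:R * p) * h)).
  by apply/funext => k; rewrite /G1 -natr1; congr heat; ring.
have E2 : G2 = (fun k => heat s ((x + p * h) - (k - j%:R * p) * h)).
  by apply/funext => k; rewrite /G2 -natr1; congr heat; ring.
rewrite {}E1 {}E2.
have I1 := IH (x - (1 - p) * h); have I2 := IH (x + p * h).
have jd : 0 <= j%:R * (p * (1 - p) * h ^+ 2) by rewrite mulr_ge0.
have := hC (s + j%:R * (p * (1 - p) * h ^+ 2)) x p h ltac:(lra) hp hh.
have -> : s + j%:R * (p * (1 - p) * h ^+ 2) + p * (1 - p) * h ^+ 2 =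
  s + j.+1%:R * (p * (1 - p) * h ^+ 2) by rewrite -natr1; ring.
set s' := s + j%:R * _ in I1 I2 *; set s'' := s + _.
set b1 := binE j p _ in I1 *; set b2 := binE j p _ in I2 *.
set h1 := heat s' _ in I1 *; set h2 := heat s' _ in I2 *; set h3 := heat s'' x.
clearbody b1 b2 h1 h2 h3; clear IH hC jd; move=> I3; have /andP[p0 p1] := hp; have p1' : 0 <= 1 - p by lra.
have -> : p * b1 + (1 - p) * b2 - h3 =
  p * (b1 - h1) + (1 - p) * (b2 - h2) + (p * h1 + (1 - p) * h2 - h3) by ring.
apply: (le_trans (ler_normD _ _)).
have J1 : `|p * (b1 - h1)| <= p * (j%:R * (C * h ^+ 3)).
  by rewrite normrM (ger0_norm p0) ler_wpM2l.
have J2 : `|(1 - p) * (b2 - h2)| <= (1 - p) * (j%:R * (C * h ^+ 3)).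
  by rewrite normrM (ger0_norm p1') ler_wpM2l.
have := ler_normD (p * (b1 - h1)) ((1 - p) * (b2 - h2)).
have -> : j.+1%:R * (C * h ^+ 3) = p * (j%:R * (C * h ^+ 3)) + (1 - p) * (j%:R * (C * h ^+ 3)) + C * h ^+ 3.
  by rewrite -natr1; ring.
move: I3 J1 J2; lra_goal.
Qed.

Lemma heat_lipschitz s0 : 0 < s0 -> exists2 C, 0 <= C & forall s s' x x',
  s0 <= s -> s0 <= s' -> `|heat s x - heat s' x'| <= C * (`|s - s'| + `|x - x'|).
Proof.
move=> s00; pose A := c0 * q s0 ^+ 1; pose B := c0 * q s0 ^+ 2.
have A0 : 0 <= A by exact: mulr_ge0 c0_ge0 (qX_ge0 1 s00).
have B0 : 0 <= B by exact: mulr_ge0 c0_ge0 (qX_ge0 2 s00).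
exists (A + B); first by lra.
move=> s s' x x' ss ss'.
rewrite -(subrKA (heat s x')); apply: (le_trans (ler_normD _ _)).
have h1 : `|heat s x - heat s x'| <= A * `|x - x'|.
  apply: (@mean_value_bound _ _ (fun x => gauss (x * q s) * q s)) => z _.
  split; first exact: heat_dx.
  have ps : 0 < s by lra.
  rewrite -(expr1 (q s)) normrM (@ger0_norm _ (q s ^+ 1)) ?qX_ge0 //.
  rewrite /A ler_pM ?qX_ge0 ?qX_le // expr1.
  by have := gm (z * q s) (isT : (0 <= 4)%N); rewrite expr0 mul1r.
have h2 : `|heat s x' - heat s' x'| <= B * `|s - s'|.
  apply: (@mean_value_bound _ (heat ^~ x') (fun s => dx2 s x' / 2)) => z /andP[z1 _].
  have z0 : s0 <= z by apply: le_trans z1; rewrite le_min ss' ss.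
  split; first by apply: heat_ds; lra.
  have z00 : 0 < z by lra.
  rewrite /dx2 normrM normrM mulNr normrN -{1}(expr1 (x' * q z)) /B.
  rewrite (@ger0_norm _ (q z ^+ 2)) ?sqr_ge0 // (@ger0_norm _ 2^-1) ?invr_ge0 //.
  have k1 := gm (x' * q z) (isT : (1 <= 4)%N).
  have k2 : q z ^+ 2 <= q s0 ^+ 2 by exact: qX_le.
  have : `|(x' * q z) ^+ 1 * gauss (x' * q z)| * q z ^+ 2 <= c0 * q s0 ^+ 2.
    by rewrite ler_pM ?sqr_ge0.
  move: B0; rewrite /B; move: (_ * q z ^+ 2) (c0 * _) => a b; lra.
have : 0 <= B * `|x - x'| by rewrite mulr_ge0.
have : 0 <= A * `|s - s'| by rewrite mulr_ge0.
lra.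
Qed.

End Heat.

(** * Central limit theorem over finitely many rounds *)

Section CentralLimit.
Context {R : realType} (f : R -> R) (m : nat) (beta gamma : R).
Context (hf : majority_type f m beta gamma).

Definition limit_sd : R := Num.sqrt (1 / (4 * (gamma ^+ 2 - 1))).

Definition deviation (n : nat) (v : R) : R := (v - n%:R / 2) / Num.sqrt n%:R.

(** For large [n] and [a], the probability that after [a] rounds from state [v]
the deviation divided by [gamma ^+ a] is at most [c]. *)
Definition gauss_test (n : nat) (c v : R) : R := ncdf 0 1 ((c - deviation n v) / limit_sd).

Lemma variance_gt0 : 0 < 1 / (4 * (gamma ^+ 2 - 1)).
Proof.
have g1 := mt_gamma_gt1 hf; rewrite divr_gt0 // mulr_gt0 // subr_gt0.
by rewrite exprn_egt1.
Qed.

Lemma limit_sd_gt0 : 0 < limit_sd.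
Proof. by rewrite sqrtr_gt0 variance_gt0. Qed.

Lemma limit_sd_sqr : limit_sd ^+ 2 = 1 / (4 * (gamma ^+ 2 - 1)).
Proof. by rewrite sqr_sqrtr // ltW // variance_gt0. Qed.

(** The limiting variance [s] is the fixed point of the variance recursion:
[s + 1/4 = gamma ^+ 2 * s]. *)
Lemma limit_sd_step : Num.sqrt (limit_sd ^+ 2 + 1 / 4) = gamma * limit_sd.
Proof.
have g1 := mt_gamma_gt1 hf.
have -> : limit_sd ^+ 2 + 1 / 4 = (gamma * limit_sd) ^+ 2.
  rewrite exprMn limit_sd_sqr; field.
  by rewrite subr_eq0 gt_eqF // exprn_egt1.
by rewrite sqrtr_sqr ger0_norm // mulr_ge0 ?(ltW limit_sd_gt0) //; lra.
Qed.

Lemma deviation_ratio n v : (0 < n)%N ->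
  v / n%:R - 1 / 2 = deviation n v / Num.sqrt n%:R.
Proof.
move=> n0; have nR : (0 : R) < n%:R by rewrite ltr0n.
rewrite /deviation -mulrA -invfM -expr2 sqr_sqrtr ?ltW //.
by field; rewrite gt_eqF.
Qed.

(** A round is a binomial step for the heat flow. Started at time
[limit_sd ^+ 2], the flow runs for the time [p * (1 - p)], which is close to
1/4, and [limit_sd_step] rescales the result to a test function of the same
family. *)
Lemma test_step : exists2 C, 0 <= C & forall n c v, (0 < n)%N -> 0 <= v <= n%:R ->
  `|step f n (gauss_test n (gamma * c)) v - gauss_test n c v|
    <= C * (1 + deviation n v ^+ 2) / Num.sqrt n%:R.
Proof.
have g1 := mt_gamma_gt1 hf; have sd0 := limit_sd_gt0.
pose s0 := limit_sd ^+ 2; have s00 : 0 < s0 by rewrite exprn_gt0.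
have [C1 C10 hC1] := heat_binomial s00.
have [C2 C20 hC2] := heat_lipschitz s00.
have [C3 C30 hC3] := update_expand_half hf.
exists (C1 + C2 * (gamma ^+ 2 + C3)).
  by rewrite addr_ge0 // mulr_ge0 // addr_ge0 ?sqr_ge0 // ltW.
move=> n c v n0 hv; have nR : (0 : R) < n%:R by rewrite ltr0n.
pose r : R := Num.sqrt n%:R; have r0 : 0 < r by rewrite sqrtr_gt0.
have rn : r * r = n%:R by rewrite -expr2 sqr_sqrtr ?ltW.
pose h := r^-1; have h0 : 0 < h by rewrite invr_gt0.
have r1 : 1 <= r by rewrite -sqrtr1 ler_wsqrtr // ler1n.
have h1 : h <= 1 by rewrite invf_le1.
have hr : h * r = 1 by rewrite mulVf // gt_eqF.
have sdE : Num.sqrt s0 = limit_sd by rewrite sqrtr_sqr ger0_norm // ltW.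
pose V := deviation n v; pose p := f (v / n%:R).
have hp : 0 <= p <= 1 := step_prob hf hv.
have vE : v / n%:R = 1 / 2 + V * h by have := deviation_ratio v n0; rewrite -/V -/r -/h; lra.
have Vh : `|V * h| <= 1 / 2.
  have := state_ratio hv; rewrite ler_norml; lra.
have p1 : `|p - 1 / 2 - gamma * (V * h)| <= C3 * (V * h) ^+ 2.
  by have := hC3 _ Vh; rewrite -vE -/p; congr (`|_| <= _); ring.
have p2 : `|p - 1 / 2| <= gamma * `|V * h|.
  have := update_half_lipschitz hf (state_ratio hv); rewrite -/p.
  by have -> : v / n%:R - 1 / 2 = V * h by rewrite vE; ring.
have := hC1 n s0 (gamma * c - (p - 1 / 2) * r) p h (lexx _) hp ltac:(lra).
have -> : (fun k => heat s0 (gamma * c - (p - 1 / 2) * r - (k - n%:R * p) * h)) = gauss_test n (gamma * c).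
  apply/funext => k; rewrite /heat sdE /gauss_test /deviation -/r -/h.
  suff -> : gamma * c - (p - 1 / 2) * r - (k - n%:R * p) * h = gamma * c - (k - n%:R / 2) * h by [].
  rewrite -rn.
  have -> : (k - r * r * p) * h = k * h - (h * r) * r * p by ring.
  have -> : (k - r * r / 2) * h = k * h - (h * r) * r / 2 by ring.
  by rewrite hr; ring.
have -> : n%:R * (p * (1 - p) * h ^+ 2) = p * (1 - p).
  by rewrite -rn -[RHS]mulr1 -(expr1n _ 2) -hr; ring.
have -> : n%:R * (C1 * h ^+ 3) = C1 * h.
  by rewrite -rn -[RHS]mulr1 -(expr1n _ 2) -hr; ring.
rewrite -/(step f n (gauss_test n (gamma * c)) v).
have tE : gauss_test n c v = heat (s0 + 1 / 4) (gamma * (c - V)).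
  rewrite /gauss_test /heat limit_sd_step; congr (ncdf 0 1 _).
  by rewrite -/V; field; rewrite !gt_eqF //; lra.
have q0 : 0 <= p * (1 - p) by have /andP[pl pr] := hp; rewrite mulr_ge0 // subr_ge0.
have := hC2 (s0 + p * (1 - p)) (s0 + 1 / 4) (gamma * c - (p - 1 / 2) * r) (gamma * (c - V)).
rewrite !lerDl q0 divr_ge0 // => /(_ isT isT).
rewrite -tE.
have -> : s0 + p * (1 - p) - (s0 + 1 / 4) = - ((p - 1 / 2) ^+ 2) by field.
have -> : gamma * c - (p - 1 / 2) * r - gamma * (c - V) = - ((p - 1 / 2 - gamma * (V * h)) * r).
  have -> : (p - 1 / 2 - gamma * (V * h)) * r = (p - 1 / 2) * r - gamma * V * (h * r) by ring.
  by rewrite hr; ring.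
have n1 : `|- ((p - 1 / 2) ^+ 2)| = (p - 1 / 2) ^+ 2 by rewrite normrN ger0_norm // sqr_ge0.
have n2 : `|- ((p - 1 / 2 - gamma * (V * h)) * r)| = `|p - 1 / 2 - gamma * (V * h)| * r.
  by rewrite normrN normrM (ger0_norm (ltW r0)).
rewrite n1 n2.
have b1 : (p - 1 / 2) ^+ 2 <= gamma ^+ 2 * V ^+ 2 * h.
  have : `|p - 1 / 2| ^+ 2 <= (gamma * `|V * h|) ^+ 2.
    have g0 : 0 <= gamma by exact: ltW (lt_trans ltr01 g1).
    by apply: lerXn2r p2; rewrite nnegrE; [exact: normr_ge0|exact: mulr_ge0].
  rewrite exprMn !real_normK ?num_real // => /le_trans; apply.
  have -> : gamma ^+ 2 * (V * h) ^+ 2 = (gamma ^+ 2 * V ^+ 2 * h) * h by ring.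
  have gv : 0 <= gamma ^+ 2 * V ^+ 2 * h.
    exact: mulr_ge0 (mulr_ge0 (sqr_ge0 _) (sqr_ge0 _)) (ltW h0).
  exact: ler_piMr gv h1.
have b2 : `|p - 1 / 2 - gamma * (V * h)| * r <= C3 * V ^+ 2 * h.
  have -> : C3 * V ^+ 2 * h = (C3 * (V * h) ^+ 2) * r.
    by rewrite -[LHS]mulr1 -hr; ring.
  by rewrite ler_pM2r.
have b3 : C2 * ((p - 1 / 2) ^+ 2 + `|p - 1 / 2 - gamma * (V * h)| * r) <= C2 * (gamma ^+ 2 + C3) * V ^+ 2 * h.
  have -> : C2 * (gamma ^+ 2 + C3) * V ^+ 2 * h = C2 * (gamma ^+ 2 * V ^+ 2 * h + C3 * V ^+ 2 * h) by ring.
  by rewrite ler_wpM2l // lerD.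
move=> k1 k2.
have b4 : 0 <= C1 * V ^+ 2 * h by exact: mulr_ge0 (mulr_ge0 C10 (sqr_ge0 V)) (ltW h0).
have b5 : 0 <= C2 * (gamma ^+ 2 + C3) * h.
  exact: mulr_ge0 (mulr_ge0 C20 (addr_ge0 (sqr_ge0 gamma) (ltW C30))) (ltW h0).
have -> : (C1 + C2 * (gamma ^+ 2 + C3)) * (1 + deviation n v ^+ 2) / Num.sqrt n%:R =
  C1 * h + C1 * V ^+ 2 * h + C2 * (gamma ^+ 2 + C3) * h + C2 * (gamma ^+ 2 + C3) * V ^+ 2 * h.
  by rewrite -/V -/r -/h; ring.
have k3 := le_trans k1 b3.
move: k2 k3; move: (step _ _ _ _) (heat _ _) (gauss_test _ _ _) => a b e k2 k3.
have -> : a - e = (a - b) + (b - e) by ring.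
apply: (le_trans (ler_normD _ _)); move: k2 k3 b4 b5; lra_goal.
Qed.

(** The error in [test_step] grows with the deviation; this bound keeps it small
when further rounds are added. *)
Lemma deviation_step n v : (0 < n)%N -> 0 <= v <= n%:R ->
  step f n (fun w => 1 + deviation n w ^+ 2) v <= 2 * gamma ^+ 2 * (1 + deviation n v ^+ 2).
Proof.
move=> n0 hv; have g1 := mt_gamma_gt1 hf.
have nR : (0 : R) < n%:R by rewrite ltr0n.
pose r : R := Num.sqrt n%:R; have r0 : 0 < r by rewrite sqrtr_gt0.
have rn : r * r = n%:R by rewrite -expr2 sqr_sqrtr ?ltW.
have r00 : r != 0 by rewrite gt_eqF.
rewrite /step; set p := f _; have hp : 0 <= p <= 1 := step_prob hf hv.
have -> : (fun w => 1 + deviation n w ^+ 2) =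
  (fun w => 1 * (fun=> 1) w + (r * r)^-1 * (fun w => (w - n%:R / 2) ^+ 2) w).
  apply/funext => w; rewrite /deviation -/r; field.
  by rewrite r00.
rewrite (binE_lin n p 1 (r * r)^-1 (fun=> 1) (fun w => (w - n%:R / 2) ^+ 2)).
rewrite binE_cst binE_sq.
have p2 : `|p - 1 / 2| <= gamma * `|v / n%:R - 1 / 2|.
  by have := update_half_lipschitz hf (state_ratio hv); rewrite -/p.
move: p2; rewrite deviation_ratio // -/r; set V := deviation n v => p2.
have p3 : (p - 1 / 2) ^+ 2 * (r * r) <= gamma ^+ 2 * V ^+ 2.
  have : `|p - 1 / 2| ^+ 2 <= (gamma * `|V / r|) ^+ 2.
    by rewrite ler_sqr ?nnegrE // mulr_ge0 //; lra.
  rewrite exprMn !real_normK ?num_real // => h.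
  have -> : gamma ^+ 2 * V ^+ 2 = (gamma ^+ 2 * (V / r) ^+ 2) * (r * r) by field.
  by rewrite ler_wpM2r // mulr_ge0 // ltW.
have -> : (r * r)^-1 * (n%:R * p * (1 - p) + (n%:R * p - n%:R / 2) ^+ 2) =
  p * (1 - p) + (p - 1 / 2) ^+ 2 * (r * r).
  by rewrite -rn; field.
have g2 : 1 < gamma ^+ 2 by rewrite exprn_egt1.
have : p * (1 - p) <= 1 by have := sqr_ge0 p; rewrite expr2; lra.
have := mulr_ge0 (sqr_ge0 gamma) (sqr_ge0 V).
by rewrite !mul1r; lra.
Qed.

(** Since the limiting variance is a fixed point, one family of Gaussian test
functions serves all rounds. *)
Lemma test_iter a : exists2 C, 0 <= C & forall n c v, (0 < n)%N -> 0 <= v <= n%:R ->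
  `|iter a (step f n) (gauss_test n (gamma ^+ a * c)) v - gauss_test n c v|
    <= C * (1 + deviation n v ^+ 2) / Num.sqrt n%:R.
Proof.
have [C C0 hC] := test_step; have g1 := mt_gamma_gt1 hf.
elim: a => [|a [D D0 IH]].
  exists 0 => // n c v n0 hv; rewrite expr0 mul1r /= subrr normr0 !mul0r //.
exists (D * (2 * gamma ^+ 2) + C).
  apply: addr_ge0 => //; apply: mulr_ge0 => //; apply: mulr_ge0 => //.
  exact: sqr_ge0.
move=> n c v n0 hv.
have r0 : (0 : R) < Num.sqrt n%:R by rewrite sqrtr_gt0 ltr0n.
pose e w := D * (1 + deviation n w ^+ 2) / Num.sqrt n%:R.
have E w : e w = (D / Num.sqrt n%:R) * (1 + deviation n w ^+ 2) + 0 * 0.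
  by rewrite /e; ring.
have S1 : step f n e v <= D * (2 * gamma ^+ 2) * (1 + deviation n v ^+ 2) / Num.sqrt n%:R.
  have -> : e = (fun w => (D / Num.sqrt n%:R) * (fun w => 1 + deviation n w ^+ 2) w + 0 * (fun=> 0) w).
    by apply/funext => w; rewrite E.
  rewrite /step (binE_lin n _ (D / Num.sqrt n%:R) 0 (fun w => 1 + deviation n w ^+ 2)) mul0r addr0.
  have := deviation_step n0 hv; rewrite /step => h.
  have -> : D * (2 * gamma ^+ 2) * (1 + deviation n v ^+ 2) / Num.sqrt n%:R =
    (D / Num.sqrt n%:R) * (2 * gamma ^+ 2 * (1 + deviation n v ^+ 2)) by ring.
  by rewrite ler_wpM2l // divr_ge0 // ltW.
have S2 := hC n c v n0 hv.
have lin G H : step f n (fun w => 1 * G w + 1 * H w) v = step f n G v + step f n H v.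
  by rewrite /step binE_lin !mul1r.
have linN G H : step f n (fun w => 1 * G w + (-1) * H w) v = step f n G v - step f n H v.
  by rewrite /step binE_lin mul1r mulN1r.
set F := iter a (step f n) (gauss_test n (gamma ^+ a.+1 * c)).
have hF w : 0 <= w <= n%:R -> `|F w - gauss_test n (gamma * c) w| <= e w.
  by move=> hw; rewrite /F exprSr -mulrA; exact: IH.
rewrite iterS -/F.
have U : step f n F v <= step f n (gauss_test n (gamma * c)) v + step f n e v.
  rewrite -lin; apply: (step_le hf) => // k kn; have := hF k%:R (nat_state kn).
  by rewrite ler_norml; lra.
have L : step f n (gauss_test n (gamma * c)) v - step f n e v <= step f n F v.
  rewrite -linN; apply: (step_le hf) => // k kn; have := hF k%:R (nat_state kn).
  by rewrite ler_norml; lra.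
have -> : (D * (2 * gamma ^+ 2) + C) * (1 + deviation n v ^+ 2) / Num.sqrt n%:R =
  D * (2 * gamma ^+ 2) * (1 + deviation n v ^+ 2) / Num.sqrt n%:R + C * (1 + deviation n v ^+ 2) / Num.sqrt n%:R by ring.
move: S2; rewrite !ler_norml; lra.
Qed.

Lemma sqrt_nat_cvgy : (Num.sqrt (n%:R : R))^-1 @[n --> \oo] --> (0 : R).
Proof.
apply/cvgrPdist_le => e e0.
pose N := (Num.truncn (e ^- 2)).+1.
exists N => // n /= Nn; rewrite sub0r normrN ger0_norm ?invr_ge0 //.
have h : e ^- 2 <= n%:R.
  apply: (@le_trans _ _ N%:R); last by rewrite ler_nat.
  by rewrite ltW // /N; exact: truncnS_gt.
have e1 : 0 < e ^- 2 by rewrite invr_gt0 exprn_gt0.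
have n0 : (0 : R) < n%:R by lra.
rewrite -[e]invrK lef_pV2 ?posrE ?sqrtr_gt0 ?invr_gt0 //.
have -> : e^-1 = Num.sqrt (e ^- 2) by rewrite -exprVn sqrtr_sqr ger0_norm // invr_ge0 ltW.
by rewrite ler_wsqrtr.
Qed.

(** The error in [test_iter] vanishes because the initial deviations converge. *)
Lemma test_limit (x0 : nat -> R) (d : R) a c :
  (forall n, 0 <= x0 n <= n%:R) ->
  deviation n (x0 n) @[n --> \oo] --> d ->
  iter a (step f n) (gauss_test n (gamma ^+ a * c)) (x0 n) @[n --> \oo]
    --> ncdf 0 1 ((c - d) / limit_sd).
Proof.
move=> hx hd; have [C C0 hC] := test_iter a.
have l0 : (C * (1 + deviation n (x0 n) ^+ 2)) / Num.sqrt n%:R @[n --> \oo] --> (0 : R).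
  have -> : (0 : R) = C * (1 + d ^+ 2) * 0 by rewrite mulr0.
  apply: cvgM; last exact: sqrt_nat_cvgy.
  apply: cvgM; first exact: cvg_cst.
  apply: cvgD; first exact: cvg_cst.
  by rewrite expr2; have -> : (fun n => deviation n (x0 n) ^+ 2) = (fun n => deviation n (x0 n) * deviation n (x0 n)) by []; apply: cvgM.
have l1 : gauss_test n c (x0 n) @[n --> \oo] --> ncdf 0 1 ((c - d) / limit_sd).
  apply: (@cvg_comp _ _ _ (fun n => (c - deviation n (x0 n)) / limit_sd) (ncdf (0:R) 1)).
    apply: cvgM; last exact: cvg_cst.
    by apply: cvgB; [exact: cvg_cst|exact: hd].
  by apply: (derive_continuous (a := normal_pdf 0 1 ((c - d) / limit_sd))); apply: ncdf_derive; rewrite oner_eq0.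
have l2 : iter a (step f n) (gauss_test n (gamma ^+ a * c)) (x0 n) - gauss_test n c (x0 n) @[n --> \oo] --> (0 : R).
  apply/cvgrPdist_le => e e0; move/cvgrPdist_le : l0 => /(_ e e0)[N _ hN].
  exists N.+1 => // n /= Nn; rewrite sub0r normrN.
  apply: (le_trans (hC n c (x0 n) _ (hx n))); first exact: leq_ltn_trans Nn.
  have := hN n (ltnW Nn); rewrite /= sub0r normrN; apply: le_trans; exact: ler_norm.
have -> : (fun n => iter a (step f n) (gauss_test n (gamma ^+ a * c)) (x0 n)) =
  (fun n => (iter a (step f n) (gauss_test n (gamma ^+ a * c)) (x0 n) -
     gauss_test n c (x0 n)) + gauss_test n c (x0 n)).
  by apply/funext => n; rewrite subrK.
by rewrite -[X in _ --> X]add0r; exact: cvgD l2 l1.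
Qed.

End CentralLimit.

(** * Three stages: near 1/2, in between, near 0 *)

Section Stages.
Context {R : realType} (f : R -> R) (m : nat) (beta gamma : R).
Context (hf : majority_type f m beta gamma).

Lemma expR_natX (x : R) k : expR x ^+ k = expR (k%:R * x).
Proof.
elim: k => [|k IH]; first by rewrite expr0 mul0r expR0.
by rewrite exprS IH -expRD -natr1; congr expR; ring.
Qed.

Lemma error_ge0 n (kappa S : R) : 0 <= kappa -> 0 <= kappa / (n%:R * S ^+ 2).
Proof. by move=> k0; rewrite divr_ge0 // mulr_ge0 ?ler0n // sqr_ge0. Qed.

(** After [j] rounds the share is kept below [expR (- (m ^+ j * B + c + j))].
The term [j] makes the failure probabilities in Markov's inequality summable
without affecting the doubly exponential decay. Below [1 / n] there is
consensus, whence the last term of the error. *)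
Lemma late_fast : exists2 A, 0 < A & exists2 x0, 0 < x0 <= 1 / 2 &
  forall n J B c, (0 < n)%N -> 0 < B -> 0 <= c -> expR (- (B + c)) <= x0 ->
  fast f n J.+1 (expR (- (B + c)))
    (A * expR (- c) + 4 * n%:R * beta * expR (- (m%:R ^+ J.+1 * B))).
Proof.
have m1 := m_gt1 hf; have b0 := mt_beta_gt0 hf.
have m2 : (2 : R) <= m%:R by rewrite ler_nat; exact: mt_m_ge2 hf.
have [x0 hx0 hf0] := update_equiv0 hf b0.
have fu l : 0 < l <= x0 -> f l <= 2 * beta * l ^+ m.
  by move=> /hf0; rewrite ler_norml; lra.
exists (4 * beta * expR 1); first by rewrite !mulr_gt0 ?expR_gt0.
exists x0 => // n J B c n0; have nR : (0 : R) < n%:R by rewrite ltr0n.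
elim: J B c => [|J IH] B c B0 c0 hl.
  set l := expR _ in hl *; have l0 : 0 < l by exact: expR_gt0.
  have := @fast_markov _ _ _ _ _ hf n 0 l (1 / 2 / n%:R) 0 n0 (lexx _).
  have -> : 0 < 1 / 2 / n%:R :> R by rewrite divr_gt0 //; lra.
  have -> : 0 <= l <= 1 / 2 by lra.
  have hF : fast f n 0 (1 / 2 / n%:R) 0.
    by apply: fast0; rewrite divfK ?gt_eqF //; lra.
  move=> /(_ isT isT hF); apply: fast_mono => //; rewrite add0r.
  have -> : f l / (1 / 2 / n%:R) = 2 * n%:R * f l by field; rewrite gt_eqF.
  have h1 : f l <= 2 * beta * expR (- (m%:R ^+ 1 * B)).
    apply: (le_trans (fu l _)); first by rewrite l0.
    rewrite ler_wpM2l; [by []|lra|].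
    rewrite /l expR_natX expr1 ler_expR.
    by have := mulr_ge0 (ler0n R m) c0; lra.
  have : 0 <= 4 * beta * expR 1 * expR (- c).
    by rewrite !mulr_ge0 ?expR_ge0 //; lra.
  have : 2 * n%:R * f l <= 2 * n%:R * (2 * beta * expR (- (m%:R ^+ 1 * B))).
    by rewrite ler_wpM2l // mulr_ge0.
  lra.
have mB : B <= m%:R * B by rewrite ler_peMl; lra.
have hl' : expR (- (m%:R * B + (c + 1))) <= x0.
  by apply: le_trans hl; rewrite ler_expR; lra.
have := IH (m%:R * B) (c + 1) ltac:(lra) ltac:(lra) hl'.
set eta := _ + 4 * _ * _ * _.
set l := expR (- (B + c)) in hl *; set l' := expR _ => hF.
have l0 : 0 < l by exact: expR_gt0.
have l'0 : 0 < l' by exact: expR_gt0.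
have eta0 : 0 <= eta.
  by rewrite /eta addr_ge0 // !mulr_ge0 ?expR_ge0 ?ler0n //; lra.
have := @fast_markov _ _ _ _ _ hf n J.+1 l l' eta n0 eta0 l'0 ltac:(lra) hF.
apply: fast_mono => //.
have h1 : f l / l' <= 2 * beta * expR 1 * expR (- c).
  rewrite ler_pdivrMr //; apply: (le_trans (fu l _)); first by rewrite l0.
  rewrite -!mulrA ler_pM2l // ler_pM2l // -!expRD expR_natX ler_expR.
  have : 0 <= (m%:R - 2) * c by rewrite mulr_ge0 // subr_ge0.
  lra.
have e1 : m%:R ^+ J.+2 * B = m%:R ^+ J.+1 * (m%:R * B) by rewrite (exprSr _ J.+1) mulrA.
rewrite e1 /eta (opprD c) expRD.
have h2 : expR (- 1 : R) <= 1 / 2.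
  rewrite expRN mul1r lef_pV2 ?posrE ?expR_gt0 //.
  by have := expR_ge1Dx (1 : R); lra.
have h3 : 0 <= beta * expR 1 * expR (- c) by rewrite !mulr_ge0 ?expR_ge0 ?(ltW b0).
have : (beta * expR 1 * expR (- c)) * expR (- 1) <= (beta * expR 1 * expR (- c)) * (1 / 2).
  by rewrite ler_wpM2l.
lra.
Qed.

(** The share stays far above [1 / n], so Chebyshev's inequality suffices. The
constant [c] absorbs [beta] and the factor 2 lost by aiming at [f l / 2]. *)
Lemma late_slow : exists2 c, 0 <= c & exists2 x0, 0 < x0 <= 1 / 2 &
  forall n J B, (0 < n)%N -> 0 < B -> expR (- (B - c)) <= x0 ->
  slow f n J (expR (- (B - c))) (4 * J%:R * expR (m%:R ^+ J * B - c) / n%:R).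
Proof.
have m1 := m_gt1 hf; have b0 := mt_beta_gt0 hf.
have m2 : (2 : R) <= m%:R by rewrite ler_nat; exact: mt_m_ge2 hf.
have bb0 : 0 < beta / 2 by rewrite divr_gt0.
have [x0 hx0 hf0] := update_equiv0 hf bb0.
pose c := `|ln (4 / beta)|; have c0 : 0 <= c by exact: normr_ge0.
exists c => //; exists x0 => // n J B n0; have nR : (0 : R) < n%:R by rewrite ltr0n.
elim: J B => [|J IH] B B0 hl.
  by rewrite mulr0 !mul0r; apply: slow0 => //; exact: expR_gt0.
have mB : B <= m%:R * B by rewrite ler_peMl; lra.
have hl' : expR (- (m%:R * B - c)) <= x0.
  by apply: le_trans hl; rewrite ler_expR; lra.
have := IH (m%:R * B) ltac:(lra) hl'.
set eta := _ / n%:R.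
set l := expR (- (B - c)) in hl *; set l' := expR _ => hF.
have l0 : 0 < l by exact: expR_gt0.
have l'0 : 0 < l' by exact: expR_gt0.
have fl : l' <= f l / 2.
  have := hf0 l; rewrite l0 hl => /(_ isT); rewrite ler_norml => /andP[h _].
  have h1 : expR (- ln (4 / beta)) * expR (- (m%:R * B) + m%:R * c) <= f l / 2.
    rewrite expRN lnK ?posrE ?divr_gt0 //.
    have -> : - (m%:R * B) + m%:R * c = m%:R * - (B - c) by ring.
    rewrite -expR_natX -/l invf_div; lra.
  apply: le_trans h1; rewrite -expRD /l' ler_expR.
  have := ler_norm (ln (4 / beta)); rewrite -/c.
  have : 0 <= (m%:R - 2) * c by rewrite mulr_ge0 // subr_ge0.
  lra.
have eta0 : 0 <= eta.
  by rewrite /eta !mulr_ge0 ?expR_ge0 ?invr_ge0 ?ler0n //; lra.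
have := @slow_chebyshev _ _ _ _ _ hf n J l l' eta n0 eta0 ltac:(lra) ltac:(lra) hF.
apply: slow_mono => //.
have fl0 : 0 < f l by lra.
have h1 : 2 * f l / (n%:R * (f l - l') ^+ 2) <= 4 / (n%:R * l').
  rewrite ler_pdivrMr; last by rewrite mulr_gt0 // exprn_gt0; lra.
  rewrite mulrAC ler_pdivlMr; last by rewrite mulr_gt0.
  have h2 : (f l / 2) ^+ 2 <= (f l - l') ^+ 2 by rewrite ler_sqr ?nnegrE; lra.
  have h3 : f l * l' <= f l * (f l / 2) by rewrite ler_wpM2l // ltW.
  have h4 : n%:R * (f l * l') <= n%:R * (f l * (f l / 2)) by rewrite ler_wpM2l // ltW.
  have h5 : n%:R * (f l / 2) ^+ 2 <= n%:R * (f l - l') ^+ 2 by rewrite ler_wpM2l // ltW.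
  have : n%:R * (f l / 2) ^+ 2 = n%:R * (f l * (f l / 2)) / 2 by field.
  lra.
have h2 : 4 / (n%:R * l') = 4 * expR (m%:R * B - c) / n%:R.
  by rewrite invfM /l' -expRN opprK mulrA mulrAC.
have h3 : expR (m%:R * B - c) <= expR (m%:R ^+ J.+1 * B - c).
  rewrite ler_expR lerD2r exprSr -mulrA ler_peMl //; first by lra.
  by rewrite exprn_ege1 // ltW.
have h4 : 4 * expR (m%:R * B - c) / n%:R <= 4 * expR (m%:R ^+ J.+1 * B - c) / n%:R.
  by rewrite ler_pM2r ?invr_gt0 // ler_pM2l.
have -> : 4 * J.+1%:R * expR (m%:R ^+ J.+1 * B - c) / n%:R =
  4 * J%:R * expR (m%:R ^+ J.+1 * B - c) / n%:R + 4 * expR (m%:R ^+ J.+1 * B - c) / n%:R.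
  by rewrite -natr1; ring.
rewrite /eta mulrA -exprSr.
by move: h1 h2 h4; lra.
Qed.

Lemma iter_update_lipschitz J x y : 0 <= x <= y -> y <= 1 / 2 ->
  0 <= iter J f x <= iter J f y /\ iter J f y <= 1 / 2 /\
  iter J f y - iter J f x <= gamma ^+ J * (y - x).
Proof.
move=> hx hy; have g0 := gamma_gt0 hf; elim: J => [|J [IH1 [IH2 IH3]]] /=.
  by split=> //; split=> //; rewrite expr0 mul1r.
have fx := update_in_half hf (x := iter J f x) ltac:(lra).
have fy := update_in_half hf (x := iter J f y) ltac:(lra).
have fm := update_mono hf IH1 IH2.
split; first by lra.
split; first by lra.
apply: (le_trans (update_lipschitz hf IH1 IH2)).
by rewrite exprS -mulrA ler_pM2l.
Qed.

Lemma nat_inv_small (ns : nat -> nat) (C e : R) : 0 < e ->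
  ns i @[i --> \oo] --> \oo ->
  \forall i \near \oo, (0 < ns i)%N /\ C / (ns i)%:R <= e.
Proof.
move=> e0 hns.
have hN : \forall i \near \oo, ((Num.truncn (C / e)).+1 <= ns i)%N.
  by have := hns _ (nbhs_infty_ge (Num.truncn (C / e)).+1); rewrite nbhs_simpl.
apply: filterS hN => i hi.
have n0 : (0 < ns i)%N by apply: leq_trans hi.
split => //; rewrite ler_pdivrMr ?ltr0n // mulrC -ler_pdivrMr //.
apply: ltW; apply: (@lt_le_trans _ _ (Num.truncn (C / e)).+1%:R).
  exact: truncnS_gt.
by rewrite ler_nat.
Qed.

(** Boundedly many rounds away from both fixed points, each with an error of
order [1 / n]; the room between [iter J f l] and [l'] is shared out among them. *)
Lemma middle_fast (ns T : nat -> nat) J l l' eta eta' :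
  ns i @[i --> \oo] --> \oo -> 0 <= l < 1 / 2 -> iter J f l < l' ->
  0 <= eta < eta' -> (\forall i \near \oo, fast f (ns i) (T i) l' eta) ->
  \forall i \near \oo, fast f (ns i) (J + T i) l eta'.
Proof.
move=> hns + + + hF; have g0 := gamma_gt0 hf.
elim: J l eta' => [|J IH] l eta' hl hJ he.
  by apply: filterS hF => i; apply: fast_mono => /=; [exact: ltW|lra].
rewrite iterSr in hJ.
have fl := update_le_id hf (x := l) ltac:(lra).
have fl0 := update_ge0 hf (x := l) ltac:(lra).
have gJ : 0 < gamma ^+ J by rewrite exprn_gt0.
pose e := Num.min ((1 / 2 - f l) / 2) ((l' - iter J f (f l)) / (2 * gamma ^+ J)).
have e0 : 0 < e by rewrite /e lt_min !divr_gt0 ?mulr_gt0 ?subr_gt0 //; lra.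
have e1 : e <= (1 / 2 - f l) / 2 by rewrite /e ge_min lexx.
have e2 : gamma ^+ J * e * 2 <= l' - iter J f (f l).
  have : e <= (l' - iter J f (f l)) / (2 * gamma ^+ J) by rewrite /e ge_min lexx orbT.
  by rewrite ler_pdivlMr ?mulr_gt0 //; lra.
have [_ [_]] := @iter_update_lipschitz J (f l) (f l + e) ltac:(lra) ltac:(lra).
have -> : f l + e - f l = e by ring.
move=> h1.
have ge : 0 < gamma ^+ J * e by rewrite mulr_gt0.
have hIH := IH (f l + e) ((eta + eta') / 2) ltac:(lra) ltac:(lra) ltac:(lra).
have hs := @nat_inv_small ns (1 / e ^+ 2) ((eta' - eta) / 2) ltac:(lra) hns.
near=> i.
have [n0 hn] : (0 < ns i)%N /\ 1 / e ^+ 2 / (ns i)%:R <= (eta' - eta) / 2.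
  by near: i.
have hi : fast f (ns i) (J + T i) (f l + e) ((eta + eta') / 2) by near: i.
rewrite addSn.
have := @fast_chebyshev _ _ _ _ _ hf (ns i) (J + T i) l (f l + e) e _ n0 _ e0 _ (lexx _) hi.
move=> /(_ ltac:(lra) ltac:(lra)); apply: fast_mono => //.
have : f l / ((ns i)%:R * e ^+ 2) <= 1 / e ^+ 2 / (ns i)%:R.
  rewrite invfM mulrA mulrAC ler_wpM2r ?invr_ge0 ?ler0n // ler_wpM2r ?invr_ge0 ?sqr_ge0 //; lra.
lra.
Unshelve. all: by end_near. Qed.

Lemma middle_slow (ns T : nat -> nat) J l l' eta eta' :
  ns i @[i --> \oo] --> \oo -> 0 < l < 1 / 2 -> l' < iter J f l ->
  0 <= eta < eta' -> (\forall i \near \oo, slow f (ns i) (T i) l' eta) ->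
  \forall i \near \oo, slow f (ns i) (J + T i) l eta'.
Proof.
move=> hns + + + hF; have g0 := gamma_gt0 hf.
elim: J l eta' => [|J IH] l eta' hl hJ he.
  by apply: filterS hF => i; apply: slow_mono => /=; [exact: ltW|lra].
rewrite iterSr in hJ.
have fl := update_le_id hf (x := l) ltac:(lra).
have fl0 := update_gt0 hf (x := l) ltac:(lra).
have gJ : 0 < gamma ^+ J by rewrite exprn_gt0.
pose e := Num.min (f l / 2) ((iter J f (f l) - l') / (2 * gamma ^+ J)).
have e0 : 0 < e by rewrite /e lt_min !divr_gt0 ?mulr_gt0 ?subr_gt0 //; lra.
have e1 : e <= f l / 2 by rewrite /e ge_min lexx.
have e2 : gamma ^+ J * e * 2 <= iter J f (f l) - l'.
  have : e <= (iter J f (f l) - l') / (2 * gamma ^+ J) by rewrite /e ge_min lexx orbT.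
  by rewrite ler_pdivlMr ?mulr_gt0 //; lra.
have [_ [_]] := @iter_update_lipschitz J (f l - e) (f l) ltac:(lra) ltac:(lra).
have -> : f l - (f l - e) = e by ring.
move=> h1.
have ge : 0 < gamma ^+ J * e by rewrite mulr_gt0.
have hIH := IH (f l - e) ((eta + eta') / 2) ltac:(lra) ltac:(lra) ltac:(lra).
have hs := @nat_inv_small ns (2 / e ^+ 2) ((eta' - eta) / 2) ltac:(lra) hns.
near=> i.
have [n0 hn] : (0 < ns i)%N /\ 2 / e ^+ 2 / (ns i)%:R <= (eta' - eta) / 2.
  by near: i.
have hi : slow f (ns i) (J + T i) (f l - e) ((eta + eta') / 2) by near: i.
rewrite addSn.
have := @slow_chebyshev _ _ _ _ _ hf (ns i) (J + T i) l (f l - e) _ n0 _ _ _ hi.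
move=> /(_ ltac:(lra) ltac:(lra) ltac:(lra)); apply: slow_mono => //.
have -> : f l - (f l - e) = e by ring.
have : 2 * f l / ((ns i)%:R * e ^+ 2) <= 2 / e ^+ 2 / (ns i)%:R.
  rewrite invfM mulrA mulrAC ler_wpM2r ?invr_ge0 ?ler0n // ler_wpM2r ?invr_ge0 ?sqr_ge0 //; lra.
lra.
Unshelve. all: by end_near. Qed.

(** Rounds near 1/2. The slack [S] grows at a rate [r] strictly between 1 and
[gamma], so the Chebyshev errors [1 / (n * S ^+ 2)] sum geometrically. *)
Lemma early_fast : exists2 K, 0 < K & exists2 E0, 0 < E0 & exists2 kappa, 0 < kappa &
  forall n t eta J E S, (0 < n)%N -> 0 <= eta -> 0 < E -> gamma ^+ J * E <= E0 ->
  0 < S <= E ->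
  fast f n t (1 / 2 - gamma ^+ J * E * (1 - K * (gamma ^+ J * E))) eta ->
  fast f n (J + t) (1 / 2 - (E * (1 - K * E) + S)) (eta + kappa / (n%:R * S ^+ 2)).
Proof.
have g1 := mt_gamma_gt1 hf; have [K K0 [E0 E00 hK]] := update_corrected hf.
pose r := (1 + gamma) / 2; have r1 : 1 < r by rewrite /r; lra.
have r0 : 0 < r by exact: lt_trans ltr01 r1.
have rg : 0 < gamma - r by rewrite /r; lra.
have rle : r <= gamma by rewrite -subr_ge0 ltW.
have r2 : 1 < r ^+ 2 by rewrite exprn_egt1.
pose D := (gamma - r) ^+ 2; have D0 : 0 < D by rewrite exprn_gt0.
(* The sum of the geometric series [r ^- (2 * j) / D]. *)
pose kappa := r ^+ 2 / (D * (r ^+ 2 - 1)).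
have k0 : 0 < kappa by rewrite divr_gt0 ?mulr_gt0 ?subr_gt0 //; lra.
have kE : kappa / r ^+ 2 + 1 / D = kappa.
  by rewrite /kappa; field; rewrite !gt_eqF ?subr_gt0 //; lra.
exists K => //; exists E0 => //; exists kappa => // n t eta J E S n0 eta0.
have nR : (0 : R) < n%:R by rewrite ltr0n.
elim: J E S => [|J IH] E S Epos hE hS hF.
  apply: fast_mono hF.
    by rewrite expr0 mul1r; lra.
  by rewrite lerDl error_ge0 // ltW.
have gE : 0 < gamma * E by rewrite mulr_gt0; lra.
rewrite exprSr -mulrA in hE hF.
have /andP[S00 SE] := hS.
have rS : 0 < r * S <= gamma * E.
  by rewrite (mulr_gt0 r0 S00) (ler_pM (ltW r0) (ltW S00) rle SE).
have := IH (gamma * E) (r * S) gE hE rS hF.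
set eta' := eta + _ => hF'.
have eta'0 : 0 <= eta' by rewrite /eta' addr_ge0 // error_ge0 // ltW.
have hE1 : gamma * E <= E0.
  by apply: le_trans hE; rewrite ler_peMl ?(ltW gE) // exprn_ege1 // ltW.
have := hK E S r Epos hE1 ltac:(lra) => -[h1 _ _ h4].
have S0 : 0 < (gamma - r) * S by exact: mulr_gt0.
rewrite addSn; have := @fast_chebyshev _ _ _ _ _ hf n (J + t) _ _ _ _ n0 eta'0 S0 _ h4 hF'.
move=> /(_ ltac:(lra)); apply: fast_mono => //.
set l := 1 / 2 - _; have fl : f l <= 1.
  have hl : 0 <= l <= 1 / 2 by move: h1; rewrite /l; lra_goal.
  by have := update_in_half hf hl; lra_goal.
have nS : 0 < n%:R * S ^+ 2 by rewrite mulr_gt0 // exprn_gt0.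
have h5 : f l / (n%:R * ((gamma - r) * S) ^+ 2) <= 1 / D / (n%:R * S ^+ 2).
  have -> : n%:R * ((gamma - r) * S) ^+ 2 = D * (n%:R * S ^+ 2) by rewrite /D; ring.
  rewrite invfM mulrA ler_pM2r ?invr_gt0 //.
  by rewrite ler_pM2r ?invr_gt0.
have -> : eta + kappa / (n%:R * S ^+ 2) = eta' + 1 / D / (n%:R * S ^+ 2).
  rewrite /eta' -{1}kE; field.
  by rewrite !gt_eqF.
by rewrite lerD2l.
Qed.

(** The tangent at 1/2 bounds [f] from below without a correction, so only the
slack is left. *)
Lemma early_slow : exists2 kappa, 0 < kappa &
  forall n t eta J E S, (0 < n)%N -> 0 <= eta -> 0 < E -> gamma ^+ J * E <= 1 / 2 ->
  0 < S <= E ->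
  slow f n t (1 / 2 - gamma ^+ J * E) eta ->
  slow f n (J + t) (1 / 2 - (E - S)) (eta + kappa / (n%:R * S ^+ 2)).
Proof.
have g1 := mt_gamma_gt1 hf.
pose r := (1 + gamma) / 2; have r1 : 1 < r by rewrite /r; lra.
have r0 : 0 < r by exact: lt_trans ltr01 r1.
have rg : 0 < gamma - r by rewrite /r; lra.
have rle : r <= gamma by rewrite -subr_ge0 ltW.
have r2 : 1 < r ^+ 2 by rewrite exprn_egt1.
pose D := (gamma - r) ^+ 2; have D0 : 0 < D by rewrite exprn_gt0.
pose kappa := r ^+ 2 / (D * (r ^+ 2 - 1)).
have k0 : 0 < kappa by rewrite divr_gt0 ?mulr_gt0 ?subr_gt0 //; lra.
have kE : kappa / r ^+ 2 + 1 / D = kappa.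
  by rewrite /kappa; field; rewrite !gt_eqF ?subr_gt0 //; lra.
exists kappa => // n t eta J E S n0 eta0.
have nR : (0 : R) < n%:R by rewrite ltr0n.
elim: J E S => [|J IH] E S Epos hE hS hF.
  apply: slow_mono hF.
    by rewrite expr0 mul1r; lra.
  by rewrite lerDl error_ge0 // ltW.
have gE : 0 < gamma * E by rewrite mulr_gt0; lra.
rewrite exprSr -mulrA in hE hF.
have /andP[S00 SE] := hS.
have rS : 0 < r * S <= gamma * E.
  by rewrite (mulr_gt0 r0 S00) (ler_pM (ltW r0) (ltW S00) rle SE).
have := IH (gamma * E) (r * S) gE hE rS hF.
set eta' := eta + _ => hF'.
have eta'0 : 0 <= eta' by rewrite /eta' addr_ge0 // error_ge0 // ltW.
have hE1 : gamma * E <= 1 / 2.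
  by apply: le_trans hE; rewrite ler_peMl ?(ltW gE) // exprn_ege1 // ltW.
have EgE : E <= gamma * E by rewrite ler_peMl ?ltW.
set l := 1 / 2 - (E - S); have hl : 0 <= l <= 1 / 2 by rewrite /l; lra.
set l' := 1 / 2 - (gamma * E - r * S) in hF'.
have fl : f l <= 1 / 2 by have := update_in_half hf hl; lra.
have fl2 : (gamma - r) * S <= f l - l'.
  have := update_ge_tangent hf (e := E - S) ltac:(lra); rewrite -/l /l'; lra.
have S0 : 0 < (gamma - r) * S by exact: mulr_gt0.
rewrite addSn; have := @slow_chebyshev _ _ _ _ _ hf n (J + t) l l' _ n0 eta'0 hl _ hF'.
have l'0 : 0 <= l' by rewrite /l'; lra.
move=> /(_ ltac:(lra)); apply: slow_mono => //.
have h5 : 2 * f l / (n%:R * (f l - l') ^+ 2) <= 1 / D / (n%:R * S ^+ 2).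
  apply: (@le_trans _ _ (1 / (n%:R * ((gamma - r) * S) ^+ 2))).
    rewrite ler_pM; [by []| | |lra|].
    - by have := update_in_half hf hl; lra.
    - by rewrite invr_ge0 mulr_ge0 ?sqr_ge0 // ltW.
    - have S1 := lt_le_trans S0 fl2.
      rewrite lef_pV2 ?posrE; [|by rewrite mulr_gt0 // exprn_gt0..].
      by rewrite ler_pM2l // ler_sqr // nnegrE ltW.
  have -> : n%:R * ((gamma - r) * S) ^+ 2 = D * (n%:R * S ^+ 2) by rewrite /D; ring.
  by rewrite invfM mulrA.
have -> : eta + kappa / (n%:R * S ^+ 2) = eta' + 1 / D / (n%:R * S ^+ 2).
  rewrite /eta' -{1}kE; field.
  by rewrite !gt_eqF.
by rewrite lerD2l.
Qed.

End Stages.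

(** * Reaching consensus in time from a given deviation *)

Section Sequences.
Context {R : realType} (f : R -> R) (m : nat) (beta gamma : R).
Context (hf : majority_type f m beta gamma).
Context (ns N M : nat -> nat) (xs ys : nat -> R) (x y : R).
Context (hns : ns i @[i --> \oo] --> \oo).
Context (hN : \forall i \near \oo, Num.sqrt (ns i)%:R = gamma ^+ N i * gamma `^ xs i).
Context (hM : \forall i \near \oo, ln (ns i)%:R = m%:R ^+ M i * m%:R `^ ys i).
Context (hxs : xs i @[i --> \oo] --> x) (hys : ys i @[i --> \oo] --> y).
Context (hNy : N i @[i --> \oo] --> \oo) (hMy : M i @[i --> \oo] --> \oo).

Lemma nat_near (u : nat -> nat) k : u i @[i --> \oo] --> \oo ->
  \forall i \near \oo, (k <= u i)%N.
Proof. by move=> hu; have := hu _ (nbhs_infty_ge k); rewrite nbhs_simpl. Qed.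

Lemma powR_continuous (a : R) : 0 < a -> continuous (fun z => a `^ z).
Proof.
move=> a0 z; have -> : (fun z => a `^ z) = (fun z => expR (z * ln a)).
  by apply/funext => w; rewrite /powR gt_eqF.
apply: (@cvg_comp _ _ _ (fun z => z * ln a) expR); last exact: continuous_expR.
by apply: cvgM; [exact: cvg_id|exact: cvg_cst].
Qed.

Lemma ln_ns_large (C : R) : \forall i \near \oo, C <= ln (ns i)%:R.
Proof.
have h := nat_near (Num.truncn (expR C)).+1 hns.
apply: filterS h => i hi.
have h2 : expR C <= (ns i)%:R.
  apply: ltW; apply: (@lt_le_trans _ _ (Num.truncn (expR C)).+1%:R).
    exact: truncnS_gt.
  by rewrite ler_nat.
by rewrite -[C]expRK ler_ln ?posrE ?expR_gt0 //; apply: lt_le_trans h2; exact: expR_gt0.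
Qed.

Lemma ns_exp_ln i : (0 < ns i)%N -> (ns i)%:R = expR (ln (ns i)%:R) :> R.
Proof. by move=> n0; rewrite lnK // posrE ltr0n. Qed.

Section Shift.
Context (k : R) (T : nat -> nat).
Context (hT : \forall i \near \oo, (T i)%:R = (M i)%:R + k).

Lemma ln_ns_shift : \forall i \near \oo,
  ln (ns i)%:R = m%:R ^+ T i * m%:R `^ (ys i - k).
Proof.
have m1 := m_gt1 hf.
near=> i; have -> : ln (ns i)%:R = m%:R ^+ M i * m%:R `^ ys i by near: i.
have e : (T i)%:R = (M i)%:R + k by near: i.
rewrite -!powR_mulrn ?ler0n // -!powRD; first by congr powR; rewrite e; ring.
- by rewrite (gt_eqF (lt_trans ltr01 m1)) implybT.
- by rewrite (gt_eqF (lt_trans ltr01 m1)) implybT.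
Unshelve. all: by end_near. Qed.

Lemma shift_near j : \forall i \near \oo, (j <= T i)%N.
Proof.
have h := nat_near (j + `|Num.ceil (- k)|)%N hMy.
near=> i; have e : (T i)%:R = (M i)%:R + k by near: i.
rewrite -(ler_nat R) e.
have : (j + `|Num.ceil (- k)| <= M i)%N by near: i.
rewrite -(ler_nat R) natrD natr_absz.
have : - k <= `|Num.ceil (- k)|%:~R by apply: (le_trans (ceil_ge _)); rewrite ler_int; exact: ler_norm.
lra.
Unshelve. all: by end_near. Qed.

Lemma rate_cvg : m%:R `^ (ys i - k) @[i --> \oo] --> m%:R `^ (y - k).
Proof.
have m1 := m_gt1 hf.
apply: (@cvg_comp _ _ _ (fun i => ys i - k) (fun z => m%:R `^ z)).
  by apply: cvgB; [exact: hys|exact: cvg_cst].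
by apply: powR_continuous; lra.
Qed.

Let cvg_lt (u : nat -> R) l c : u i @[i --> \oo] --> l -> l < c ->
  \forall i \near \oo, u i <= c.
Proof.
move=> hu lc; have /cvgrPdist_le := hu => /(_ (c - l)); rewrite subr_gt0 => /(_ lc).
by apply: filterS => i; rewrite ler_norml; lra.
Qed.

Let cvg_gt (u : nat -> R) l c : u i @[i --> \oo] --> l -> c < l ->
  \forall i \near \oo, c <= u i.
Proof.
move=> hu lc; have /cvgrPdist_le := hu => /(_ (l - c)); rewrite subr_gt0 => /(_ lc).
by apply: filterS => i; rewrite ler_norml; lra.
Qed.

Let shifted_bottcher u c : 0 < u <= 1 / 2 ->
  (- ln (iter b f u) + c) / m%:R ^+ b @[b --> \oo] --> bottcher f m u.
Proof.
move=> hu; have m1 := m_gt1 hf.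
have -> : (fun b => (- ln (iter b f u) + c) / m%:R ^+ b) =
   (fun b => (- ln (iter b f u)) / m%:R ^+ b + c * (m%:R^-1) ^+ b).
  by apply/funext => b; rewrite mulrDl exprVn.
rewrite -[X in _ --> X]addr0 -[X in _ --> _ + X](mulr0 c).
apply: cvgD; first exact: bottcher_cvg hf _ hu.
apply: cvgM; first exact: cvg_cst.
by apply: cvg_expr; rewrite ger0_norm ?invr_ge0 ?ler0n // invf_cp1 //; lra.
Qed.

(** If [lambda] reaches the scale 1/n within [T] deterministic rounds with
room to spare in the exponent, so does the process. *)
Lemma fast_from_const lambda eta : 0 < lambda < 1 / 2 -> 0 < eta ->
  m%:R `^ (y - k) < bottcher f m lambda ->
  \forall i \near \oo, fast f (ns i) (T i) lambda eta.
Proof.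
move=> hl eta0 hB; have m1 := m_gt1 hf; have b0 := mt_beta_gt0 hf.
set q := m%:R `^ (y - k) in hB; set B := bottcher f m lambda in hB.
have q0 : 0 < q by rewrite powR_gt0; lra.
(* [q < q2 < q1 < B]: the step to [q2] absorbs the convergence of the
   exponents, the step to [B] the constant [c], and [q1 / q2] leaves a
   positive power of [ns i] to spare. *)
pose q1 := (q + B) / 2; pose q2 := (q + q1) / 2.
have q12 : q2 < q1 by rewrite /q2 /q1; lra.
have qq2 : q < q2 by rewrite /q2 /q1; lra.
have q1B : q1 < B by rewrite /q1; lra.
have [A A0 [x0 /andP[x00 x01] late]] := late_fast hf.
pose c := `|ln (4 * A / eta)|.
have c0 : 0 <= c by exact: normr_ge0.
have hc : A * expR (- c) <= eta / 4.
  have a0 : 0 < 4 * A / eta by rewrite divr_gt0 // mulr_gt0.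
  have : expR (- c) <= expR (- ln (4 * A / eta)) by rewrite ler_expR lerN2 ler_norm.
  rewrite expRN lnK ?posrE // invf_div => h.
  have : A * expR (- c) <= A * (eta / (4 * A)) by rewrite ler_wpM2l // ltW.
  by have -> : A * (eta / (4 * A)) = eta / 4 by field; rewrite gt_eqF.
have xe : 0 < x0 * expR (- 1) by rewrite mulr_gt0 ?expR_gt0.
have [b [hb1 hb2]] : exists b, q1 <= (- ln (iter b f lambda) + (- c - 1)) / m%:R ^+ b /\
    iter b f lambda <= x0 * expR (- 1).
  have h1 := cvg_gt (shifted_bottcher (- c - 1) (u := lambda) ltac:(lra)) q1B.
  have h2 := iter_update_small hf xe hl.
  by have [b _ hb] := filterI h1 h2; exists b; have := hb b (leqnn _).
have /andP[ib0 ib1] := iter_update_in hf b (u := lambda) ltac:(lra).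
have mb : 0 < m%:R ^+ b :> R by rewrite exprn_gt0 //; lra.
pose B' := - ln (iter b f lambda) - c - 1.
have B'q : q1 * m%:R ^+ b <= B' by move: hb1; rewrite ler_pdivlMr // /B'; lra.
have q10 : 0 < q1 by lra.
have B'0 : 0 < B' by apply: lt_le_trans B'q; rewrite mulr_gt0.
have lE : expR (- (B' + c)) = iter b f lambda * expR 1.
  have -> : - (B' + c) = ln (iter b f lambda) + 1 by rewrite /B'; ring.
  by rewrite expRD lnK.
have l0x0 : expR (- (B' + c)) <= x0.
  have : iter b f lambda * expR 1 <= x0 * expR (- 1) * expR 1.
    by rewrite ler_pM2r ?expR_gt0.
  by rewrite lE -mulrA -expRD addNr expR0 mulr1.
pose e := q1 / q2 - 1.
have q20 : 0 < q2 by lra.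
have e0 : 0 < e by rewrite /e subr_gt0 ltr_pdivlMr // mul1r.
have main : \forall i \near \oo, fast f (ns i) (T i - b.+1).+1 (expR (- (B' + c))) (eta / 2).
  have hq := cvg_lt rate_cvg qq2.
  have hln := ln_ns_large (16 * beta / (e * eta)).
  have hn0 := nat_near 1 hns.
  near=> i.
  have n0 : (0 < ns i)%N by near: i.
  apply: fast_mono (late (ns i) (T i - b.+1)%N B' c n0 B'0 c0 l0x0) => //.
  suff : 4 * (ns i)%:R * beta * expR (- (m%:R ^+ (T i - b.+1).+1 * B')) <= eta / 4 by lra.
  have bT : (b.+1 <= T i)%N by near: i; exact: shift_near.
  have -> : (T i - b.+1).+1 = (T i - b)%N by rewrite subnSK.
  have h1 : m%:R ^+ T i * q1 <= m%:R ^+ (T i - b) * B'.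
    rewrite -{1}(subnK (ltnW bT)) exprD -mulrA ler_wpM2l //.
    by rewrite mulrC.
  have lnE : ln (ns i)%:R = m%:R ^+ T i * m%:R `^ (ys i - k) by near: i; exact: ln_ns_shift.
  have h2 : m%:R `^ (ys i - k) <= q2 by near: i.
  have mT : 0 < m%:R ^+ T i :> R by rewrite exprn_gt0 // (lt_trans ltr01).
  have h3 : q1 / q2 * ln (ns i)%:R <= m%:R ^+ T i * q1.
    rewrite lnE mulrCA ler_pM2l // mulrAC ler_pdivrMr // ler_pM2l //.
  have h4 : 16 * beta / (e * eta) <= ln (ns i)%:R by near: i.
  have L0 : 0 < ln (ns i)%:R :> R.
    by apply: lt_le_trans h4; rewrite divr_gt0 ?mulr_gt0.
  have h5 : (ns i)%:R * expR (- (m%:R ^+ (T i - b) * B')) <= (e * ln (ns i)%:R)^-1.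
    rewrite {1}ns_exp_ln // -expRD.
    apply: (@le_trans _ _ (expR (- (e * ln (ns i)%:R)))).
      by rewrite ler_expR /e; move: h1 h3; lra_goal.
    rewrite expRN lef_pV2 ?posrE ?expR_gt0 ?mulr_gt0 //.
    by have := expR_ge1Dx (e * ln (ns i)%:R); lra_goal.
  have h6 : (e * ln (ns i)%:R)^-1 <= eta / (16 * beta).
    have eL : 0 < e * ln (ns i)%:R :> R by rewrite mulr_gt0.
    have be : 0 < 16 * beta / eta by rewrite divr_gt0 // mulr_gt0.
    rewrite -[leRHS]invf_div lef_pV2 ?posrE //.
    move: h4; rewrite ler_pdivrMr ?mulr_gt0 // => h4.
    by rewrite ler_pdivrMr //; move: h4; lra_goal.
  have h7 := ler_wpM2l (ltW b0) (le_trans h5 h6).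
  have h8 : beta * (eta / (16 * beta)) = eta / 16 by field; rewrite gt_eqF.
  move: h7; rewrite h8; lra_goal.
have mid := @middle_fast _ _ _ _ _ hf ns (fun i => (T i - b.+1).+1) b lambda
  (expR (- (B' + c))) (eta / 2) eta hns ltac:(lra) _ ltac:(lra) main.
have hlt : iter b f lambda < expR (- (B' + c)).
  by rewrite lE ltr_pMr // expR_gt1.
have := mid hlt; apply: filter_app; near=> i.
have bT : (b.+1 <= T i)%N by near: i; exact: shift_near.
by rewrite addnS -addSn subnKC.
Unshelve. all: by end_near. Qed.

Lemma slow_from_const lambda eta : 0 < lambda < 1 / 2 -> 0 < eta ->
  bottcher f m lambda < m%:R `^ (y - k) ->
  \forall i \near \oo, slow f (ns i) (T i) lambda eta.
Proof.
move=> hl eta0 hB; have m1 := m_gt1 hf; have b0 := mt_beta_gt0 hf.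
set q := m%:R `^ (y - k) in hB; set B := bottcher f m lambda in hB.
have B0 : 0 < B by exact: (bottcher_gt0 hf).
pose q1 := (q + B) / 2; pose q2 := (q + q1) / 2.
have q12 : q1 < q2 by rewrite /q2 /q1; lra.
have qq2 : q2 < q by rewrite /q2 /q1; lra.
have q1B : B < q1 by rewrite /q1; lra.
have [c c0 [x0 /andP[x00 x01] late]] := late_slow hf.
have [b [hb1 hb2]] : exists b, (- ln (iter b f lambda) + (c + 1)) / m%:R ^+ b <= q1 /\
    iter b f lambda <= x0.
  have h1 := cvg_lt (shifted_bottcher (c + 1) (u := lambda) ltac:(lra)) q1B.
  have h2 := iter_update_small hf x00 hl.
  by have [b _ hb] := filterI h1 h2; exists b; have := hb b (leqnn _).
have /andP[ib0 ib1] := iter_update_in hf b (u := lambda) ltac:(lra).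
have mb : 0 < m%:R ^+ b :> R by rewrite exprn_gt0 //; lra.
pose B' := - ln (iter b f lambda) + (c + 1).
have B'q : B' <= q1 * m%:R ^+ b by move: hb1; rewrite ler_pdivrMr.
have q10 : 0 < q1 by lra.
have B'0 : 0 < B'.
  have : ln (iter b f lambda) <= 0 by rewrite ln_le0 //; lra.
  by rewrite /B'; lra.
have lE : expR (- (B' - c)) = iter b f lambda * expR (- 1).
  have -> : - (B' - c) = ln (iter b f lambda) + - 1 by rewrite /B'; ring.
  by rewrite expRD lnK.
have ex1 : expR (- 1) < 1 :> R by rewrite expR_lt1; lra.
have l0x0 : expR (- (B' - c)) <= x0.
  by apply: le_trans hb2; rewrite lE ler_piMr // ltW.
have q20 : 0 < q2 by lra.
pose e := 1 - q1 / q2.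
have e0 : 0 < e by rewrite /e subr_gt0 ltr_pdivrMr // mul1r.
have main : \forall i \near \oo, slow f (ns i) (T i - b) (expR (- (B' - c))) (eta / 2).
  have hq := cvg_gt rate_cvg qq2.
  have hln := ln_ns_large (16 / (e ^+ 2 * q2 * eta)).
  have hn0 := nat_near 1 hns.
  near=> i.
  have n0 : (0 < ns i)%N by near: i.
  have nR : (0 : R) < (ns i)%:R by rewrite ltr0n.
  apply: slow_mono (late (ns i) (T i - b)%N B' n0 B'0 l0x0) => //.
  have bT : (b <= T i)%N by near: i; exact: shift_near.
  have h1 : m%:R ^+ (T i - b) * B' <= m%:R ^+ T i * q1.
    rewrite -{2}(subnK bT) exprD -mulrA ler_wpM2l //.
    by rewrite [leRHS]mulrC.
  have lnE : ln (ns i)%:R = m%:R ^+ T i * m%:R `^ (ys i - k) by near: i; exact: ln_ns_shift.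
  have h2 : q2 <= m%:R `^ (ys i - k) by near: i.
  have mT : 0 < m%:R ^+ T i :> R by rewrite exprn_gt0 // (lt_trans ltr01).
  have h3 : m%:R ^+ T i * q1 <= q1 / q2 * ln (ns i)%:R.
    by rewrite lnE [leRHS]mulrCA ler_pM2l // mulrAC ler_pdivlMr // ler_pM2l.
  have h4 : 16 / (e ^+ 2 * q2 * eta) <= ln (ns i)%:R by near: i.
  have e20 : 0 < e ^+ 2 by rewrite exprn_gt0.
  have eq2 : 0 < e ^+ 2 * q2 by rewrite mulr_gt0.
  have d0 : 0 < e ^+ 2 * q2 * eta by rewrite mulr_gt0.
  have L0 : 0 < ln (ns i)%:R :> R.
    by apply: lt_le_trans h4; rewrite divr_gt0.
  set L := ln (ns i)%:R in lnE h3 h4 L0.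
  have h5 : (T i - b)%:R <= L / q2.
    rewrite ler_pdivlMr // lnE.
    have k1 : (T i - b)%:R <= m%:R ^+ T i :> R.
      apply: (@le_trans _ _ (T i)%:R); first by rewrite ler_nat leq_subr.
      by rewrite -natrX ler_nat; apply: ltnW; apply: ltn_expl; exact: mt_m_ge2 hf.
    by rewrite ler_pM // ?ler0n // ltW.
  have h6 : expR (m%:R ^+ (T i - b) * B' - c) / (ns i)%:R <= 2 / (e * L) ^+ 2.
    rewrite {1}ns_exp_ln // -expRN -expRD -/L.
    apply: (@le_trans _ _ (expR (- (e * L)))).
      by rewrite ler_expR /e; move: h1 h3 c0; lra_goal.
    rewrite expRN -[leRHS]invf_div lef_pV2 ?posrE ?expR_gt0 ?divr_gt0 ?exprn_gt0 ?mulr_gt0 //.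
    have := expR_ge1Dxn 1 (ltW (mulr_gt0 e0 L0)).
    by rewrite (_ : 2`! = 2)%N //; lra_goal.
  have h7 : (T i - b)%:R * (expR (m%:R ^+ (T i - b) * B' - c) / (ns i)%:R) <= L / q2 * (2 / (e * L) ^+ 2).
    by rewrite ler_pM // divr_ge0 ?expR_ge0 // ltW.
  have h8 : L / q2 * (2 / (e * L) ^+ 2) = 2 / (e ^+ 2 * q2) / L.
    by field; rewrite !gt_eqF.
  have h9 : 2 / (e ^+ 2 * q2) / L <= eta / 8.
    rewrite ler_pdivrMr // ler_pdivrMr //.
    by move: h4; rewrite ler_pdivrMr //; lra_goal.
  by move: h7 h9; rewrite h8; lra_goal.
have hlt : expR (- (B' - c)) < iter b f lambda.
  by rewrite lE -[ltRHS]mulr1 ltr_pM2l.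
have mid := @middle_slow _ _ _ _ _ hf ns (fun i => (T i - b)%N) b lambda
  (expR (- (B' - c))) (eta / 2) eta hns hl hlt ltac:(lra) main.
have := mid; apply: filter_app; near=> i.
have bT : (b <= T i)%N by near: i; exact: shift_near.
by rewrite subnKC.
Unshelve. all: by end_near. Qed.

End Shift.

Lemma dev_pow k b z : gamma ^+ k * dev gamma (k + b) z = dev gamma b z.
Proof.
elim: k => [|k IH]; first by rewrite expr0 mul1r.
by rewrite exprSr -mulrA addSn (devS hf).
Qed.

Lemma minority_deviation n (v : R) : (0 < n)%N -> 0 <= v <= n%:R ->
  minority n v = 1 / 2 - `|deviation n v| / Num.sqrt n%:R.
Proof.
move=> n0 hv; have r0 : (0 : R) < Num.sqrt n%:R by rewrite sqrtr_gt0 ltr0n.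
have -> : `|deviation n v| / Num.sqrt n%:R = `|v / n%:R - 1 / 2|.
  by rewrite deviation_ratio // [RHS]normrM normfV (gtr0_norm r0).
rewrite /minority; case: (leP (v / n%:R) (1 - v / n%:R)) => h.
  by rewrite ler0_norm; lra.
by rewrite ger0_norm; lra.
Qed.

(** The deviation [dev gamma (N i) z] is of order [1 / sqrt n]. *)
Lemma start_scale a z : \forall i \near \oo,
  Num.sqrt (ns i)%:R * (dev gamma (N i) z * gamma ^+ a) = gamma ^+ a * gamma `^ (xs i - z).
Proof.
have g0 := gamma_gt0 hf.
near=> i; have -> : Num.sqrt (ns i)%:R = gamma ^+ N i * gamma `^ xs i by near: i.
rewrite (dev_expn hf) powRD; last by rewrite (gt_eqF g0) implybT.
by rewrite exprVn; field; rewrite expf_neq0 // gt_eqF.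
Unshelve. all: by end_near. Qed.

Lemma start_cvg z : gamma `^ (xs i - z) @[i --> \oo] --> gamma `^ (x - z).
Proof.
apply: (@cvg_comp _ _ _ (fun i => xs i - z) (fun z => gamma `^ z)).
  by apply: cvgB; [exact: hxs|exact: cvg_cst].
by apply: powR_continuous; exact: gamma_gt0 hf.
Qed.

(** With a slack proportional to a deviation of order [gamma ^+ a / sqrt n], the
error in [early_fast] and [early_slow] is of order [gamma ^- (2 * a)],
uniformly in [n]. *)
Lemma start_error kappa tau z eta : 0 < kappa -> 0 < tau -> 0 < eta ->
  exists a0, forall a, (a0 <= a)%N -> \forall i \near \oo,
    kappa / ((ns i)%:R * (tau * (dev gamma (N i) z * gamma ^+ a)) ^+ 2) <= eta.
Proof.
move=> k0 t0 e0; have g0 := gamma_gt0 hf.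
pose w := gamma `^ (x - z) / 2; have w0 : 0 < w by rewrite divr_gt0 // powR_gt0.
pose e := Num.min 1 (eta * (tau ^+ 2 * w ^+ 2) / kappa).
have tw : 0 < tau ^+ 2 * w ^+ 2 by rewrite mulr_gt0 // exprn_gt0.
have e1 : 0 < e by rewrite /e lt_min ltr01 divr_gt0 // mulr_gt0.
have [a0 _ ha] := dev_small hf 0 e1.
exists a0 => a /ha hd.
have hs := start_scale a z.
have hw : \forall i \near \oo, w <= gamma `^ (xs i - z).
  have w2 : 0 < gamma `^ (x - z) - w by rewrite /w in w0 *; lra.
  have /cvgrPdist_le/(_ _ w2) := @start_cvg z.
  by apply: filterS => i; rewrite ler_norml; lra.
have hn0 := nat_near 1 hns.
near=> i.
have n0 : (0 < ns i)%N by near: i.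
have nR : (0 : R) < (ns i)%:R by rewrite ltr0n.
have hE : Num.sqrt (ns i)%:R * (dev gamma (N i) z * gamma ^+ a) = gamma ^+ a * gamma `^ (xs i - z) by near: i.
have hwi : w <= gamma `^ (xs i - z) by near: i.
set E := dev _ _ _ * _ in hE *.
have -> : (ns i)%:R * (tau * E) ^+ 2 = tau ^+ 2 * (Num.sqrt (ns i)%:R * E) ^+ 2.
  by rewrite -{1}[(ns i)%:R]sqr_sqrtr ?ler0n //; ring.
rewrite hE.
have ga : 0 < gamma ^+ a by rewrite exprn_gt0.
have d1 : dev gamma a 0 = (gamma ^+ a)^-1.
  by rewrite (dev_expn hf) oppr0 powRr0 mul1r exprVn.
have h1 : tau ^+ 2 * (gamma ^+ a * w) ^+ 2 <= tau ^+ 2 * (gamma ^+ a * gamma `^ (xs i - z)) ^+ 2.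
  rewrite ler_pM2l ?exprn_gt0 // ler_sqr ?nnegrE ?mulr_ge0 ?powR_ge0 ?(ltW ga) ?(ltW w0) //.
  by rewrite ler_pM2l.
have p1 : 0 < tau ^+ 2 * (gamma ^+ a * w) ^+ 2 by rewrite mulr_gt0 // exprn_gt0 // mulr_gt0.
apply: (@le_trans _ _ (kappa / (tau ^+ 2 * (gamma ^+ a * w) ^+ 2))).
  rewrite ler_pM2l // lef_pV2 ?posrE //; exact: lt_le_trans h1.
have -> : kappa / (tau ^+ 2 * (gamma ^+ a * w) ^+ 2) = kappa / (tau ^+ 2 * w ^+ 2) * (dev gamma a 0 * dev gamma a 0).
  by rewrite d1; field; rewrite !gt_eqF.
have h2 : dev gamma a 0 * dev gamma a 0 <= e.
  have := dev_gt0 hf a 0; have : e <= 1 by rewrite /e ge_min lexx.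
  move=> e11 dp; apply: (le_trans _ hd); rewrite ler_piMr ?(ltW dp) //.
  exact: le_trans hd e11.
have h3 : e <= eta * (tau ^+ 2 * w ^+ 2) / kappa by rewrite /e ge_min lexx orbT.
rewrite mulrAC ler_pdivrMr // -ler_pdivlMl // mulrC.
by rewrite [leRHS]mulrC; exact: le_trans h2 h3.
Unshelve. all: by end_near. Qed.

Context (k : R) (T : nat -> nat).
Context (hT : \forall i \near \oo, (T i)%:R = (N i)%:R + (M i)%:R + k).

(** The rounds left once the deviation has grown to the size [dev gamma b z]. *)
Let T' b i := (T i + b - N i)%N.

Let T'_shift b : \forall i \near \oo, (T' b i)%:R = (M i)%:R + (k + b%:R) /\ (N i <= T i)%N.
Proof.
have h := nat_near (`|Num.ceil (- k)|)%N hMy.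
near=> i; have e : (T i)%:R = (N i)%:R + (M i)%:R + k by near: i.
have NT : (N i <= T i)%N.
  rewrite -(ler_nat R) e.
  have : (`|Num.ceil (- k)| <= M i)%N by near: i.
  rewrite -(ler_nat R) natr_absz.
  have : - k <= `|Num.ceil (- k)|%:~R by apply: (le_trans (ceil_ge _)); rewrite ler_int; exact: ler_norm.
  lra.
split => //; rewrite /T' natrB ?natrD ?e; last by rewrite (leq_trans NT) // leq_addr.
by ring.
Unshelve. all: by end_near. Qed.

Let T'_split a b : \forall i \near \oo, ((N i - (a + b)) + T' b i)%N = (T i - a)%N
  /\ ((N i - (a + b)) + (a + b))%N = N i.
Proof.
have h := T'_shift b; have h2 := nat_near (a + b)%N hNy.
near=> i; have [_ NT] : (T' b i)%:R = (M i)%:R + (k + b%:R) /\ (N i <= T i)%N by near: i.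
have ab : (a + b <= N i)%N by near: i.
rewrite subnK //; split => //.
by rewrite /T'; lia.
Unshelve. all: by end_near. Qed.

Let abel_rate b u (c : R) : 0 < u < 1 / 2 ->
  (c < b%:R + abel f m u) = (m%:R `^ (c - b%:R) < bottcher f m u).
Proof.
move=> hu; have m1 := m_gt1 hf; have l0 : 0 < ln (m%:R : R) by rewrite ln_gt0.
have B0 : 0 < bottcher f m u by exact: (bottcher_gt0 hf).
rewrite /abel /logb addrC -ltrBlDr ltr_pdivlMr //.
rewrite -[bottcher f m u in RHS]lnK ?posrE // /powR gt_eqF ?ltr_expR //; lra.
Qed.

Let abel_rate2 b u (c : R) : 0 < u < 1 / 2 ->
  (b%:R + abel f m u < c) = (bottcher f m u < m%:R `^ (c - b%:R)).
Proof.
move=> hu; have m1 := m_gt1 hf; have l0 : 0 < ln (m%:R : R) by rewrite ln_gt0.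
have B0 : 0 < bottcher f m u by exact: (bottcher_gt0 hf).
rewrite /abel /logb addrC -ltrBrDr ltr_pdivrMr //.
rewrite -[bottcher f m u in RHS]lnK ?posrE // /powR gt_eqF ?ltr_expR //; lra.
Qed.

(** It takes [N i - (a + b)] rounds to raise a deviation of order
[gamma ^+ a / sqrt n] to the fixed size [dev gamma b z], and [abel_orbit z2 b]
decides whether the [M i + k + b] remaining rounds suffice. The room between
[z] and [z2] pays for the correction in [early_fast]. *)
Lemma fast_total z z2 rho eta : z < z2 -> h_fun f m gamma z2 + y < k + 1 ->
  gamma `^ (x - z) < rho -> 0 < eta ->
  exists a0, forall a, (a0 <= a)%N -> \forall i \near \oo,
    forall j, (j <= ns i)%N -> gamma ^+ a * rho <= `|deviation (ns i) (j%:R : R)| ->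
    1 - eta <= iter (T i - a) (step f (ns i)) (consensus (ns i)) j%:R.
Proof.
move=> zz hz hrho eta0; have g1 := mt_gamma_gt1 hf; have g0 := gamma_gt0 hf.
have [K K0 [E0 E00 [kappa k0 early]]] := early_fast hf.
pose q := gamma `^ (- (z2 - z)).
have q1 : q < 1.
  rewrite /q /powR (gt_eqF g0) expR_lt1 mulNr oppr_lt0.
  by rewrite mulr_gt0 ?ln_gt0 // subr_gt0.
have q0 : 0 < q by rewrite powR_gt0.
have e0 : 0 < Num.min (Num.min E0 (1 / 4)) ((1 - q) / (2 * K)).
  have qK : 0 < (1 - q) / (2 * K) by rewrite divr_gt0 ?subr_gt0 ?mulr_gt0.
  have q4 : 0 < (1 / 4 : R) by lra.
  by rewrite !lt_min E00 q4 qK.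
have ho := cvgr_gt _ (abel_orbit_cvg hf (z := z2)) (y - k) ltac:(lra).
have [b [hb1 hb2]] : exists b, dev gamma b z <= Num.min (Num.min E0 (1 / 4)) ((1 - q) / (2 * K))
   /\ y - k < abel_orbit f m gamma z2 b.
  have [b _ hb] := filterI (dev_small hf z e0) ho; exists b; exact: hb b (leqnn _).
move: hb1; rewrite !le_min => /andP[/andP[dE0 d4] dq].
set d := dev gamma b z in dE0 d4 dq.
have d0 : 0 < d := dev_gt0 hf b z.
have dE2 : dev gamma b z2 = d * q by rewrite /d -(dev_shiftr hf); congr dev; ring.
have Kd : K * d < 1 - q.
  by move: dq; rewrite ler_pdivlMr ?mulr_gt0 //; lra.
have Kd1 : d * q < d * (1 - K * d) by rewrite ltr_pM2l //; lra.
have dKd : d * (1 - K * d) <= d * 1.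
  by rewrite ler_pM2l //; have : 0 < K * d by [rewrite mulr_gt0]; lra.
have dq0 : 0 < d * q by rewrite mulr_gt0.
set lambda := 1 / 2 - d * (1 - K * d).
have hl : 0 < lambda < 1 / 2 by rewrite /lambda; lra.
have hB : m%:R `^ (y - (k + b%:R)) < bottcher f m lambda.
  apply: (@lt_trans _ _ (bottcher f m (1 / 2 - dev gamma b z2))).
    move: hb2; rewrite /abel_orbit dE2 (abel_rate b); last by lra.
    by rewrite (_ : y - k - b%:R = y - (k + b%:R)) //; ring.
  by apply: (bottcher_lt hf); rewrite dE2 /lambda; lra.
have eta2 : 0 < eta / 2 by lra.
have hT' : \forall i \near \oo, (T' b i)%:R = (M i)%:R + (k + b%:R).
  by apply: filterS (T'_shift b) => i [].
have hF := fast_from_const hT' hl eta2 hB.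
pose p := gamma `^ (x - z); have p0 : 0 < p by rewrite powR_gt0.
pose tau := Num.min 1 ((rho - p) / (4 * p)).
have tau0 : 0 < tau by rewrite /tau lt_min ltr01 divr_gt0 ?subr_gt0 ?mulr_gt0.
have tau1 : tau <= 1 by rewrite /tau ge_min lexx.
have tau2 : tau * (4 * p) <= rho - p.
  by rewrite -ler_pdivlMr ?mulr_gt0 // /tau ge_min lexx orbT.
have [a0 ha0] := start_error z k0 tau0 eta2.
exists a0 => a aa.
have hs := start_scale a z; have herr := ha0 a aa; have hsp := T'_split a b.
have hn0 := nat_near 1 hns.
have hpx : \forall i \near \oo, (1 + tau) * gamma `^ (xs i - z) <= rho.
  have p2 : 0 < (rho - p) / 4 by rewrite divr_gt0 ?subr_gt0.
  have /cvgrPdist_le/(_ _ p2) := @start_cvg z; rewrite -/p.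
  apply: filterS => i; rewrite ler_norml => /andP[h _].
  have h2 : gamma `^ (xs i - z) <= p + (rho - p) / 4 by move: h; lra_goal.
  have : (1 + tau) * gamma `^ (xs i - z) <= (1 + tau) * (p + (rho - p) / 4).
    by rewrite ler_wpM2l // addr_ge0 // ltW.
  have : tau * ((rho - p) / 4) <= 1 * ((rho - p) / 4) by rewrite ler_wpM2r // ltW.
  move: tau2 p2; lra_goal.
near=> i => j jn hj.
have n0 : (0 < ns i)%N by near: i.
have nR : (0 : R) < (ns i)%:R by rewrite ltr0n.
have hE : Num.sqrt (ns i)%:R * (dev gamma (N i) z * gamma ^+ a) = gamma ^+ a * gamma `^ (xs i - z) by near: i.
have [s1 s2] : ((N i - (a + b)) + T' b i)%N = (T i - a)%N /\ ((N i - (a + b)) + (a + b))%N = N i by near: i.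
have herr' : kappa / ((ns i)%:R * (tau * (dev gamma (N i) z * gamma ^+ a)) ^+ 2) <= eta / 2 by near: i.
have hF' : fast f (ns i) (T' b i) lambda (eta / 2) by near: i.
set E := dev gamma (N i) z * gamma ^+ a in hE herr'.
have ga : 0 < gamma ^+ a by rewrite exprn_gt0.
have Epos : 0 < E by rewrite mulr_gt0 // (dev_gt0 hf).
have hJE : gamma ^+ (N i - (a + b)) * E = d.
  rewrite /E.
  have -> : dev gamma (N i) z = dev gamma (N i - (a + b) + (a + b)) z by rewrite s2.
  by rewrite mulrA dev_pow mulrC dev_pow.
have hS : 0 < tau * E <= E by rewrite mulr_gt0 //= ler_piMl // ltW.
have := early (ns i) (T' b i) (eta / 2) (N i - (a + b))%N E (tau * E) n0 (ltW eta2) Epos _ hS.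
rewrite hJE => /(_ dE0 hF') hfast.
rewrite -s1; apply: le_trans (hfast j jn _); first by move: herr'; lra_goal.
rewrite minority_deviation // ?nat_state //.
have r0 : (0 : R) < Num.sqrt (ns i)%:R by rewrite sqrtr_gt0.
have KE : E * (1 - K * E) <= E * 1.
  by rewrite ler_pM2l // gerBl; exact: ltW (mulr_gt0 K0 Epos).
suff h : (1 + tau) * E <= `|deviation (ns i) (j%:R : R)| / Num.sqrt (ns i)%:R.
  by move: h KE; lra_goal.
rewrite ler_pdivlMr // -mulrA [E * _]mulrC hE; apply: le_trans hj.
rewrite mulrCA ler_pM2l //.
by near: i.
Unshelve. all: by end_near. Qed.

(** Here the deviation grows at most linearly, so that [z] itself will do. *)
Lemma slow_total z rho eta : k + 1 < h_fun f m gamma z + y ->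
  rho < gamma `^ (x - z) -> 0 < eta ->
  exists a0, forall a, (a0 <= a)%N -> \forall i \near \oo,
    forall j, (j <= ns i)%N -> `|deviation (ns i) (j%:R : R)| <= gamma ^+ a * rho ->
    iter (T i - a) (step f (ns i)) (consensus (ns i)) j%:R <= eta.
Proof.
move=> hz hrho eta0; have g1 := mt_gamma_gt1 hf; have g0 := gamma_gt0 hf.
have [kappa k0 early] := early_slow hf.
have e0 : 0 < (1 / 4 : R) by lra.
have ho := cvgr_lt _ (abel_orbit_cvg hf (z := z)) (y - k) ltac:(lra).
have [b [hb1 hb2]] : exists b, dev gamma b z <= 1 / 4
   /\ abel_orbit f m gamma z b < y - k.
  have [b _ hb] := filterI (dev_small hf z e0) ho; exists b; exact: hb b (leqnn _).
set d := dev gamma b z in hb1.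
have d0 : 0 < d := dev_gt0 hf b z.
set lambda := 1 / 2 - d.
have hl : 0 < lambda < 1 / 2 by rewrite /lambda; lra.
have hB : bottcher f m lambda < m%:R `^ (y - (k + b%:R)).
  move: hb2; rewrite /abel_orbit -/d -/lambda (abel_rate2 b) //.
  by rewrite (_ : y - k - b%:R = y - (k + b%:R)) //; ring.
have eta2 : 0 < eta / 2 by lra.
have hT' : \forall i \near \oo, (T' b i)%:R = (M i)%:R + (k + b%:R).
  by apply: filterS (T'_shift b) => i [].
have hF := slow_from_const hT' hl eta2 hB.
pose p := gamma `^ (x - z); have p0 : 0 < p by rewrite powR_gt0.
have [tau tau0 tau2] : exists2 tau, 0 < tau <= 1 & rho < (1 - tau) * p.
  exists (Num.min 1 ((p - rho) / (2 * p))).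
    by rewrite lt_min ltr01 ge_min lexx divr_gt0 ?subr_gt0 ?mulr_gt0.
  set tau := Num.min _ _; have : tau <= (p - rho) / (2 * p) by rewrite /tau ge_min lexx orbT.
  by rewrite ler_pdivlMr ?mulr_gt0 //; rewrite -/p in hrho; lra.
have /andP[tau00 tau1] := tau0.
have [a0 ha0] := start_error z k0 tau00 eta2.
exists a0 => a aa.
have hs := start_scale a z; have herr := ha0 a aa; have hsp := T'_split a b.
have hn0 := nat_near 1 hns.
have hpx : \forall i \near \oo, rho <= (1 - tau) * gamma `^ (xs i - z).
  have cv : (1 - tau) * gamma `^ (xs i - z) @[i --> \oo] --> (1 - tau) * p.
    by apply: cvgM; [exact: cvg_cst|exact: start_cvg].
  have h : \forall i \near \oo, rho < (1 - tau) * gamma `^ (xs i - z).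
    by apply: (cvgr_gt _ cv).
  by apply: filterS h => i /ltW.
near=> i => j jn hj.
have n0 : (0 < ns i)%N by near: i.
have nR : (0 : R) < (ns i)%:R by rewrite ltr0n.
have hE : Num.sqrt (ns i)%:R * (dev gamma (N i) z * gamma ^+ a) = gamma ^+ a * gamma `^ (xs i - z) by near: i.
have [s1 s2] : ((N i - (a + b)) + T' b i)%N = (T i - a)%N /\ ((N i - (a + b)) + (a + b))%N = N i by near: i.
have herr' : kappa / ((ns i)%:R * (tau * (dev gamma (N i) z * gamma ^+ a)) ^+ 2) <= eta / 2 by near: i.
have hF' : slow f (ns i) (T' b i) lambda (eta / 2) by near: i.
set E := dev gamma (N i) z * gamma ^+ a in hE herr'.
have ga : 0 < gamma ^+ a by rewrite exprn_gt0.
have Epos : 0 < E by rewrite mulr_gt0 // (dev_gt0 hf).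
have hJE : gamma ^+ (N i - (a + b)) * E = d.
  rewrite /E.
  have -> : dev gamma (N i) z = dev gamma (N i - (a + b) + (a + b)) z by rewrite s2.
  by rewrite mulrA dev_pow mulrC dev_pow.
have hS : 0 < tau * E <= E by rewrite mulr_gt0 //= ler_piMl // ltW.
have := early (ns i) (T' b i) (eta / 2) (N i - (a + b))%N E (tau * E) n0 (ltW eta2) Epos _ hS.
rewrite hJE => /(_ ltac:(lra) hF') hslow.
rewrite -s1; apply: (le_trans (hslow j jn _)); last by move: herr'; lra_goal.
rewrite minority_deviation // ?nat_state //.
have r0 : (0 : R) < Num.sqrt (ns i)%:R by rewrite sqrtr_gt0.
suff h : `|deviation (ns i) (j%:R : R)| / Num.sqrt (ns i)%:R <= (1 - tau) * E.
  by move: h; lra_goal.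
rewrite ler_pdivrMr // -mulrA [E * _]mulrC hE; apply: (le_trans hj).
rewrite [leRHS]mulrCA ler_pM2l //.
by near: i.
Unshelve. all: by end_near. Qed.

End Sequences.

(** * The law of the runtime *)

Section ProcessLaw.
Context {R : realType} (f : R -> R) (m : nat) (beta gamma : R).
Context (hf : majority_type f m beta gamma).
Context (n : nat) (x0 : R) (d : measure_display) (T : measurableType d)
  (P : probability T R) (X : nat -> {RV P >-> R}).
Context (hX : majority_process f n x0 X).

Let pr (A : set T) : R := fine (P A).

Let prE A : measurable A -> P A = (pr A)%:E.
Proof. by move=> mA; rewrite fineK // fin_num_measure. Qed.

Let pr_split A B : measurable A -> measurable B ->
  pr A = pr (A `&` B) + pr (A `&` ~` B).
Proof.
move=> mA mB; have mAB := measurableI _ _ mA mB.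
have mAC := measurableI _ _ mA (measurableC mB).
apply: EFin_inj; rewrite EFinD -!prE // addeC -setDE.
exact: measureDI.
Qed.

Let pr_ge0 A : 0 <= pr A.
Proof. exact: fine_ge0. Qed.

Let pr_le A B : measurable A -> measurable B -> A `<=` B -> pr A <= pr B.
Proof.
by move=> mA mB AB; rewrite -lee_fin -!prE // le_measure // inE.
Qed.

Let hit (t : nat) : set T := [set w | X t w = n%:R \/ n%:R - X t w = n%:R].

Lemma value_measurable t (v : R) : measurable [set w | X t w = v].
Proof.
rewrite -[X in measurable X]setTI.
exact: (measurable_funP (X t) measurableT [set v] (measurable_set1 v)).
Qed.

Lemma hit_measurable t : measurable (hit t).
Proof.
have -> : hit t = [set w | X t w = n%:R] `|` [set w | X t w = 0].
  apply/seteqP; split => w /=; case=> h; [by left|right; lra|by left|right; lra].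
by apply: measurableU; exact: value_measurable.
Qed.

Let history t (s : nat -> R) : set T := [set w | forall i, (i <= t)%N -> X i w = s i].

Let history_measurable t s : measurable (history t s).
Proof.
have -> : history t s = \bigcap_(i in [set i | (i <= t)%N]) [set w | X i w = s i].
  by apply/seteqP; split => w /= h i; exact: h.
by apply: bigcap_measurable => [|i _]; [exists 0%N|exact: value_measurable].
Qed.

Let extend t (s : nat -> R) (v : R) i := if (i <= t)%N then s i else v.

Let history_extend t s v :
  history t.+1 (extend t s v) = history t s `&` [set w | X t.+1 w = v].
Proof.
apply/seteqP; split => w /=.
  move=> h; split; first by move=> i it; have := h i (leqW it); rewrite /extend it.
  by have := h t.+1 (leqnn _); rewrite /extend ltnn.
move=> [h1 h2] i; rewrite leq_eqVlt /extend => /orP[/eqP ->|].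
  by rewrite ltnn.
by rewrite ltnS => it; rewrite it; exact: h1.
Qed.

Let pr_step t s k : 0 <= s t <= n%:R ->
  pr (history t s `&` [set w | X t.+1 w = k%:R]) =
  pr (history t s) * binomial_pmf n (f (s t / n%:R)) k.
Proof.
move=> hs; have [_ _ h] := hX; have := h t s k.
have hp := step_prob hf hs.
rewrite /binomial_prob hp esum_set1 ?lee_fin ?binomial_pmf_ge0 //.
rewrite -/(history t s) (prE (history_measurable t s)) -EFinM => e.
by rewrite -[RHS]/(fine (_)%:E) -e.
Qed.

(** The binomial masses sum to 1, so almost surely the next state is one of
[0, ..., n]. *)
Let total_mass t s G : 0 <= s t <= n%:R -> measurable G ->
  pr (history t s `&` G) =
  \sum_(k < n.+1) pr (history t.+1 (extend t s k%:R) `&` G).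
Proof.
move=> hs mG; pose E := history t s; have mE : measurable E by exact: history_measurable.
pose V (k : nat) := [set w | X t.+1 w = k%:R].
have mV k : measurable (V k) by exact: value_measurable.
pose W K := [set w | forall k, (k < K)%N -> X t.+1 w <> k%:R].
have mW K : measurable (W K).
  have -> : W K = \bigcap_(k in [set k | (k < K)%N]) ~` V k.
    by apply/seteqP; split => w /= h k; exact: h.
  by apply: bigcap_measurableType => k _; apply: measurableC.
have main K A : measurable A -> pr A = \sum_(k < K) pr (A `&` V k) + pr (A `&` W K).
  move=> mA; elim: K => [|K IH].
    rewrite big_ord0 add0r (_ : W 0%N = setT) ?setIT //.
    by apply/seteqP; split.
  rewrite big_ord_recr /= IH -addrA; congr (_ + _).
  rewrite (pr_split (measurableI _ _ mA (mW K)) (mV K)); congr (_ + _); congr pr.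
    apply/seteqP; split => w /= => [[[]]|[]] //.
    move=> Aw Vw; do ! split => //; move=> k kK; rewrite Vw => /eqP.
    by rewrite eqr_nat => /eqP kE; rewrite kE ltnn in kK.
  apply/seteqP; split => w /= => [[[Aw Ww] nV]|[Aw Ww]].
    split => // k; rewrite ltnS leq_eqVlt => /orP[/eqP -> //|kK]; exact: Ww.
  by do ! split => //; [move=> k kK; apply: Ww; exact: ltnW|exact: Ww].
have E0 : pr (E `&` W n.+1) = 0.
  have := main n.+1 E mE.
  under eq_bigr do rewrite pr_step //.
  rewrite -mulr_sumr.
  have -> : \sum_(i < n.+1) binomial_pmf n (f (s t / n%:R)) i = 1.
    by rewrite -[RHS](binE_cst n (f (s t / n%:R)) 1) binE_pmf; apply: eq_bigr => i _; rewrite mulr1.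
  rewrite -/E; lra.
rewrite (main n.+1 (E `&` G)); last exact: measurableI.
have -> : pr (E `&` G `&` W n.+1) = 0.
  apply/le_anti; rewrite pr_ge0 andbT -E0; apply: pr_le.
  - by apply: measurableI => //; exact: measurableI.
  - exact: measurableI.
  - by move=> w [[]].
rewrite addr0; apply: eq_bigr => k _; rewrite history_extend; congr pr.
by apply/seteqP; split => w /=; tauto.
Qed.

(** Consensus is absorbing because [f] fixes 0 and 1. *)
Lemma consensus_iter t (v : R) : consensus n v = 1 -> iter t (step f n) (consensus n) v = 1.
Proof.
move=> hv; have e : v = n%:R \/ v = 0.
  move: hv; rewrite /consensus; case: ifP => [/orP[/eqP ->|/eqP h] _|_ /eqP].
  - by left.
  - by right; lra.
  - by rewrite eq_sym oner_eq0.
have c0 : consensus n (0 : R) = 1 by rewrite /consensus subr0 eqxx orbT.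
have cn : consensus n (n%:R : R) = 1 by rewrite /consensus eqxx.
have f1 : f 1 = 1.
  by have := update_reflect hf (x := 0) ltac:(lra); rewrite (update0 hf) !subr0.
have bin0 N (G : R -> R) : binE N 0 G = G 0 by elim: N => //= N ->; rewrite mul0r add0r subr0 mul1r.
have bin1 N (G : R -> R) : binE N 1 G = G N%:R.
  elim: N G => //= N IH G; rewrite subrr mul0r addr0 mul1r IH.
  by rewrite natr1.
have h0 j : iter j (step f n) (consensus n) 0 = 1.
  by elim: j => // j IH; rewrite iterS /step mul0r (update0 hf) bin0.
case: e => ->; last exact: h0.
have [n0|n0] := posnP n; first by rewrite [X in X%:R]n0; exact: h0.
elim: t => // t IH; rewrite iterS /step divff ?f1 ?bin1 //.
by rewrite pnatr_eq0 -lt0n.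
Qed.

(** Induction on the remaining rounds, conditioning on the history so far. *)
Let hitting j t s : (forall i, (i <= t)%N -> 0 <= s i <= n%:R) ->
  pr (history t s `&` [set w | exists i, (t <= i <= t + j)%N /\ hit i w]) =
  pr (history t s) * iter j (step f n) (consensus n) (s t).
Proof.
elim: j t s => [|j IH] t s hs.
all: have mH u v : measurable [set w | exists i, (u <= i <= v)%N /\ hit i w].
1,3: have -> : [set w | exists i, (u <= i <= v)%N /\ hit i w] = \bigcup_(i in [set i | (u <= i <= v)%N]) hit i
  by apply/seteqP; split => w /= [i]; [case=> h1 h2; exists i|move=> h1 h2; exists i].
1,2: by apply: bigcup_measurable => i _; exact: hit_measurable.
all: have [c1|c0] := eqVneq (consensus n (s t)) 1.
1,3: rewrite consensus_iter // mulr1; congr pr; apply/seteqP; split => w /=; [by case|].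
1,2: move=> hw; split => //; exists t; rewrite leqnn leq_addr; split => //.
1,2: move: c1; rewrite /consensus /hit /= (hw t (leqnn _)); case: ifP.
1,3: by move=> /orP[/eqP|/eqP]; [left|right].
1,2: by move=> _ /eqP; rewrite eq_sym oner_eq0.
all: have nh w : history t s w -> ~ hit t w.
1,3: move=> hw; rewrite /hit /= (hw t (leqnn _)) => hh; move: c0; rewrite /consensus.
1,2: by case: ifP; rewrite ?eqxx //; case: hh => ->; rewrite eqxx ?orbT.
- have -> : history t s `&` [set w | exists i, (t <= i <= t + 0)%N /\ hit i w] = set0.
    apply/seteqP; split => w //= [hw [i [hi hh]]]; apply: (nh w hw).
    by move: hi; rewrite addn0 -eqn_leq => /eqP ->.
  rewrite /pr measure0 /=; move: c0; rewrite /consensus; case: ifP; rewrite ?eqxx // => _ _.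
  by rewrite mulr0.
- have -> : history t s `&` [set w | exists i, (t <= i <= t + j.+1)%N /\ hit i w] =
     history t s `&` [set w | exists i, (t.+1 <= i <= t.+1 + j)%N /\ hit i w].
    apply/seteqP; split => w /= [hw [i [hi hh]]]; split => //; exists i; split => //.
      move: hi; rewrite leq_eqVlt addSnnS => /andP[/orP[/eqP ti|->] //].
      by rewrite -ti in hh; have := nh w hw hh.
    by move: hi; rewrite addSnnS => /andP[/ltnW -> ->].
  rewrite total_mass ?hs //.
  rewrite iterS /step binE_pmf mulr_sumr; apply: eq_bigr => k _.
  have kn : 0 <= (k%:R : R) <= n%:R by apply: nat_state; rewrite -ltnS.
  rewrite IH; last first.
    by move=> i _; rewrite /extend; case: ifP => // it; exact: hs.
  rewrite history_extend pr_step ?hs // /extend ltnn mulrA.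
  by [].
Qed.

Lemma hitting_law t :
  P [set w | exists i, (i <= t)%N /\ hit i w] =
  (iter t (step f n) (consensus n) x0)%:E.
Proof.
have [hx h0 _] := hX.
pose A := [set w | exists i, (i <= t)%N /\ hit i w].
have mA : measurable A.
  have -> : A = \bigcup_(i in [set i | (i <= t)%N]) hit i.
    by apply/seteqP; split => w /= [i]; [case=> h1 h2; exists i|move=> h1 h2; exists i].
  by apply: bigcup_measurable => i _; exact: hit_measurable.
have H0 : history 0 (fun=> x0) = [set w | X 0%N w = x0].
  apply/seteqP; split => w /=; first by apply.
  by move=> hw i; rewrite leqn0 => /eqP ->.
have p1 : pr (history 0 (fun=> x0)) = 1 by rewrite H0 /pr h0.
have := @hitting t 0 (fun=> x0) (fun _ _ => hx).
rewrite p1 mul1r add0n => <-.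
rewrite prE //; congr EFin.
rewrite (pr_split mA (history_measurable 0 (fun=> x0))).
have -> : pr (A `&` ~` history 0 (fun=> x0)) = 0.
  have mC := measurableC (history_measurable 0 (fun=> x0)).
  apply/le_anti; rewrite pr_ge0 andbT.
  apply: (@le_trans _ _ (pr (~` history 0 (fun=> x0)))).
    by apply: pr_le => //; exact: measurableI.
  have := pr_split (@measurableT _ T) (history_measurable 0 (fun=> x0)).
  rewrite !setTI p1 /pr probability_setT /=; lra.
by rewrite addr0 setIC.
Qed.

Lemma runtime_lt (r : \bar R) w :
  (runtime n (fun t => X t) w < r)%E <-> exists t, (t%:R%:E < r)%E /\ hit t w.
Proof.
rewrite /runtime; split.
  by move=> /ereal_inf_lt[_ [t ht <-]] tr; exists t.
move=> [t [tr ht]]; apply: le_lt_trans tr; apply: ereal_inf_lbound.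
by exists t.
Qed.


(** The infimum defining [runtime] is attained, being taken over natural numbers. *)
Lemma runtime_le (r : R) w :
  (runtime n (fun t => X t) w <= r%:E)%E <-> exists t, t%:R <= r /\ hit t w.
Proof.
split=> [h|[t [tr ht]]]; last first.
  have le : (runtime n (fun t => X t) w <= t%:R%:E)%E by apply: ereal_inf_lbound; exists t.
  by apply: (le_trans le); rewrite lee_fin.
have : (runtime n (fun t => X t) w < (Num.floor r + 1)%:~R%:E)%E.
  by apply: (le_lt_trans h); rewrite lte_fin; exact: floorD1_gt.
move=> /runtime_lt[t [ht hh]]; exists t; split => //.
move: ht; rewrite lte_fin -[t%:R]/(t%:Z%:~R) ltr_int ltzD1 => ht.
by apply: le_trans (floor_le_tmp r); rewrite ler_int.
Qed.

Lemma runtime_measurable (c : R) :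
  measurable_fun [set: T] (fun w => (runtime n (fun t => X t) w - c%:E)%E).
Proof.
apply: (measurability _ (ErealGenInftyO.measurableE R)) => _ [_ [r ->] <-].
rewrite setTI.
have -> : (fun w => (runtime n (fun t => X t) w - c%:E)%E) @^-1` `]-oo, r%:E[%classic =
   \bigcup_(t in [set t : nat | (t%:R%:E < r%:E + c%:E)%E]) hit t.
  have e w : (runtime n (fun t => X t) w - c%:E < r%:E)%E =
      (runtime n (fun t => X t) w < r%:E + c%:E)%E by rewrite lteBlDr.
  apply/seteqP; split => w; move: (e w) => /= ew; rewrite in_itv /= ew.
    by move=> /runtime_lt[t [h1 h2]]; exists t.
  by move=> [t h1 h2]; apply/runtime_lt; exists t.
by apply: bigcup_measurable => t _; exact: hit_measurable.
Qed.

End ProcessLaw.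

(** * The law of the limit *)

Section LimitLaw.
Context {R : realType} (f : R -> R) (m : nat) (beta gamma : R).
Context (hf : majority_type f m beta gamma).
Context (d x y : R).
Context (dZ : measure_display) (TZ : measurableType dZ) (Q : probability TZ R)
  (Z : {RV Q >-> R}).
Context (hZ : forall A : set R, measurable A ->
  distribution Q Z A = normal_prob d (limit_sd gamma) A).

Definition limit_value (z : R) : R :=
  (Num.floor (h_fun f m gamma (x - logb gamma `|z|) + y))%:~R.

Lemma limit_value_measurable : measurable_fun [set: R] limit_value.
Proof.
have mono : {homo (fun z => (Num.floor (h_fun f m gamma z + y))%:~R : R) : u v / u <= v}.
  move=> u v; rewrite le_eqVlt => /orP[/eqP -> //|uv].
  by rewrite ler_int le_floor // lerD2r ltW // (h_lt hf).
apply: (measurableT_comp (nondecreasing_measurable measurableT mono)).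
apply: measurable_funB; first exact: measurable_cst.
apply: measurable_funM; last exact: measurable_cst.
by apply: (measurableT_comp (@measurable_ln R)); exact: normr_measurable.
Qed.

Definition two_sided_tail (rho : R) : R :=
  ncdf 0 1 ((- rho - d) / limit_sd gamma) + (1 - ncdf 0 1 ((rho - d) / limit_sd gamma)).

Let N : probability (measurableTypeR R) R := normal_prob d (limit_sd gamma).

Let null1 (a : R) : N [set a] = 0%E.
Proof.
have /null_content_dominatesP h := normal_prob_dominates d (limit_sd gamma).
by apply: h; [exact: measurable_set1|exact: lebesgue_measure_set1].
Qed.

Let normal_sub (A B : set R) (a b c : R) : measurable A -> measurable B ->
  (forall z, A z -> B z \/ z \in [:: a; b; c]) -> (N A <= N B)%E.
Proof.
move=> mA mB AB; have m1 v : measurable [set v : R] by exact: measurable_set1.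
rewrite -(@measureU0 _ _ _ N _ _ mB (m1 a) (null1 a)).
have mBa := measurableU _ _ mB (m1 a).
rewrite -(@measureU0 _ _ _ N _ _ mBa (m1 b) (null1 b)).
have mBb := measurableU _ _ mBa (m1 b).
rewrite -(@measureU0 _ _ _ N _ _ mBb (m1 c) (null1 c)).
apply: le_measure; rewrite ?inE //; first exact: measurableU.
move=> z /AB[Bz|]; first by left; left; left.
rewrite !inE => /or3P[] /eqP ->; [by left; left; right|by left; right|by right].
Qed.

Let normal_tail rho : 0 <= rho ->
  N (`]-oo, (- rho)] `|` `]rho, +oo[) = (two_sided_tail rho)%:E.
Proof.
move=> r0; have s0 := limit_sd_gt0 hf.
have -> : `]rho, +oo[%classic = ~` `]-oo, rho]%classic :> set R.
  by rewrite setCitvl.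
rewrite measureU //; last 2 first.
- exact: measurableC.
- apply/seteqP; split => z //=; rewrite !in_itv /= => -[h1 h2]; apply: h2.
  by apply: (le_trans h1); lra.
rewrite [X in (_ + X)%E](probability_setC N) // /two_sided_tail EFinD EFinB.
by rewrite -!(@ncdf_scale _ d) // !ncdfE.
Qed.

(** Since [h] crosses each level once, the limit is at most [r] when [`|Z|]
exceeds the level belonging to the crossing point. The points where the
inequalities leave this open form a null set for the normal law. *)
Lemma limit_value_tail (r : R) : exists zc,
  [/\ forall z, z < zc -> h_fun f m gamma z + y < (Num.floor r)%:~R + 1,
      forall z, zc < z -> (Num.floor r)%:~R + 1 < h_fun f m gamma z + y
    & Q [set w | limit_value (Z w) <= r] = (two_sided_tail (gamma `^ (x - zc)))%:E].
Proof.
set k : R := _%:~R.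
have [zc [hlo hhi]] := h_crossing hf (k + 1 - y).
exists zc; split=> [z /hlo|z /hhi|]; [lra|lra|].
have g1 := mt_gamma_gt1 hf; have g0 : 0 < gamma by lra.
have lg : 0 < ln gamma by rewrite ln_gt0.
pose rho := gamma `^ (x - zc); have r0 : 0 < rho by rewrite powR_gt0.
pose A := [set z | limit_value z <= r].
have mA : measurable A.
  rewrite (_ : A = limit_value @^-1` `]-oo, r]%classic).
    by rewrite -[X in measurable X]setTI; exact: limit_value_measurable.
  by apply/seteqP; split => z /=; rewrite in_itv.
have AE z : A z <-> h_fun f m gamma (x - logb gamma `|z|) + y < k + 1.
  rewrite /A /limit_value /k /= -intrD1 -floor_lt_int.
  by rewrite ltzD1 floor_ge_int.
have cmp (z : R) : z != 0 -> (logb gamma `|z| < x - zc) = (`|z| < rho).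
  move=> z0; have az : 0 < `|z| by rewrite normr_gt0.
  by rewrite /logb ltr_pdivrMr // /rho -[in RHS](lnK (x := `|z|)) ?posrE // /powR gt_eqF // ltr_expR.
have cmp' (z : R) : z != 0 -> (x - zc < logb gamma `|z|) = (rho < `|z|).
  move=> z0; have az : 0 < `|z| by rewrite normr_gt0.
  by rewrite /logb ltr_pdivlMr // /rho -[in RHS](lnK (x := `|z|)) ?posrE // /powR gt_eqF // ltr_expR.
rewrite -(normal_tail (ltW r0)).
rewrite -[LHS]/(distribution Q Z A) hZ // -/N.
pose B : set R := `]-oo, (- rho)] `|` `]rho, +oo[.
have mB : measurable B by apply: measurableU.
apply/le_anti/andP; split.
  apply: (@normal_sub _ _ 0 rho rho mA mB) => z /AE hz.
  have [-> |z0] := eqVneq z 0; first by right; rewrite inE eqxx.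
  have [e|zr] := eqVneq z rho; first by right; rewrite e !inE eqxx /= orbT.
  have : ~~ (`|z| < rho).
    rewrite -cmp //; apply/negP => lt.
    by have := hhi (x - logb gamma `|z|) ltac:(lra); lra.
  rewrite -leNgt /B /= !in_itv /= andbT; case: (ger0P z) => _ h.
    by left; right; rewrite lt_neqAle eq_sym zr.
  by left; left; lra.
apply: (@normal_sub _ _ (- rho) 0 0 mB mA) => z hz.
have [-> |zr] := eqVneq z (- rho); first by right; rewrite inE eqxx.
have z0 : z != 0.
  by apply/eqP => z0; move: hz; rewrite /B z0 /= !in_itv /=; case; lra.
left; apply/AE; suff : rho < `|z|.
  by rewrite -cmp' // => lt; have := hlo (x - logb gamma `|z|) ltac:(lra); lra.
move: hz; rewrite /B /= !in_itv /= andbT; case=> h; last first.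
  by apply: (lt_le_trans h); exact: ler_norm.
have lt : z < - rho by rewrite lt_neqAle zr.
by rewrite -normrN; apply: (@lt_le_trans _ _ (- z)); [lra|exact: ler_norm].
Qed.

Lemma two_sided_tail_continuous : continuous two_sided_tail.
Proof.
have cN : continuous (@ncdf R 0 1).
  by move=> u; apply: derive_continuous; apply: ncdf_derive; rewrite oner_eq0.
move=> u; apply: cvgD; last apply: cvgB; last 1 first.
- apply: (@cvg_comp _ _ _ (fun u => (u - d) / limit_sd gamma) (ncdf 0 1)); last exact: cN.
  by apply: cvgMr_tmp; apply: cvgB; [exact: cvg_id|exact: cvg_cst].
- apply: (@cvg_comp _ _ _ (fun u => (- u - d) / limit_sd gamma) (ncdf 0 1)); last exact: cN.
  by apply: cvgMr_tmp; apply: cvgB; [apply: cvgN; exact: cvg_id|exact: cvg_cst].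
- exact: cvg_cst.
Qed.

End LimitLaw.

(** * Combining the random and the deterministic rounds *)

Section Assembly.
Context {R : realType} (f : R -> R) (m : nat) (beta gamma : R).
Context (hf : majority_type f m beta gamma).

Lemma sandwich (e w u1 u2 v : R) : `|w - u1| <= e / 2 -> `|w - u2| <= e / 2 ->
  u1 - e / 2 <= v -> v <= u2 + e / 2 -> `|w - v| <= e.
Proof.
by rewrite !ler_norml => /andP[? ?] /andP[? ?] ? ?; apply/andP; split; lra.
Qed.

(** Smooth counterpart of the indicator of [c < `|deviation n v|]. *)
Definition two_sided (n : nat) (c v : R) : R :=
  gauss_test gamma n (- c) v + (1 - gauss_test gamma n c v).

(** In [a] rounds the deviations are stretched by [gamma ^+ a], whereas the test
functions keep their width; relative to the deviations the smoothing vanishes. *)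
Lemma smoothing_error eps eta : 0 < eps -> 0 < eta -> exists a0, forall a, (a0 <= a)%N ->
  ncdf 0 1 (- (gamma ^+ a * eps) / limit_sd gamma) <= eta /\
  1 - eta <= ncdf 0 1 (gamma ^+ a * eps / limit_sd gamma).
Proof.
move=> eps0 eta0; have g1 := mt_gamma_gt1 hf; have s0 := limit_sd_gt0 hf.
have [A [_ hA]] : \forall u \near -oo, ncdf 0 1 u < eta by apply: (cvgr_lt _ (ncdf_Ny 0 1)).
have [B [_ hB]] : \forall u \near +oo, 1 - eta < ncdf 0 1 u.
  by apply: (cvgr_gt _ (ncdf_y 0 1)); lra.
pose C := `|A| + `|B| + 1.
have hc : \forall a \near \oo, C * limit_sd gamma / eps <= gamma ^+ a.
  have i1 : `|gamma^-1| < 1 by rewrite ger0_norm ?invr_ge0 ?invf_lt1 //; lra.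
  have D0 : 0 < C * limit_sd gamma / eps.
    by rewrite divr_gt0 // mulr_gt0 // /C ltr_wpDl // addr_ge0.
  have h : \forall a \near \oo, gamma^-1 ^+ a < (C * limit_sd gamma / eps)^-1.
    by apply: (cvgr_lt _ (cvg_expr i1)); rewrite invr_gt0.
  apply: filterS h => a; rewrite exprVn ltf_pV2 ?posrE ?exprn_gt0 //; first exact: ltW.
  exact: gamma_gt0 hf.
have [a0 _ ha0] := hc; exists a0 => a /ha0 /=; rewrite ler_pdivrMr // => h.
have {}h : C <= gamma ^+ a * eps / limit_sd gamma by rewrite ler_pdivlMr.
have nA := ler_norm (- A); have nB := ler_norm B; rewrite normrN in nA.
have A0 := normr_ge0 A; have B0 := normr_ge0 B.
split; apply: ltW; [apply: hA; rewrite mulNr|apply: hB]; rewrite /C in h; lra.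
Qed.

Section Smoothing.
Context (x0 : nat -> R) (d : R).
Context (hx0 : forall n, 0 <= x0 n <= n%:R).
Context (hdev : deviation n (x0 n) @[n --> \oo] --> d).

Lemma two_sided_limit a c e :
  iter a (step f n) (fun v => two_sided n (gamma ^+ a * c) v + e) (x0 n) @[n --> \oo]
    --> two_sided_tail gamma d c + e.
Proof.
have -> : (fun n => iter a (step f n) (fun v => two_sided n (gamma ^+ a * c) v + e) (x0 n)) =
  (fun n => iter a (step f n) (gauss_test gamma n (gamma ^+ a * (- c))) (x0 n) +
    (1 - iter a (step f n) (gauss_test gamma n (gamma ^+ a * c)) (x0 n)) + e).
  apply/funext => n.
  have -> : (fun v => two_sided n (gamma ^+ a * c) v + e) =
    (fun v => 1 * gauss_test gamma n (gamma ^+ a * (- c)) v +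
      1 * ((1 + e) * 1 + (- 1) * gauss_test gamma n (gamma ^+ a * c) v)).
    by apply/funext => v; rewrite /two_sided mulrN; ring.
  by rewrite !iter_step_lin iter_step_cst; ring.
apply: cvgD; last exact: cvg_cst.
apply: cvgD; first exact: (test_limit hf).
by apply: cvgB; [exact: cvg_cst|exact: (test_limit hf)].
Qed.

Lemma two_sided_outside n a rho eps eta v : 0 <= rho -> 0 <= eps -> 0 <= eta ->
  ncdf 0 1 (- (gamma ^+ a * eps) / limit_sd gamma) <= eta ->
  1 - eta <= ncdf 0 1 (gamma ^+ a * eps / limit_sd gamma) ->
  two_sided n (gamma ^+ a * (rho + eps)) v - (eta + eta) <=
  (if gamma ^+ a * rho <= `|deviation n v| then 1 else 0).
Proof.
move=> rho0 eps0 eta0 h1 h2; have s0 := limit_sd_gt0 hf; have g0 := gamma_gt0 hf.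
have ga : 0 < gamma ^+ a by rewrite exprn_gt0.
have mono u w : u <= w -> ncdf 0 1 (u / limit_sd gamma) <= ncdf 0 1 (w / limit_sd gamma) :> R.
  by move=> uw; apply: ncdf_mono; rewrite ler_pM2r // invr_gt0.
have r0 : 0 <= gamma ^+ a * rho by rewrite mulr_ge0 // ltW.
have q0 : 0 <= gamma ^+ a * eps by rewrite mulr_ge0 // ltW.
rewrite /two_sided /gauss_test mulrDr.
set V := deviation n v; set r := _ * rho; set q := gamma ^+ a * eps.
rewrite -/q in h1 h2 q0; rewrite -/r in r0.
have [hr|] := lerP r `|V|.
  by have b := mono (- (r + q) - V) (r + q - V) ltac:(lra); lra.
rewrite ltr_norml => /andP[v1 v2].
have b1 := mono (- (r + q) - V) (- q) ltac:(lra).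
have b2 := mono q (r + q - V) ltac:(lra).
lra.
Qed.

Lemma two_sided_inside n a rho eps eta v : 0 <= rho -> 0 <= eps -> 0 <= eta ->
  ncdf 0 1 (- (gamma ^+ a * eps) / limit_sd gamma) <= eta ->
  1 - eta <= ncdf 0 1 (gamma ^+ a * eps / limit_sd gamma) ->
  (if `|deviation n v| <= gamma ^+ a * (rho + eps) then 0 else 1) <=
  two_sided n (gamma ^+ a * rho) v + (eta + eta).
Proof.
move=> rho0 eps0 eta0 h1 h2; have s0 := limit_sd_gt0 hf; have g0 := gamma_gt0 hf.
have ga : 0 < gamma ^+ a by rewrite exprn_gt0.
have mono u w : u <= w -> ncdf 0 1 (u / limit_sd gamma) <= ncdf 0 1 (w / limit_sd gamma) :> R.
  by move=> uw; apply: ncdf_mono; rewrite ler_pM2r // invr_gt0.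
have r0 : 0 <= gamma ^+ a * rho by rewrite mulr_ge0 // ltW.
have q0 : 0 <= gamma ^+ a * eps by rewrite mulr_ge0 // ltW.
rewrite /two_sided /gauss_test mulrDr.
set V := deviation n v; set r := _ * rho; set q := gamma ^+ a * eps.
rewrite -/q in h1 h2 q0; rewrite -/r in r0.
have /andP[a1 _] := ncdf_01 (0 : R) 1 ((- r - V) / limit_sd gamma).
have /andP[_ a2] := ncdf_01 (0 : R) 1 ((r - V) / limit_sd gamma).
have [hr|] := lerP `|V| (r + q); first by lra.
rewrite ltr_normr => /orP[hv|hv].
  by have b := mono (r - V) (- q) ltac:(lra); lra.
by have b := mono q (- r - V) ltac:(lra); lra.
Qed.

Context (ns N M : nat -> nat) (xs ys : nat -> R) (x y : R).
Context (hns : ns i @[i --> \oo] --> \oo).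
Context (hN : \forall i \near \oo, Num.sqrt (ns i)%:R = gamma ^+ N i * gamma `^ xs i).
Context (hM : \forall i \near \oo, ln (ns i)%:R = m%:R ^+ M i * m%:R `^ ys i).
Context (hxs : xs i @[i --> \oo] --> x) (hys : ys i @[i --> \oo] --> y).
Context (hNy : N i @[i --> \oo] --> \oo) (hMy : M i @[i --> \oo] --> \oo).
Context (k : R) (T : nat -> nat).
Context (hT : \forall i \near \oo, (T i)%:R = (N i)%:R + (M i)%:R + k).

Let late a : \forall i \near \oo, (a <= T i)%N.
Proof.
have h := nat_near (a + (Num.truncn `|k|).+1) hNy.
apply: filterS2 h hT => i hi ht; rewrite -(ler_nat R) ht.
have := truncnS_gt `|k|; have := ler_norm (- k); rewrite normrN.
have : (a + (Num.truncn `|k|).+1)%:R <= (N i)%:R :> R by rewrite ler_nat.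
have := ler0n R (M i); rewrite natrD; lra.
Qed.

Let along (u : nat -> R) (l : R) : u n @[n --> \oo] --> l -> u (ns i) @[i --> \oo] --> l.
Proof. by move=> h; apply: (@cvg_comp _ _ _ ns u _ \oo). Qed.

Let level_lt z1 z2 : z1 < z2 -> gamma `^ (x - z2) < gamma `^ (x - z1).
Proof.
have g1 := mt_gamma_gt1 hf; move=> zz.
by rewrite /powR gt_eqF ?(gamma_gt0 hf) // ltr_expR ltr_pM2r ?ln_gt0 //; lra.
Qed.

Let hitting_lower zc z0 e : (forall z, z < zc -> h_fun f m gamma z + y < k + 1) ->
  z0 < zc -> 0 < e -> \forall i \near \oo,
  two_sided_tail gamma d (gamma `^ (x - z0)) - e
    <= iter (T i) (step f (ns i)) (consensus (ns i)) (x0 (ns i)).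
Proof.
move=> hz zz e0; pose q := e / 4; have q0 : 0 < q by rewrite /q; lra.
pose del := (zc - z0) / 3; have d0 : 0 < del by rewrite /del; lra.
pose rho := gamma `^ (x - (z0 + del)).
pose eps := gamma `^ (x - z0) - rho.
have rho0 : 0 < rho by rewrite powR_gt0 // (gamma_gt0 hf).
have eps0 : 0 < eps by rewrite subr_gt0; apply: level_lt; lra.
have [|||a0 ha0] := @fast_total _ _ _ _ _ hf _ _ _ _ _ _ _ hns hN hM hxs hys hNy hMy _ _ hT
  (z0 + 2 * del) (z0 + (5/2) * del) rho q _ _ _ q0; first by lra.
- by apply: hz; rewrite /del; lra.
- by apply: level_lt; lra.
have [a1 ha1] := smoothing_error eps0 q0.
pose a := (a0 + a1 + 1)%N.
have {}ha0 := ha0 a ltac:(lia); have {ha1}[s1 s2] := ha1 a ltac:(lia).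
have hl := along (@two_sided_limit a (rho + eps) (- (q + q) - q)).
have {}hl : \forall i \near \oo, two_sided_tail gamma d (rho + eps) + (- (q + q) - q) - q <
  iter a (step f (ns i)) (fun v => two_sided (ns i) (gamma ^+ a * (rho + eps)) v + (- (q + q) - q)) (x0 (ns i)).
  by apply: (cvgr_gt _ hl); lra.
have er : rho + eps = gamma `^ (x - z0) by rewrite /eps; ring.
near=> i.
have ht : (a <= T i)%N by near: i; exact: late.
rewrite -(subnKC ht) iterD.
have hl' : two_sided_tail gamma d (rho + eps) + (- (q + q) - q) - q <
  iter a (step f (ns i)) (fun v => two_sided (ns i) (gamma ^+ a * (rho + eps)) v + (- (q + q) - q)) (x0 (ns i)) by near: i.
rewrite er in hl'.
have eq4 : two_sided_tail gamma d (gamma `^ (x - z0)) - e =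
  two_sided_tail gamma d (gamma `^ (x - z0)) + (- (q + q) - q) - q by rewrite /q; field.
rewrite eq4; apply: (le_trans (ltW hl')).
rewrite -er; apply: (iter_step_le hf (hx0 _)); first by rewrite /a addn1.
move=> j hj.
have hf' : forall j, (j <= ns i)%N -> gamma ^+ a * rho <= `|deviation (ns i) (j%:R : R)| ->
    1 - q <= iter (T i - a) (step f (ns i)) (consensus (ns i)) j%:R by near: i.
have key := two_sided_outside (ns i) j%:R (ltW rho0) (ltW eps0) (ltW q0) s1 s2.
have /andP[b0 _] := iter_step_01 hf (T i - a) hj; have b1 := hf' j hj.
move: (iter _ _ _ _) (two_sided _ _ _) key b0 b1 => A G.
by case: ifP => _ key b0 b1; [have := b1 isT; move: key|move: key b0 q0]; lra_goal.
Unshelve. all: by end_near. Qed.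

Let hitting_upper zc z0 e : (forall z, zc < z -> k + 1 < h_fun f m gamma z + y) ->
  zc < z0 -> 0 < e -> \forall i \near \oo,
  iter (T i) (step f (ns i)) (consensus (ns i)) (x0 (ns i))
    <= two_sided_tail gamma d (gamma `^ (x - z0)) + e.
Proof.
move=> hz zz e0; pose q := e / 4; have q0 : 0 < q by rewrite /q; lra.
pose del := (z0 - zc) / 3; have d0 : 0 < del by rewrite /del; lra.
pose rho := gamma `^ (x - z0).
pose eps := gamma `^ (x - (z0 - del)) - rho.
have rho0 : 0 < rho by rewrite powR_gt0 // (gamma_gt0 hf).
have eps0 : 0 < eps by rewrite subr_gt0; apply: level_lt; lra.
have er : rho + eps = gamma `^ (x - (z0 - del)) by rewrite /eps; ring.
have [||a0 ha0] := @slow_total _ _ _ _ _ hf _ _ _ _ _ _ _ hns hN hM hxs hys hNy hMy _ _ hT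
  (z0 - 2 * del) (rho + eps) q _ _ q0.
- by apply: hz; rewrite /del; lra.
- by rewrite er; apply: level_lt; lra.
have [a1 ha1] := smoothing_error eps0 q0.
pose a := (a0 + a1 + 1)%N.
have {}ha0 := ha0 a ltac:(lia); have {ha1}[s1 s2] := ha1 a ltac:(lia).
have hl := along (@two_sided_limit a rho (q + q + q)).
have {}hl : \forall i \near \oo,
  iter a (step f (ns i)) (fun v => two_sided (ns i) (gamma ^+ a * rho) v + (q + q + q)) (x0 (ns i))
  < two_sided_tail gamma d rho + (q + q + q) + q.
  by apply: (cvgr_lt _ hl); lra.
near=> i.
have ht : (a <= T i)%N by near: i; exact: late.
rewrite -(subnKC ht) iterD.
have hl' : iter a (step f (ns i)) (fun v => two_sided (ns i) (gamma ^+ a * rho) v + (q + q + q)) (x0 (ns i))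
  < two_sided_tail gamma d rho + (q + q + q) + q by near: i.
rewrite /rho in hl'.
have eq4 : two_sided_tail gamma d (gamma `^ (x - z0)) + e =
  two_sided_tail gamma d (gamma `^ (x - z0)) + (q + q + q) + q by rewrite /q; field.
rewrite eq4; apply: le_trans (ltW hl').
apply: (iter_step_le hf (hx0 _)); first by rewrite /a addn1.
move=> j hj.
have hf' : forall j, (j <= ns i)%N -> `|deviation (ns i) (j%:R : R)| <= gamma ^+ a * (rho + eps) ->
    iter (T i - a) (step f (ns i)) (consensus (ns i)) j%:R <= q by near: i.
have key := two_sided_inside (ns i) j%:R (ltW rho0) (ltW eps0) (ltW q0) s1 s2.
have /andP[_ b0] := iter_step_01 hf (T i - a) hj; have b1 := hf' j hj.
rewrite -/rho.
move: (iter _ _ _ _) (two_sided _ _ _) key b0 b1 => A G.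
by case: ifP => _ key b0 b1; [have := b1 isT; move: key|move: key b0 q0]; lra_goal.
Unshelve. all: by end_near. Qed.

(** The first [a] rounds are random and governed by [two_sided_limit], the others
are deterministic up to small errors; first [n] and then [a] tends to
infinity. Both bounds are taken at levels next to the crossing point and
approach each other by continuity of [two_sided_tail]. *)
Lemma hitting_limit zc : (forall z, z < zc -> h_fun f m gamma z + y < k + 1) ->
  (forall z, zc < z -> k + 1 < h_fun f m gamma z + y) ->
  iter (T i) (step f (ns i)) (consensus (ns i)) (x0 (ns i)) @[i --> \oo]
    --> two_sided_tail gamma d (gamma `^ (x - zc)).
Proof.
move=> hlo hhi; pose W z := two_sided_tail gamma d (gamma `^ (x - z)).
have cW : {for zc, continuous W}.
  apply: (@cvg_comp _ _ _ (fun z => gamma `^ (x - z)) (two_sided_tail gamma d));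
    last exact: two_sided_tail_continuous.
  apply: (@cvg_comp _ _ _ (fun z => x - z) (fun z => gamma `^ z));
    last exact: (powR_continuous (gamma_gt0 hf)).
  by apply: cvgB; [exact: cvg_cst|exact: cvg_id].
apply/cvgrPdist_le => e e0; have e2 : 0 < e / 2 by lra.
have /cvgrPdist_le/(_ _ e2) [/= r r0 hr] := cW.
have near1 z : - r < zc - z < r -> `|W zc - W z| <= e / 2.
  by move=> hz; apply: hr; rewrite /= ltr_norml.
have d1 := hitting_lower hlo (z0 := zc - r / 2) ltac:(lra) e2.
have d2 := hitting_upper hhi (z0 := zc + r / 2) ltac:(lra) e2.
have w1 := near1 (zc - r / 2) ltac:(lra); have w2 := near1 (zc + r / 2) ltac:(lra).
by apply: filterS2 d1 d2 => i c1 c2; exact: (sandwich w1 w2 c1 c2).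
Qed.

End Smoothing.
End Assembly.

(** * Integer parts and the conclusion *)

Section IntegerParts.
Context {R : realType}.

Lemma floor_nat (u : R) : 0 <= u -> (`|Num.floor u|%N)%:R = (Num.floor u)%:~R :> R.
Proof. by move=> u0; rewrite natr_absz ger0_norm // floor_ge0. Qed.

Lemma floor_nat_cvgy (u : nat -> R) : (forall C, \forall i \near \oo, C <= u i) ->
  `|Num.floor (u i)|%N @[i --> \oo] --> \oo.
Proof.
move=> hu; apply/cvgnyPge => A; apply: filterS (hu A%:R) => i h.
by rewrite -(ler_nat R) floor_nat ?(le_trans _ h) // -[A%:R]/(A%:Z%:~R) ler_int floor_ge_int.
Qed.

Lemma increasing_cvgy (ns : nat -> nat) : (forall i j, (i < j)%N -> (ns i < ns j)%N) ->
  ns i @[i --> \oo] --> \oo.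
Proof.
move=> hns; have le i : (i <= ns i)%N.
  by elim: i => // i IH; apply: leq_ltn_trans IH _; apply: hns.
by apply/cvgnyPge => A; exists A => // i /= Ai; exact: leq_trans (le i).
Qed.

Lemma powR_logb (b u : R) : 1 < b -> 0 < u -> b `^ logb b u = u.
Proof.
move=> b1 u0; have lb : 0 < ln b by rewrite ln_gt0.
rewrite /powR gt_eqF; last lra.
by rewrite /logb mulfVK ?gt_eqF // lnK // posrE.
Qed.

Lemma powR_floor (b u : R) : 1 < b -> 0 <= u ->
  b `^ u = b ^+ `|Num.floor u|%N * b `^ (u - (Num.floor u)%:~R).
Proof.
move=> b1 u0; have b0 : 0 < b by lra.
rewrite -powR_mulrn ?(ltW b0) // floor_nat // -powRD; last by rewrite (gt_eqF b0) implybT.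
by congr powR; ring.
Qed.

Lemma deviation_cvg (x0 : nat -> R) (d : R) :
  (fun n : nat => x0 n - (n%:R / 2 + d * Num.sqrt n%:R))
    =o_\oo (fun n : nat => Num.sqrt (n%:R : R)) ->
  deviation n (x0 n) @[n --> \oo] --> d.
Proof.
move=> /eqoP h; apply/cvgrPdist_le => e e0.
have hpos : \forall n \near \oo, (0 < n)%N by exists 1%N.
apply: filterS2 (h e e0) hpos => n hn n0.
have s0 : 0 < Num.sqrt (n%:R : R) by rewrite sqrtr_gt0 ltr0n.
have -> : d - deviation n (x0 n) =
  - ((x0 n - (n%:R / 2 + d * Num.sqrt n%:R)) / Num.sqrt n%:R).
  by rewrite /deviation; field; rewrite gt_eqF.
by rewrite normrN normrM normfV ler_pdivrMr ?normr_gt0 ?gt_eqF.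
Qed.

End IntegerParts.

Lemma runtime_law (R : realType) (f : R -> R) (m : nat) (beta gamma : R)
    (hf : majority_type f m beta gamma) (n : nat) (x0 : R)
    (d : measure_display) (T : measurableType d) (P : probability T R)
    (X : nat -> {RV P >-> R}) (hX : majority_process f n x0 X) (c : int) (r : R) :
  0 <= c + Num.floor r ->
  P [set w | (runtime n (fun t => X t) w - (c%:~R : R)%:E <= r%:E)%E] =
  (iter (absz (c + Num.floor r)) (step f n) (consensus n) x0)%:E.
Proof.
move=> c0; rewrite -(hitting_law hf hX); congr (P _); apply/seteqP.
have e w : (runtime n (fun t => X t) w - (c%:~R : R)%:E <= r%:E)%E =
    (runtime n (fun t => X t) w <= (r + c%:~R)%:E)%E by rewrite leeBlDr.
have tE t : (t <= absz (c + Num.floor r)%R)%N = (t%:R <= r + c%:~R :> R).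
  rewrite -lez_nat gez0_abs // addrC -[in RHS]/(t%:Z%:~R).
  by rewrite -floor_ge_int floorDrz ?intr_int // intrKfloor.
by split => w /=; move: (e w) => /= ->; rewrite runtime_le => -[t [ht hh]]; exists t;
  rewrite ?tE // -?tE.
Qed.

Theorem corollary1p5 (R : realType) (d : R)
    (f : R -> R) (m : nat) (beta gamma : R)
    (hf : majority_type f m beta gamma)
    (x0 : nat -> R)
    (hx0 : (fun n : nat => x0 n - (n%:R / 2 + d * Num.sqrt n%:R))
             =o_\oo (fun n : nat => Num.sqrt (n%:R : R)))
    (dX : nat -> measure_display) (T : forall n, measurableType (dX n))
    (P : forall n, probability (T n) R)
    (X : forall n, nat -> {RV (P n) >-> R})
    (hX : forall n, majority_process f n (x0 n) (X n))
    (dZ : measure_display) (TZ : measurableType dZ) (Q : probability TZ R)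
    (Z : {RV Q >-> R})
    (hZ : forall A : set R, measurable A ->
      distribution Q Z A =
      normal_prob d (Num.sqrt (1 / (4 * (gamma ^+ 2 - 1)))) A)
    (x y : R) (hx : 0 <= x < 1) (hy : 0 <= y < 1)
    (ns : nat -> nat) (hns : forall i j, (i < j)%N -> (ns i < ns j)%N)
    (hnx : 1 / 2 * logb gamma (ns i)%:R
             - (Num.floor (1 / 2 * logb gamma (ns i)%:R))%:~R
           @[i --> \oo] --> x)
    (hny : logb m%:R (ln (ns i)%:R)
             - (Num.floor (logb m%:R (ln ((ns i)%:R : R))))%:~R
           @[i --> \oo] --> y) :
  cvg_in_distribution (fun i => P (ns i))
    (fun i w => (runtime (ns i) (X (ns i)) w
       - ((Num.floor (1 / 2 * logb gamma (ns i)%:R)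
           + Num.floor (logb m%:R (ln ((ns i)%:R : R))))%:~R : R)%:E)%E)
    Q
    (fun w => ((Num.floor (h_fun f m gamma (x - logb gamma `|Z w|) + y))%:~R
               : R)%:E).
Proof.
have g1 := mt_gamma_gt1 hf.
have m1 : 1 < m%:R :> R by exact: (m_gt1 hf).
have lg : 0 < ln gamma by rewrite ln_gt0.
have lm : 0 < ln (m%:R : R) by rewrite ln_gt0.
split=> [i||r _]; first exact: runtime_measurable.
  apply/measurable_EFinP.
  exact: (measurableT_comp (limit_value_measurable hf x y) (measurable_funP Z)).
have hdev := deviation_cvg hx0.
have hstate n : 0 <= x0 n <= n%:R by have [] := hX n.
have hny' := increasing_cvgy hns.
pose u i : R := 1 / 2 * logb gamma (ns i)%:R.
pose w i : R := logb m%:R (ln (ns i)%:R).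
have ularge C : \forall i \near \oo, C <= u i.
  apply: filterS (ln_ns_large hny' (C * 2 * ln gamma)) => i h.
  by rewrite /u /logb -ler_pdivrMl // invf_div divr1 mulrC ler_pdivlMr.
have wlarge C : \forall i \near \oo, C <= w i.
  apply: filterS (ln_ns_large hny' (expR (C * ln m%:R))) => i h.
  rewrite /w /logb ler_pdivlMr // -[leLHS]expRK ler_ln ?posrE ?expR_gt0 //.
  by apply: lt_le_trans h; exact: expR_gt0.
pose N i := `|Num.floor (u i)|%N; pose M i := `|Num.floor (w i)|%N.
pose xs i := u i - (Num.floor (u i))%:~R; pose ys i := w i - (Num.floor (w i))%:~R.
have npos := nat_near 1 hny'.
have hN : \forall i \near \oo, Num.sqrt (ns i)%:R = gamma ^+ N i * gamma `^ xs i.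
  apply: filterS2 npos (ularge 0) => i n1 ui.
  rewrite -powR_floor // /u mulrC powRrM powR_logb // ?ltr0n //.
  by rewrite mul1r powR12_sqrt.
have hM : \forall i \near \oo, ln (ns i)%:R = m%:R ^+ M i * m%:R `^ ys i.
  apply: filterS2 (ln_ns_large hny' 1) (wlarge 0) => i n1 wi.
  by rewrite -powR_floor // powR_logb // (lt_le_trans _ n1).
have hNy : N i @[i --> \oo] --> \oo := floor_nat_cvgy ularge.
have hMy : M i @[i --> \oo] --> \oo := floor_nat_cvgy wlarge.
pose t i := absz (Num.floor (u i) + Num.floor (w i) + Num.floor r).
have tpos : \forall i \near \oo, 0 <= Num.floor (u i) + Num.floor (w i) + Num.floor r.
  apply: filterS2 (ularge `|(Num.floor r)%:~R|) (wlarge 0) => i ui wi.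
  have : (- Num.floor r <= Num.floor (u i)) by rewrite floor_ge_int intrN (le_trans _ ui) // -normrN ler_norm.
  have : 0 <= Num.floor (w i) by rewrite floor_ge0.
  by move=> h1 h2; rewrite addrAC addr_ge0 // -lerBlDr sub0r.
have hT : \forall i \near \oo, (t i)%:R = (N i)%:R + (M i)%:R + (Num.floor r)%:~R :> R.
  near=> i; have ui : 0 <= u i by near: i.
  have wi : 0 <= w i by near: i.
  have ti : 0 <= Num.floor (u i) + Num.floor (w i) + Num.floor r by near: i.
  by rewrite natr_absz ger0_norm // !intrD !floor_nat.
have [zc [hlo hhi ->]] := limit_value_tail hf x y hZ r.
have lim := hitting_limit hf hstate hdev hny' hN hM hnx hny hNy hMy hT hlo hhi.
apply: cvg_EFin.
  by apply: filterS tpos => i ti; rewrite (runtime_law hf (hX (ns i))).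
apply: cvg_trans lim; apply: near_eq_cvg.
by apply: filterS tpos => i ti /=; rewrite (runtime_law hf (hX (ns i))).
Unshelve. all: by end_near. Qed.
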